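(* Suppose $N$ and $m$ are both even. For $k\ge1$ let $a_k$ (respectively $b_k$) be the dimension of the Hodge degree $k$ part of the defect $0$ homology $H_0$ (respectively defect $1$ homology $H_1$) of the two-loop hairy graph-complex $0\to\mathcal C_2\to\mathcal C_1\to\mathcal C_0\to 0$ with rational coefficients. Then $$a_k=\begin{cases}\lfloor\frac{k}{6}\rfloor & k\equiv0\bmod2,\\ 0& k\equiv1\bmod2,\end{cases}\qquad b_k=\begin{cases}0& k\equiv0\bmod2,\\ \lfloor\frac{k}{6}\rfloor & k\equiv1\bmod2.\end{cases}$$
   Context: Let $m,N$ be positive integers; all coefficients are in $\mathbb Q$. Graph-complex $\mathcal E^{m,N}_\pi$. It is spanned by connected graphs (self-loops and multiple edges allowed) with a non-empty finite set of unlabeled external vertices of valence $1$ and a possibly empty finite set of unlabeled internal vertices of valence $\ge3$. The orientation set of a graph is the union of its external vertices (each of degree $-m$), internal vertices (each of degree $-N$) and edges (each of degree $N-1$). An orientation of a graph is a total order of its orientation set together with an orientation of every edge. Isomorphic oriented graphs (isomorphism respecting adjacency, edge orientations and the order) are identified. One takes the quotient of the $\mathbb Q$-vector space spanned by isomorphism classes of oriented graphs by the relations: reversing the orientation of one edge multiplies by $(-1)^N$; permuting the orientation set multiplies by the Koszul sign of the permutation, computed from the degrees of the elements. The differential $\partial\Upsilon$ is the sum, over all internal vertices $v$ and all unordered partitions of the half-edges at $v$ into two sets of size $\ge2$, of the graph obtained by replacing $v$ by a new edge joining two vertices, the half-edges of one set being attached to one endpoint and those of the other set to the other endpoint; one endpoint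 is regarded as the old vertex $v$, the other one as the new vertex; the new vertex and the new edge are added as the first and second elements of the ordered orientation set, and the new edge is oriented from the old vertex to the new one (the choice of which endpoint is new does not matter). Hairy graphs. An edge of a connected graph is tree-type if removing it disconnects the graph into two parts, exactly one of which is a tree. The frame is the subgraph generated by the edges that are not tree-type. A hair is a tree-type edge one of whose endpoints is univalent and whose other endpoint lies in the frame and has no other tree-type edges adjacent to it. A vertex is a cut vertex if removing it (as a point of the topological space) disconnects the graph. A two-loop hairy graph is a connected graph (self-loops and multiple edges allowed) with a non-empty finite set of unlabeled external vertices of valence $1$ and a finite set of unlabeled internal vertices of valence $\ge3$, of first Betti number $2$, whose frame has no cut vertices and all of whose tree-type edges are hairs; its frame is a (subdivided) $\Theta$-graph. The Hodge degree is the number of external vertices (i.e. of hairs). The defect is $\sum_v(|v|-3)$ over the internal vertices $v$, where $|v|$ is the valence; for two-loop hairy graphs it is $0$, $1$ or $2$. Let $\mathcal C_i\subset\mathcal E^{m,N}_\pi$ be the span of the two-loop hairy graphs of defect $i$. The differential $\partial$ preserves Hodge degree and lowers the defect by $1$, giving the two-loop hairy graph-complex $0\to\mathcal C_2\xrightarrow{\partial_2}\mathcal C_1\xrightarrow{\partial_1}\mathcal C_0\to0$, with $H_i=\ker\partial_i/\operatorname{im}\partial_{i+1}$. *)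

(* Defs.v *)
From HB Require Import structures.
From mathcomp Require Import all_boot all_order all_algebra.
From mathcomp Require Import finmap monalg.

Set Implicit Arguments.
Unset Strict Implicit.
Unset Printing Implicit Defensive.

Import Order.TTheory GRing.Theory Num.Theory.
Local Open Scope ring_scope.

(* A finite multigraph with [n_ext] external vertices, [n_int] internal vertices
   and [n_edge] edges.  The half-edges are the pairs (e, b): (e, false) is the
   tail and (e, true) the head of the edge e, so the incidence function [inc]
   also records an orientation of every edge.  A cell of the graph is a vertex
   or an edge.  The cells are at the same time the elements of the orientation
   set, and [ord] lists them in the chosen total order. *)
Record ograph := OGraph {
  n_ext : nat;
  n_int : nat;
  n_edge : nat;
  inc : {ffun 'I_n_edge * bool -> 'I_n_ext + 'I_n_int};
  ord : seq ('I_n_ext + 'I_n_int + 'I_n_edge) }.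

Definition ograph_encode (G : ograph) :
  {t : nat * nat * nat & ({ffun 'I_t.2 * bool -> 'I_t.1.1 + 'I_t.1.2} *
     seq ('I_t.1.1 + 'I_t.1.2 + 'I_t.2))%type} :=
  existT (fun t : nat * nat * nat =>
     ({ffun 'I_t.2 * bool -> 'I_t.1.1 + 'I_t.1.2} *
     seq ('I_t.1.1 + 'I_t.1.2 + 'I_t.2))%type)
   (n_ext G, n_int G, n_edge G) (inc G, ord G).

Definition ograph_decode u : ograph :=
  let: existT t p := u in @OGraph t.1.1 t.1.2 t.2 p.1 p.2.

Lemma ograph_encodeK : cancel ograph_encode ograph_decode.
Proof. by case. Qed.

HB.instance Definition _ := Choice.copy ograph (can_type ograph_encodeK).

Notation vertex G := ('I_(n_ext G) + 'I_(n_int G))%type.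
Notation edge G := 'I_(n_edge G).
Notation half_edge G := (edge G * bool)%type.
Notation cell G := (vertex G + edge G)%type.

Section Graph.
Variable G : ograph.

Definition is_order (s : seq (cell G)) : bool := uniq s && [forall c, c \in s].

Definition star (v : vertex G) : {set half_edge G} := [set h | inc G h == v].

(* A self-loop contributes 2 to the valence of its vertex. *)
Definition valence (v : vertex G) : nat := #|star v|.

Definition incident (v : vertex G) (e : edge G) : bool :=
  [exists b, inc G (e, b) == v].

(* A set of cells X stands for the union of the corresponding vertices and
   open edges in the topological realization of the graph, and [connected X]
   for the connectedness of this subspace. *)
Definition cell_adj (X : {set cell G}) : rel (cell G) := fun c d =>
  [&& c \in X, d \in X &
   match c, d with
   | inl v, inr e | inr e, inl v => incident v e
   | _, _ => false
   end].

Definition component (X : {set cell G}) (c : cell G) : {set cell G} :=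
  [set d | connect (cell_adj X) c d].

Definition connected (X : {set cell G}) : bool :=
  [forall c in X, forall d in X, connect (cell_adj X) c d].

(* First Betti number of a connected subgraph, by the Euler characteristic. *)
Definition betti1 (X : {set cell G}) : int :=
  1 - #|[set v : vertex G | inl v \in X]|%:Z
    + #|[set e : edge G | inr e \in X]|%:Z.

Definition is_tree (X : {set cell G}) : bool := connected X && (betti1 X == 0).

(* S and T are the parts, after removal of e, that contain the endpoints of e;
   as the graph is connected, there are no other parts. *)
Definition tree_type (e : edge G) : bool :=
  let X := [set~ inr e] in
  let S := component X (inl (inc G (e, false))) in
  let T := component X (inl (inc G (e, true))) in
  (inl (inc G (e, true)) \notin S) && (is_tree S (+) is_tree T).

Definition frame : {set cell G} :=
  [set c | match c with
           | inl v => [exists e, ~~ tree_type e && incident v e]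
           | inr e => ~~ tree_type e
           end].

Definition is_hair (e : edge G) : bool :=
  tree_type e &&
  [exists b, [&& valence (inc G (e, b)) == 1%N,
     inl (inc G (e, ~~ b)) \in frame &
     [forall e', tree_type e' && incident (inc G (e, ~~ b)) e'
                 ==> (e' == e)]]].

(* Only the point v is removed: the edges at v stay, as (half-)open intervals. *)
Definition cut_vertex (X : {set cell G}) (v : vertex G) : bool :=
  (inl v \in X) && ~~ connected (X :\ inl v).

(* The oriented graphs that span the complex E_pi^{m,N}. *)
Definition is_Egraph : bool :=
  [&& is_order (ord G), connected [set: cell G], (0 < n_ext G)%N,
    [forall v : 'I_(n_ext G), valence (inl v) == 1%N] &
    [forall v : 'I_(n_int G), (3 <= valence (inr v))%N]].

Definition two_loop_hairy : bool :=
  [&& is_Egraph, betti1 [set: cell G] == 2,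
    [forall v, ~~ cut_vertex frame v] &
    [forall e, tree_type e ==> is_hair e]].

Definition hodge_degree : nat := n_ext G.

Definition defect : int := \sum_(v < n_int G) ((valence (inr v))%:Z - 3).

Definition reorder (s : seq (cell G)) : ograph := OGraph (inc G) s.

Definition flip (e : edge G) : ograph :=
  OGraph [ffun h : half_edge G => inc G (h.1, (h.1 == e) (+) h.2)] (ord G).

Definition degree (m N : nat) (c : cell G) : int :=
  match c with
  | inl (inl _) => - m%:Z
  | inl (inr _) => - N%:Z
  | inr _ => N%:Z - 1
  end.

(* Koszul sign of the passage from the order s to the order t. *)
Definition koszul (m N : nat) (s t : seq (cell G)) : rat :=
  \prod_(c : cell G) \prod_(d : cell G |
     (index c s < index d s)%N && (index d t < index c t)%N)
    (-1) ^ (degree m N c * degree m N d).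

(* Splitting of the internal vertex v: the half-edges in A are attached to the
   new vertex, the other half-edges at v stay at v.  The new vertex and the new
   edge have index 0, the old ones are shifted by [lift ord0]. *)
Definition lift_vertex (v : vertex G) : 'I_(n_ext G) + 'I_(n_int G).+1 :=
  match v with inl x => inl x | inr i => inr (lift ord0 i) end.

Definition lift_cell (c : cell G) :
    'I_(n_ext G) + 'I_(n_int G).+1 + 'I_(n_edge G).+1 :=
  match c with inl v => inl (lift_vertex v) | inr e => inr (lift ord0 e) end.

Definition split_inc (v : 'I_(n_int G)) (A : {set half_edge G}) :
    {ffun 'I_(n_edge G).+1 * bool -> 'I_(n_ext G) + 'I_(n_int G).+1} :=
  [ffun h => match unlift ord0 h.1 with
    | None => if h.2 then inr ord0 else inr (lift ord0 v)
    | Some e => if (e, h.2) \in A then inr ord0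
                else lift_vertex (inc G (e, h.2))
    end].

Definition split_vertex (v : 'I_(n_int G)) (A : {set half_edge G}) : ograph :=
  OGraph (split_inc v A)
    (inl (inr ord0) :: inr ord0 :: [seq lift_cell c | c <- ord G]).

Definition admissible (v : 'I_(n_int G)) (P : {set {set half_edge G}}) : bool :=
  [&& partition P (star (inr v)), #|P| == 2%N &
      [forall A in P, (2 <= #|A|)%N]].

(* One of the two blocks of P, chosen arbitrarily (used for the new vertex). *)
Definition block (P : {set {set half_edge G}}) : {set half_edge G} :=
  odflt set0 [pick A in P].

(* << H >> is the basis vector of the graph H in the free vector space. *)
Definition boundary1 : {malg rat[ograph]} :=
  \sum_(v < n_int G) \sum_(P | admissible v P) << split_vertex v (block P) >>.

End Graph.

Definition map_vertex (G H : ograph) (f : 'I_(n_ext G) -> 'I_(n_ext H))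
    (g : 'I_(n_int G) -> 'I_(n_int H)) (v : vertex G) : vertex H :=
  match v with inl x => inl (f x) | inr i => inr (g i) end.

Definition map_cell (G H : ograph) (f : 'I_(n_ext G) -> 'I_(n_ext H))
    (g : 'I_(n_int G) -> 'I_(n_int H)) (r : edge G -> edge H)
    (c : cell G) : cell H :=
  match c with inl v => inl (map_vertex f g v) | inr e => inr (r e) end.

Definition isomorphic (G H : ograph) : Prop :=
  exists (f : 'I_(n_ext G) -> 'I_(n_ext H)) (g : 'I_(n_int G) -> 'I_(n_int H))
         (r : edge G -> edge H),
    [/\ bijective f, bijective g, bijective r,
        forall e b, inc H (r e, b) = map_vertex f g (inc G (e, b)) &
        ord H = [seq map_cell f g r c | c <- ord G]].

Section Subspaces.
Variable V : lmodType rat.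
Implicit Types S U W Z B : V -> Prop.

Definition span S : V -> Prop := fun x =>
  exists (n : nat) (c : 'I_n -> rat) (s : 'I_n -> V),
    (forall i, S (s i)) /\ x = \sum_(i < n) c i *: s i.

Definition add_space U W : V -> Prop := fun x =>
  exists u w, [/\ U u, W w & x = u + w].

Definition image_space (f : V -> V) U : V -> Prop := fun y =>
  exists2 x, U x & y = f x.

(* For subspaces B and Z with B contained in Z, the dimension of Z / B is d:
   some d vectors of Z form a basis modulo B. *)
Definition quotient_dim Z B (d : nat) : Prop :=
  exists z : 'I_d -> V,
    [/\ forall i, Z (z i),
        forall x, Z x -> exists c : 'I_d -> rat, B (x - \sum_i c i *: z i) &
        forall c : 'I_d -> rat, B (\sum_i c i *: z i) -> forall i, c i = 0].

End Subspaces.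

(* The complex E_pi^{m,N} is the span of the graphs satisfying [is_Egraph]
   modulo the subspace [relations m N].  Its subspaces are represented by their
   preimages in the free vector space on oriented graphs. *)
Inductive relation (m N : nat) : {malg rat[ograph]} -> Prop :=
| rel_iso G H of is_Egraph G & is_Egraph H & isomorphic G H :
    relation m N (<< G >> - << H >>)
| rel_flip G e of is_Egraph G :
    relation m N (<< @flip G e >> - (-1) ^+ N *: << G >>)
| rel_order G s of is_Egraph G & is_order s :
    relation m N (<< @reorder G s >> - koszul m N (ord G) s *: << G >>).

Definition relations (m N : nat) : {malg rat[ograph]} -> Prop :=
  span (relation m N).

Definition boundary (x : {malg rat[ograph]}) : {malg rat[ograph]} :=
  \sum_(G <- msupp x) x@_G *: boundary1 G.

(* The Hodge degree k part of C_i. *)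
Definition chains (m N i k : nat) : {malg rat[ograph]} -> Prop :=
  add_space
    (span (fun x => exists G : ograph,
       [/\ two_loop_hairy G, defect G = i%:Z, hodge_degree G = k
         & x = << G >>]))
    (relations m N).

(* The Hodge degree k parts of the kernel of the differential on C_i and of the
   image of C_(i+1).  For i = 0 every chain is a cycle, since trivalent vertices
   cannot be split. *)
Definition cycles (m N i k : nat) : {malg rat[ograph]} -> Prop :=
  fun x => chains m N i k x /\ relations m N (boundary x).

Definition boundaries (m N i k : nat) : {malg rat[ograph]} -> Prop :=
  add_space (image_space boundary (chains m N i.+1 k)) (relations m N).

Definition homology_dim (m N i k d : nat) : Prop :=
  quotient_dim (cycles m N i k) (boundaries m N i k) d.

(* Main.v *)
(* As m and N are even, only the order of the edges contributes to signs, and the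
   orientations of the edges are irrelevant.  A two-loop hairy graph is a theta
   graph whose lines carry a, b and c hairs and whose branch vertices carry p and
   q <= 1 hairs.  Ordering its edges along the lines gives a generator [a,b,c;p,q]
   that is antisymmetric in a, b, c and satisfies
     [a,b,c;q,p] = (-1)^(a+b+c+pq) [a,b,c;p,q].
   Splitting a branch vertex pushes its hair onto one of the three lines.  Hence,
   if [a,b,c] is viewed as an alternating polynomial in three variables, the
   differential is, up to a factor 1 or 2, the multiplication by the first
   elementary symmetric polynomial: from degree k-1 to degree k if k is even (from
   defect 1 to defect 0), and from degree k-2 to degree k-1 if k is odd (from
   defect 2 to defect 1); the remaining terms vanish.  This map is injective, and
   [l-i, l-1-i, 2i+1], 0 <= i < floor(l/3), is a basis of its cokernel in degree
   2l.  Linear independence modulo the relations is detected by functionals: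
   every weight on theta graphs with the above symmetries induces a functional on
   oriented graphs that kills the relations. *)

From HB Require Import structures.
From mathcomp Require Import all_boot order ssralg ssrnum ssrint rat poly.
From mathcomp Require Import finmap monalg.
From mathcomp Require Import zify ring lra.
Require Import Defs.

Set Implicit Arguments.
Unset Strict Implicit.
Unset Printing Implicit Defensive.

Import Order.TTheory GRing.Theory Num.Theory.

Local Open Scope ring_scope.

(** The number floor(l/3) has its origin in invariant theory. An alternating polynomial is the
    Vandermonde product, of degree 3, times a symmetric polynomial, and modulo e1 the symmetric ones
    form Q[e2, e3]. In degree 2l the equation 2i + 3j = 2l - 3 forces j to be odd and has floor(l/3)
    solutions. Independence of the explicit basis is read off alternants evaluated at points with
    coordinate sum 0, where e1 vanishes; injectivity for even k is a leading-term argument. The main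
    obstacle is the passage from graphs to exponents. A [theta] record lists a graph along its three
    lines. Records of equal shape give isomorphic graphs; two records on one graph differ by
    permuting the lines and mirroring; and every two-loop hairy graph has a record, found by walking
    along the frame from a branch vertex, where finiteness, Betti number 2 and the absence of cut
    vertices leave only a theta graph. The relations involve all graphs of the complex, so
    functionals are defined on all oriented graphs, and the differential is handled through its
    dual, which preserves invariant functionals. *)

Definition full (T : finType) (s : seq T) : bool := uniq s && [forall x, x \in s].

Lemma full_mem (T : finType) (s : seq T) x : full s -> x \in s.
Proof. by case/andP=> _ /forallP. Qed.

Lemma full_uniq (T : finType) (s : seq T) : full s -> uniq s.
Proof. by case/andP. Qed.

Lemma fullP (T : finType) (s : seq T) :
  reflect (uniq s /\ forall x, x \in s) (full s).
Proof. by apply: (iffP andP) => -[-> H]; split=> //; apply/forallP. Qed.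

Lemma full_perm (T : finType) (s t : seq T) : perm_eq s t -> full s = full t.
Proof.
move=> st; rewrite /full (perm_uniq st); congr (_ && _).
by apply: eq_forallb => x; rewrite (perm_mem st).
Qed.

Lemma full_size (T : finType) (s : seq T) : full s -> size s = #|T|.
Proof.
case/fullP=> su sT; rewrite -(card_uniqP su); apply: eq_card => x.
by rewrite sT.
Qed.

Lemma full_map (T U : finType) (f : T -> U) (s : seq T) :
  bijective f -> full s -> full (map f s).
Proof.
move=> fb /fullP[su sT]; apply/fullP; split.
  by rewrite map_inj_uniq //; apply: bij_inj.
by case: fb => g fK gK x; rewrite -(gK x) map_f.
Qed.

(** * Signs of permutations *)

(* An analogue of Permutation that records the parity. *)
Inductive par (T : Type) : bool -> seq T -> seq T -> Prop :=
| par_nil : par false [::] [::]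
| par_cons b x s t : par b s t -> par b (x :: s) (x :: t)
| par_swap x y s : par true (x :: y :: s) (y :: x :: s)
| par_trans b c s t u : par b s t -> par c t u -> par (b (+) c) s u.

Section Par.
Variable T : Type.
Implicit Types s t u : seq T.

Lemma par_refl s : par false s s.
Proof. by elim: s => [|x s IH]; constructor. Qed.

Lemma par_sym b s t : par b s t -> par b t s.
Proof.
elim=> {b s t}; try by constructor.
by move=> b c s t u _ IH1 _ IH2; rewrite addbC; apply: par_trans IH2 IH1.
Qed.

Lemma par_catl u b s t : par b s t -> par b (u ++ s) (u ++ t).
Proof. by elim: u => //= x u IH /IH; constructor. Qed.

Lemma par_catr u b s t : par b s t -> par b (s ++ u) (t ++ u).
Proof.
elim=> {b s t} /=; [exact: par_refl | by constructor | by constructor |].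
by move=> b c s t v _ IH1 _ IH2; apply: par_trans IH1 IH2.
Qed.

Lemma par_cat b c s t u v :
  par b s t -> par c u v -> par (b (+) c) (s ++ u) (t ++ v).
Proof. by move=> /(par_catr u) st /(par_catl t) uv; apply: par_trans st uv. Qed.

Lemma par_move x s t : par (odd (size s)) (x :: s ++ t) (s ++ x :: t).
Proof.
elim: s => [|y s IH] /=; first exact: par_refl.
by rewrite -addTb; apply: par_trans (par_swap _ _ _) (par_cons _ IH).
Qed.

Lemma par_block s t u :
  par (odd (size s) && odd (size t)) (s ++ t ++ u) (t ++ s ++ u).
Proof.
elim: s => [|x s IH] /=; first exact: par_refl.
have := par_trans (par_cons x IH) (par_move x t (s ++ u)).
by congr (par _ _ _); case: (odd _); case: (odd _).
Qed.

Lemma par_rev s : par (odd 'C(size s, 2)) s (rev s).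
Proof.
elim: s => [|x s IH] /=; first exact: par_nil.
rewrite rev_cons -cats1.
have H := par_move x (rev s) [::]; rewrite cats0 size_rev in H.
have := par_trans (par_cons x IH) H.
by rewrite binS bin1 oddD addbC.
Qed.

End Par.

Lemma par_map (T U : Type) (f : T -> U) b (s t : seq T) :
  par b s t -> par b (map f s) (map f t).
Proof.
elim=> {b s t} /=; try by constructor.
by move=> b c s t u _ IH1 _ IH2; apply: par_trans IH1 IH2.
Qed.

Lemma par_perm (T : eqType) b (s t : seq T) : par b s t -> perm_eq s t.
Proof.
elim=> {b s t} //=.
- by move=> b x s t _; rewrite perm_cons.
- by move=> x y s; rewrite (perm_catCA [:: x] [:: y] s).
- by move=> b c s t u _ H1 _ H2; apply: perm_trans H1 H2.
Qed.

(** The Koszul sign when all degrees are odd. It is written as a product over inversions, like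
    [koszul], so that the two can be compared factor by factor. *)
Definition sgn (T : finType) (s t : seq T) : rat :=
  \prod_(x : T) \prod_(y : T |
     (index x s < index y s)%N && (index y t < index x t)%N) (-1).

Section Sgn.
Variable T : finType.
Implicit Types s t u : seq T.

(** Choosing [enum_rank] to pick one representative of each unordered pair merges the factors of
    [(x, y)] and [(y, x)]. The exponent then records whether [s] and [t] disagree on the pair, and
    multiplicativity of the sign becomes a property of exclusive or. *)
Lemma sgn_unordered s t : full s -> full t ->
  sgn s t = \prod_(p : T * T | (enum_rank p.1 < enum_rank p.2)%N)
    (-1) ^+ ((index p.1 s < index p.2 s)%N (+) (index p.1 t < index p.2 t)%N).
Proof.
move=> fs ft; rewrite /sgn pair_big_dep /=.
rewrite (bigID (fun p : T * T => (enum_rank p.1 < enum_rank p.2)%N)) /=.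
rewrite [X in _ * X](reindex_inj (h := fun p : T * T => (p.2, p.1))) /=; last first.
  by move=> [a b] [c d] /= [-> ->].
rewrite big_mkcondl /= [X in _ * X]big_mkcondl /=.
rewrite [X in _ * X](eq_bigl (fun p : T * T => (enum_rank p.1 <= enum_rank p.2)%N));
  last by move=> p; rewrite -leqNgt.
rewrite [X in _ * X](bigID (fun p : T * T => p.1 == p.2)) /= [X in _ * (X * _)]big1 ?mul1r;
  last by move=> [x y] /= /andP[_ /eqP->]; rewrite ltnn.
rewrite [X in _ * X](eq_bigl (fun p : T * T => (enum_rank p.1 < enum_rank p.2)%N)).
  rewrite -big_split /=; apply: eq_bigr => -[x y] /= xy.
  have nxy : x != y by apply: contraTneq xy => ->; rewrite ltnn.
  have ns : index x s != index y s.
    by apply: contra nxy => /eqP H; apply/eqP/(index_inj x (full_mem x fs) (full_mem y fs) H).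
  have nt : index x t != index y t.
    by apply: contra nxy => /eqP H; apply/eqP/(index_inj x (full_mem x ft) (full_mem y ft) H).
  by move: ns nt; rewrite !neq_ltn; do 4![case: ltngtP => ? //=]; rewrite ?mulr1 ?mul1r.
move=> [x y] /=; rewrite [RHS]ltn_neqAle andbC; congr (~~ _ && _).
by rewrite (inj_eq val_inj) (inj_eq enum_rank_inj).
Qed.

Lemma sgn_trans t s u : full s -> full t -> full u ->
  sgn s t * sgn t u = sgn s u.
Proof.
move=> fs ft fu; rewrite !sgn_unordered // -big_split /=; apply: eq_bigr => p _.
by do 3![case: (_ < _)%N] => /=; rewrite ?mulrN ?mulNr ?mulr1 ?opprK.
Qed.

Lemma sgn_refl s : sgn s s = 1.
Proof.
by rewrite /sgn big1 // => x _; rewrite big_pred0 // => y; case: ltngtP.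
Qed.

Lemma sgn_sqr s t : full s -> full t -> sgn s t * sgn s t = 1.
Proof.
move=> fs ft; rewrite sgn_unordered // -big_split big1 //= => p _.
by case: (_ (+) _); rewrite ?mulrNN ?mulr1.
Qed.

Lemma sgn_sym s t : full s -> full t -> sgn s t = sgn t s.
Proof.
move=> fs ft; rewrite !sgn_unordered //; apply: eq_bigr => p _.
by rewrite addbC.
Qed.

(** Only the pair [(x, y)] is inverted, so the double product has a single factor. *)
Lemma sgn_swap (a b : seq T) (x y : T) :
  full (a ++ [:: x, y & b]) -> sgn (a ++ [:: x, y & b]) (a ++ [:: y, x & b]) = -1.
Proof.
case/andP => us _; rewrite /sgn pair_big_dep /= (big_pred1 (x, y)) //.
move=> [u v] /=; rewrite !index_cat /= xpair_eqE.
move: us; rewrite cat_uniq /= !inE !negb_or => /and3P[_ /and3P[xa ya _] /and3P[/andP[xy _] _ _]].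
rewrite (eq_sym x u) (eq_sym y u) (eq_sym x v) (eq_sym y v).
have [->|nux] := eqVneq u x; have [->|nvy] := eqVneq v y;
  have [?|nuy] := eqVneq u y; have [?|nvx] := eqVneq v x; subst;
  rewrite ?(negbTE xa) ?(negbTE ya) ?(negbTE xy) ?eqxx ?(eq_sym y x) ?(negbTE xy) /= ?andbF ?andbT;
  try (by rewrite eqxx in xy); try (by rewrite ?eqxx in nux nvy nuy nvx);
  try lia;
  repeat (case: ifP; rewrite -?index_mem => ?); try lia.
Qed.

Lemma sgn_par b s t : par b s t -> full s -> sgn s t = (-1) ^+ b.
Proof.
(* The induction on [par] peels off heads, but a tail does not enumerate [T]; the removed elements
   are kept in the prefix [a]. *)
have gen : par b s t -> forall a, full (a ++ s) -> sgn (a ++ s) (a ++ t) = (-1) ^+ b.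
  elim=> {b s t}.
  - by move=> a _; rewrite sgn_refl.
  - by move=> b x s t _ IH a; rewrite -!cat_rcons; apply: IH.
  - by move=> x y s a; apply: sgn_swap.
  - move=> b c s t u st IH1 tu IH2 a fs.
    have ft : full (a ++ t) by rewrite -(full_perm (perm_cat (perm_refl a) (par_perm st))).
    have fu : full (a ++ u) by rewrite -(full_perm (perm_cat (perm_refl a) (par_perm tu))).
    by rewrite -(sgn_trans fs ft fu) IH1 // IH2 // signr_addb.
by move=> st; apply: (gen st [::]).
Qed.

End Sgn.

Lemma sgn_map (T U : finType) (f : T -> U) (s t : seq T) :
  bijective f -> sgn (map f s) (map f t) = sgn s t.
Proof.
move=> fb; have fi := bij_inj fb.
rewrite /sgn (reindex f) /=; last exact: onW_bij.
apply: eq_bigr => x _; rewrite (reindex f) /=; last exact: onW_bij.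
by apply: eq_bigl => y; rewrite !index_map.
Qed.

(** * Subspaces and free vector spaces *)

Section Spans.
Variable V : lmodType rat.
Implicit Types S U W : V -> Prop.

Definition subspace U := U 0 /\ forall (a : rat) x y, U x -> U y -> U (a *: x + y).

Lemma subspaceD U x y : subspace U -> U x -> U y -> U (x + y).
Proof. by case=> _ H Ux Uy; rewrite -[x]scale1r; apply: H. Qed.

Lemma subspaceZ U a x : subspace U -> U x -> U (a *: x).
Proof. by case=> U0 H Ux; rewrite -[_ *: _]addr0; apply: H. Qed.

Lemma subspaceN U x : subspace U -> U x -> U (- x).
Proof. by move=> sU Ux; rewrite -scaleN1r; apply: subspaceZ. Qed.

Lemma subspaceB U x y : subspace U -> U x -> U y -> U (x - y).
Proof. by move=> sU Ux Uy; apply: subspaceD => //; apply: subspaceN. Qed.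

Lemma subspace_sum U (I : Type) (r : seq I) (P : pred I) (F : I -> V) :
  subspace U -> (forall i, P i -> U (F i)) -> U (\sum_(i <- r | P i) F i).
Proof.
move=> sU UF; elim/big_rec: _ => [|i x Pi Ux]; first by case: sU.
by apply: subspaceD => //; apply: UF.
Qed.

Lemma span_subspace S : subspace (span S).
Proof.
split; first by exists 0, (fun=> 0), (fun=> 0); split=> [[]|] //; rewrite big_ord0.
move=> a x y [n [c [s [Ss ->]]]] [p [d [t [St ->]]]].
exists (n + p)%N, (fun i => match split i with inl j => a * c j | inr j => d j end),
  (fun i => match split i with inl j => s j | inr j => t j end).
split=> [i|]; first by case: (split i).
rewrite big_split_ord scaler_sumr /=; congr (_ + _); apply: eq_bigr => i _.
  by rewrite (unsplitK (inl i)) scalerA.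
by rewrite (unsplitK (inr i)).
Qed.

Lemma span_mem S x : S x -> span S x.
Proof.
by move=> Sx; exists 1, (fun=> 1), (fun=> x); split=> //; rewrite big_ord1 scale1r.
Qed.

Lemma span_min S U : subspace U -> (forall x, S x -> U x) -> forall x, span S x -> U x.
Proof.
move=> sU SU x [n [c [s [Ss ->]]]]; apply: subspace_sum => // i _.
by apply: subspaceZ => //; apply: SU.
Qed.

Lemma add_space_subspace U W : subspace U -> subspace W -> subspace (add_space U W).
Proof.
move=> sU sW; split.
  by exists 0, 0; split; [case: sU | case: sW | rewrite addr0].
move=> a x y [u [w [Uu Ww ->]]] [u' [w' [Uu' Ww' ->]]].
exists (a *: u + u'), (a *: w + w'); split; first by case: sU => _; apply.
  by case: sW => _; apply.
by rewrite scalerDr addrACA.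
Qed.

End Spans.

Section FreeExtension.
Variables (K : choiceType) (V : lmodType rat).

(** With [F := boundary1] this is convertible to [boundary], and with values in [rat^o] it is a
    functional, so the linearity lemmas below serve for both. *)
Definition free_ext (F : K -> V) (x : {malg rat[K]}) : V :=
  \sum_(G <- msupp x) x@_G *: F G.

Lemma free_extEw F (d : {fset K}) x : (msupp x `<=` d)%fset ->
  free_ext F x = \sum_(G <- d) x@_G *: F G.
Proof.
move=> sxd; rewrite /free_ext; apply: big_fset_incl => // G _ Gx.
by rewrite mcoeff_outdom ?scale0r.
Qed.

Lemma free_ext_linear F a x y :
  free_ext F (a *: x + y) = a *: free_ext F x + free_ext F y.
Proof.
pose d := (msupp x `|` msupp y `|` msupp (a *: x + y))%fset.
rewrite !(@free_extEw F d) /d; last first.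
- exact: fsubsetUr.
- by apply: fsubset_trans (fsubsetUl _ _); apply: fsubsetUl.
- by apply: fsubset_trans (fsubsetUl _ _); apply: fsubsetUr.
rewrite scaler_sumr -big_split /=; apply: eq_bigr => G _.
by rewrite mcoeffD mcoeffZ scalerDl scalerA.
Qed.

Lemma free_extU F G : free_ext F << G >> = F G.
Proof.
by rewrite (free_extEw F (d := [fset G]%fset)) ?msuppU_le // big_seq_fset1 mcoeffUU scale1r.
Qed.

Lemma free_ext0 F : free_ext F 0 = 0.
Proof. by rewrite /free_ext msupp0 big_seq_fset0. Qed.

Lemma free_extD F x y : free_ext F (x + y) = free_ext F x + free_ext F y.
Proof. by rewrite -[x in LHS]scale1r free_ext_linear scale1r. Qed.

Lemma free_extZ F a x : free_ext F (a *: x) = a *: free_ext F x.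
Proof. by rewrite -[_ *: x]addr0 free_ext_linear free_ext0 addr0. Qed.

Lemma free_extN F x : free_ext F (- x) = - free_ext F x.
Proof. by rewrite -[- x]scaleN1r free_extZ scaleN1r. Qed.

Lemma free_extB F x y : free_ext F (x - y) = free_ext F x - free_ext F y.
Proof. by rewrite free_extD free_extN. Qed.

Lemma free_ext_sum F (I : Type) (r : seq I) (P : pred I) (x : I -> {malg rat[K]}) :
  free_ext F (\sum_(i <- r | P i) x i) = \sum_(i <- r | P i) free_ext F (x i).
Proof. exact: (big_morph _ (free_extD F) (free_ext0 F)). Qed.

End FreeExtension.

(** * Orientation signs for even degrees, isomorphisms up to edge directions, and relations *)

Section CellEdges.
Variables (X E : Type).
(** For even [m] and [N] only the edges have odd degree, so this sublist of an order carries its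
    whole sign. *)
Definition edges_of (s : seq (X + E)) : seq E :=
  pmap (fun c => if c is inr e then Some e else None) s.
End CellEdges.

Lemma mem_edges_of (X E : eqType) (s : seq (X + E)) e :
  (e \in edges_of s) = (inr e \in s).
Proof.
by elim: s => //= -[x|e'] s IH; rewrite /edges_of /= !inE -IH.
Qed.

Lemma full_edges_of (X E : finType) (s : seq (X + E)) : full s -> full (edges_of s).
Proof.
case/fullP=> us sT; apply/fullP; split; last by move=> e; rewrite mem_edges_of.
by apply: (pmap_uniq (g := inr)) us => -[x|e].
Qed.

Lemma index_edges_of (X E : eqType) (s : seq (X + E)) e e' :
  (index e (edges_of s) < index e' (edges_of s))%N = (index (inr e) s < index (inr e') s)%N.
Proof.
elim: s => //= -[x|a] s IH; rewrite /edges_of /=; first by rewrite ltnS -IH.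
by rewrite /eq_op /= -/eq_op; do 2![case: eqP => ? //=]; rewrite ltnS.
Qed.

Notation eds G := (edges_of (ord G)).

(** A factor that involves a vertex has an even exponent and equals 1; for two edges the exponent (N
    - 1)^2 is odd. *)
Lemma koszul_even (m N : nat) (G : ograph) (s t : seq (cell G)) :
  ~~ odd m -> ~~ odd N -> (0 < N)%N -> koszul m N s t = sgn (edges_of s) (edges_of t).
Proof.
move=> em eN N0; rewrite /koszul /sgn big_sumType /=.
have even_deg (v : vertex G) (c : cell G) : (-1 : rat) ^ (degree m N (inl v : cell G) * degree m N c) = 1 /\
   (-1 : rat) ^ (degree m N c * degree m N (inl v : cell G)) = 1.
  rewrite [X in _ /\ _ ^ X = _]mulrC; suff H : (-1 : rat) ^ degree m N (inl v : cell G) = 1.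
    by rewrite -exprz_exp H exp1rz.
  by case: v => _ /=; rewrite -invr_expz -exprnP -signr_odd ?(negbTE em) ?(negbTE eN) invr1.
rewrite big1 ?mul1r; last by move=> v _; rewrite big1 // => c _; case: (even_deg v c).
apply: eq_bigr => e _; rewrite big_mkcond /= big_sumType /= big1 ?mul1r.
  rewrite [RHS]big_mkcond /=; apply: eq_bigr => e' _; rewrite !index_edges_of; case: ifP => // _.
  have -> : (N%:Z - 1)%R = (N.-1)%:Z by lia.
  by rewrite -PoszM -exprnP -signr_odd oddM andbb -subn1 oddB // (negbTE eN).
by move=> v _; case: ifP => // _; case: (even_deg v (inr e : cell G)).
Qed.

Lemma connect_homo (T U : finType) (e : rel T) (e' : rel U) (h : T -> U) x y :
  (forall x y, e x y -> e' (h x) (h y)) -> connect e x y -> connect e' (h x) (h y).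
Proof.
move=> he /connectP[p]; elim: p x => [|z p IH] x /=; first by move=> _ ->.
case/andP=> xz zp yE; apply: connect_trans (IH z zp yE).
exact/connect1/he.
Qed.

Lemma homo_connected (G H : ograph) (h : cell G -> cell H) :
  (forall c d, cell_adj [set: cell G] c d -> cell_adj [set: cell H] (h c) (h d)) ->
  (forall c, exists c', c = h c') ->
  connected [set: cell G] -> connected [set: cell H].
Proof.
move=> hh hs /forall_inP cG; apply/forall_inP => c _; apply/forall_inP => d _.
have [c' ->] := hs c; have [d' ->] := hs d.
apply: connect_homo hh _.
by have /forall_inP := cG c' (in_setT _); apply; rewrite in_setT.
Qed.

Definition hflip (T : Type) (h : T * bool) : T * bool := (h.1, ~~ h.2).

Lemma hflipK T : involutive (@hflip T).
Proof. by case=> e b; rewrite /hflip /= negbK. Qed.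

Definition hmap (T U : Type) (r : T -> U) (s : T -> bool) (h : T * bool) : U * bool :=
  (r h.1, h.2 (+) s h.1).

Lemma hmap_bij (T U : Type) (r : T -> U) s : bijective r -> bijective (hmap r s).
Proof.
case=> r' rK r'K; exists (fun h => (r' h.1, h.2 (+) s (r' h.1))) => -[e b].
  by rewrite /hmap /= rK addbK.
by rewrite /hmap /= r'K addbK.
Qed.

Lemma hmap_hflip (T U : Type) (r : T -> U) s h : hmap r s (hflip h) = hflip (hmap r s h).
Proof. by case: h => e b; rewrite /hmap /hflip /= addNb. Qed.

(* Isomorphism of graphs up to the orientation of the edges, which is
   irrelevant for even N. *)
Definition siso (G H : ograph) f g r s : Prop :=
  [/\ bijective f, bijective g, bijective r &
      forall h, inc H (hmap r s h) = @map_vertex G H f g (inc G h)].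

Lemma map_vertex_bij (G H : ograph) f g :
  bijective f -> bijective g -> bijective (@map_vertex G H f g).
Proof.
case=> f' fK f'K [g' gK g'K]; exists (@map_vertex H G f' g') => -[x|x] /=;
  by rewrite ?fK ?f'K ?gK ?g'K.
Qed.

Section Siso.
Variables (G H : ograph) (f : 'I_(n_ext G) -> 'I_(n_ext H)) (g : 'I_(n_int G) -> 'I_(n_int H)).
Variables (r : edge G -> edge H) (s : edge G -> bool).
Hypothesis GH : siso f g r s.

Let fb : bijective f. Proof. by case: GH. Qed.
Let gb : bijective g. Proof. by case: GH. Qed.
Let rb : bijective r. Proof. by case: GH. Qed.
Let vb : bijective (map_vertex f g). Proof. exact: map_vertex_bij. Qed.

Lemma siso_star v : star (map_vertex f g v) = [set hmap r s h | h in star v].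
Proof.
case: (hmap_bij s rb) => k kK kK'.
apply/setP => h; rewrite inE; apply/eqP/imsetP => [hv|[h' ]]; last first.
  by rewrite inE => /eqP h'v ->; case: GH => _ _ _ ->; rewrite h'v.
exists (k h); last by rewrite kK'.
rewrite inE; apply/eqP/(bij_inj vb).
by case: GH => _ _ _ <-; rewrite kK'.
Qed.

Lemma siso_valence v : valence (map_vertex f g v) = valence v.
Proof.
by rewrite /valence siso_star card_imset //; apply: bij_inj (hmap_bij s rb).
Qed.

Lemma siso_incident v e : incident v e -> incident (map_vertex f g v) (r e).
Proof.
case/existsP=> b /eqP <-; apply/existsP; exists (b (+) s e).
by case: GH => _ _ _ <-.
Qed.

Lemma siso_Egraph : is_order (ord H) -> is_Egraph G -> is_Egraph H.
Proof.
move=> oH /and5P[_ cG n0 /forallP vx /forallP vi].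
have [f' _ f'K] := fb; have [g' _ g'K] := gb; have [r' _ r'K] := rb.
apply/and5P; split=> //.
- apply: (homo_connected (h := map_cell f g r)) cG.
    move=> [v|e] [w|e'] /and3P[_ _] //= /siso_incident adj; rewrite /cell_adj !inE //.
  by case=> [[x|x]|e]; [exists (inl (inl (f' x))) | exists (inl (inr (g' x))) |
    exists (inr (r' e))] => /=; rewrite ?f'K ?g'K ?r'K.
- by case: (f (Ordinal n0)) => i; apply: leq_trans.
- by apply/forallP => x; rewrite -[x]f'K (siso_valence (inl _)).
- by apply/forallP => x; rewrite -[x]g'K (siso_valence (inr _)).
Qed.

End Siso.

Definition flips (G : ograph) (s : edge G -> bool) : ograph :=
  OGraph [ffun h : half_edge G => inc G (h.1, h.2 (+) s h.1)] (ord G).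

Lemma flips_siso G s : @siso G (flips s) id id id s.
Proof.
split; try by exists id.
move=> [e b]; rewrite ffunE /= /hmap /= addbK.
by case: (inc G _).
Qed.

Lemma flips_Egraph G s : is_Egraph G -> is_Egraph (@flips G s).
Proof.
by move=> eG; apply: (siso_Egraph (flips_siso s)) => //; case/and5P: eG.
Qed.

Section Relations.
Variables (m N : nat).
Hypotheses (m_even : ~~ odd m) (N_even : ~~ odd N) (N_gt0 : (0 < N)%N).

Definition eqv_mod (x y : {malg rat[ograph]}) := relations m N (x - y).

Local Notation eqv := eqv_mod.

Lemma relations_subspace : subspace (relations m N).
Proof. exact: span_subspace. Qed.

Lemma eqv_refl x : eqv x x.
Proof. by rewrite /eqv_mod subrr; case: relations_subspace. Qed.

Lemma eqv_sym x y : eqv x y -> eqv y x.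
Proof. by move=> xy; rewrite /eqv_mod -opprB; apply: (subspaceN relations_subspace). Qed.

Lemma eqv_trans y x z : eqv x y -> eqv y z -> eqv x z.
Proof.
move=> xy yz; rewrite /eqv_mod -[x](subrK y) -addrA.
exact: (subspaceD relations_subspace).
Qed.

Lemma eqvZ a x y : eqv x y -> eqv (a *: x) (a *: y).
Proof. by move=> xy; rewrite /eqv_mod -scalerBr; apply: (subspaceZ _ relations_subspace). Qed.

Lemma eqvD x y x' y' : eqv x y -> eqv x' y' -> eqv (x + x') (y + y').
Proof. by move=> xy xy'; rewrite /eqv_mod opprD addrACA; apply: (subspaceD relations_subspace). Qed.

Lemma eqv_flips G s : is_Egraph G -> eqv << @flips G s >> << G >>.
Proof.
(* A relation flips one edge at a time, each with sign 1 as [N] is even; the set of flipped edges is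
   therefore built up along a duplicate-free list. *)
move=> eG; suff gen (l : seq (edge G)) : uniq l -> eqv << @flips G (fun e => e \in l) >> << G >>.
  have -> : flips s = flips (fun e : edge G => e \in enum s); last exact: gen (enum_uniq _).
  by rewrite /flips; congr OGraph; apply/ffunP => h; rewrite !ffunE mem_enum.
elim: l => [_|e l IH /= /andP[el ul]].
  suff -> : @flips G (fun e => e \in [::]) = G by exact: eqv_refl.
  transitivity (OGraph (inc G) (ord G)); last by case: (G).
  rewrite /flips; congr OGraph; by apply/ffunP => -[e b']; rewrite ffunE /= addbF.
apply: eqv_trans (IH ul).
have -> : @flips G (fun e' => e' \in e :: l) = @flip (@flips G (fun e => e \in l)) e.
  rewrite /flips /flip /=; congr OGraph; apply/ffunP => -[e' b]; rewrite !ffunE /= inE.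
  by have [->|] := eqVneq e' e; rewrite ?(negbTE el) /= ?addbF ?addbT.
rewrite /eqv_mod; apply: span_mem.
have := rel_flip m N (G := @flips G (fun e => e \in l)) e (flips_Egraph _ eG).
by rewrite -signr_odd (negbTE N_even) expr0 scale1r.
Qed.

(** The map factors through flips of edges, then an isomorphism in the strict sense onto [H] with
    the order carried over from [G], then a reordering. Only the reordering contributes a sign. *)
Lemma eqv_siso G H f g r s : @siso G H f g r s -> is_Egraph G -> is_order (ord H) ->
  eqv << G >> (sgn (map r (eds G)) (eds H) *: << H >>).
Proof.
move=> GH eG oH; have [fb gb rb incH] := GH.
have oG : is_order (ord G) by case/and5P: eG.
have cb : bijective (map_cell f g r).
  have [v' vK v'K] := map_vertex_bij fb gb; have [r' rK r'K] := rb.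
  exists (fun c => match c with inl v => inl (v' v) | inr e => inr (r' e) end) => -[v|e] /=;
  by rewrite ?vK ?v'K ?rK ?r'K.
pose G2 := OGraph (inc H) [seq map_cell f g r c | c <- ord G].
have oG2 : is_order (ord G2) by apply: (full_map (T := cell G)) => //.
have GG2 : @siso G G2 f g r s by [].
have eG2 : is_Egraph G2 by apply: (siso_Egraph GG2).
have eGf := flips_Egraph s eG.
apply: eqv_trans (eqv_sym (eqv_flips s eG)) _.
have E1 : eqv << flips s >> << G2 >>.
  apply: span_mem; apply: rel_iso => //; exists f, g, r; split=> // e b.
  by have := incH (e, b (+) s e); rewrite /hmap /= addbK ffunE => ->.
apply: eqv_trans E1 _; apply: eqv_sym.
have HE : H = @reorder G2 (ord H) by rewrite /reorder /=; case: (H).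
have E2 : eqv << H >> (koszul m N (ord G2) (ord H) *: << G2 >>).
  by apply: span_mem; rewrite {1}HE; apply: rel_order.
rewrite koszul_even // in E2.
have edsG2 : eds G2 = map r (eds G).
  by rewrite /G2 /=; elim: (ord G) => //= -[v|e] l IH; rewrite /edges_of /= -/(edges_of _) IH.
rewrite -edsG2.
have := eqvZ (sgn (eds G2) (eds H)) E2.
by rewrite scalerA sgn_sqr ?scale1r //; apply: full_edges_of.
Qed.

End Relations.

(** * Theta structures *)

Record step (X I D : Type) := Step { sx : X; sk : D; sv : I; sh : D }.

Definition step_encode (X I D : Type) (a : step X I D) := (sx a, sk a, sv a, sh a).

Definition step_decode (X I D : Type) (u : X * D * I * D) : step X I D :=
  Step u.1.1.1 u.1.1.2 u.1.2 u.2.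

Lemma step_encodeK (X I D : Type) : cancel (@step_encode X I D) (@step_decode X I D).
Proof. by case. Qed.

HB.instance Definition _ (X I D : eqType) :=
  Equality.copy (step X I D) (can_type (@step_encodeK X I D)).

HB.instance Definition _ (X I D : choiceType) :=
  Choice.copy (step X I D) (can_type (@step_encodeK X I D)).

(* A line from s to t: the first half-edge, and then, for every hair vertex sv
   on the line, the external vertex sx of its hair, the half-edge sk of the hair
   at sv, and the half-edge sh at sv with which the line continues. *)
Definition line (X I D : Type) : Type := (D * seq (step X I D))%type.

(* Three lines from tu to tw, and the hairs at tu and tw themselves. *)
Record theta (X I D : Type) := Theta {
  tu : I; tw : I; tp : seq (X * D); tq : seq (X * D); tl : seq (line X I D) }.

Definition theta_encode (X I D : Type) (th : theta X I D) :=
  (tu th, tw th, tp th, tq th, tl th).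

Definition theta_decode (X I D : Type)
    (u : I * I * seq (X * D) * seq (X * D) * seq (D * seq (step X I D))) : theta X I D :=
  Theta u.1.1.1.1 u.1.1.1.2 u.1.1.2 u.1.2 u.2.

Lemma theta_encodeK (X I D : Type) : cancel (@theta_encode X I D) (@theta_decode X I D).
Proof. by case. Qed.

HB.instance Definition _ (X I D : choiceType) :=
  Choice.copy (theta X I D) (can_type (@theta_encodeK X I D)).

Section ThetaLists.
Variables X I D : Type.
Implicit Types (l : line X I D) (th : theta X I D).

Definition line_word l : seq D := l.1 :: flatten [seq [:: sk a; sh a] | a <- l.2].

Lemma size_line_word l : size (line_word l) = (size l.2).*2.+1.
Proof. by case: l => h r /=; congr S; elim: r => //= a r ->; rewrite doubleS. Qed.

(** One row per edge of the line: a half-edge, the vertex it is attached to, and the vertex at the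
    opposite half. *)
Fixpoint line_tab (s t : I) (h : D) (r : seq (step X I D)) : seq (D * (X + I) * (X + I)) :=
  if r is a :: r' then
    [:: (h, inr s, inr (sv a)), (sk a, inr (sv a), inl (sx a)) & line_tab (sv a) t (sh a) r']
  else [:: (h, inr s, inr t)].

Definition exts th : seq X :=
  map fst (tp th) ++ map fst (tq th) ++ flatten [seq map (@sx _ _ _) l.2 | l <- tl th].

Definition ints th : seq I :=
  [:: tu th, tw th & flatten [seq map (@sv _ _ _) l.2 | l <- tl th]].

Definition word th : seq D :=
  map snd (tp th) ++ map snd (tq th) ++ flatten (map line_word (tl th)).

Definition tab th : seq (D * (X + I) * (X + I)) :=
  [seq (a.2, inr (tu th), inl a.1) | a <- tp th] ++
  [seq (a.2, inr (tw th), inl a.1) | a <- tq th] ++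
  flatten [seq line_tab (tu th) (tw th) l.1 l.2 | l <- tl th].

(** The isomorphism type of a theta graph is determined by these numbers ([good_siso]), hence
    weights are functions of them. *)
Definition shape th : seq nat * nat * nat :=
  ([seq size l.2 | l <- tl th], size (tp th), size (tq th)).

Lemma line_tab_word s t h r : map (fun a => a.1.1) (line_tab s t h r) = line_word (h, r).
Proof. by elim: r s h => //= a r IH s h; rewrite IH. Qed.

Lemma tab_word th : map (fun a => a.1.1) (tab th) = word th.
Proof.
rewrite /tab /word !map_cat -!map_comp map_flatten -map_comp; congr (_ ++ (_ ++ flatten _)).
by apply: eq_map => -[h r] /=; rewrite line_tab_word.
Qed.

End ThetaLists.

Section MapTheta.
Variables (X I D X' I' D' : Type) (f : X -> X') (g : I -> I') (k : D -> D').

Definition map_step (a : step X I D) : step X' I' D' :=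
  Step (f (sx a)) (k (sk a)) (g (sv a)) (k (sh a)).

Definition map_line (l : line X I D) : line X' I' D' := (k l.1, map map_step l.2).

Definition map_hair (a : X * D) : X' * D' := (f a.1, k a.2).

Definition map_theta (th : theta X I D) : theta X' I' D' :=
  Theta (g (tu th)) (g (tw th)) (map map_hair (tp th)) (map map_hair (tq th))
    (map map_line (tl th)).

Definition map_sum (v : X + I) : X' + I' :=
  match v with inl x => inl (f x) | inr i => inr (g i) end.

Lemma exts_map th : exts (map_theta th) = map f (exts th).
Proof.
rewrite /exts /= !map_cat map_flatten -!map_comp; do 2!congr (_ ++ _).
by congr flatten; apply: eq_map => -[h r] /=; rewrite -!map_comp.
Qed.

Lemma ints_map th : ints (map_theta th) = map g (ints th).
Proof.
rewrite /ints /= map_flatten -!map_comp; do 2!congr (_ :: _).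
by congr flatten; apply: eq_map => -[h r] /=; rewrite -!map_comp.
Qed.

Lemma line_word_map l : line_word (map_line l) = map k (line_word l).
Proof. by case: l => h r; congr (_ :: _) => /=; elim: r => //= a r ->. Qed.

Lemma word_map th : word (map_theta th) = map k (word th).
Proof.
rewrite /word /= !map_cat map_flatten -!map_comp; do 2!congr (_ ++ _).
by congr flatten; apply: eq_map => l /=; rewrite line_word_map.
Qed.

Lemma tab_map th :
  tab (map_theta th) = [seq (k a.1.1, map_sum a.1.2, map_sum a.2) | a <- tab th].
Proof.
rewrite /tab /= !map_cat map_flatten -!map_comp; do 2!congr (_ ++ _).
congr flatten; apply: eq_map => -[h r] /=.
by elim: r (tu th) h => //= a r IH s h; rewrite IH.
Qed.

Lemma shape_map th : shape (map_theta th) = shape th.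
Proof.
rewrite /shape /= !size_map -map_comp; congr (_, _, _).
by apply: eq_map => l /=; rewrite size_map.
Qed.

End MapTheta.

Lemma cat_inj (T : Type) (s1 s2 t1 t2 : seq T) :
  size s1 = size t1 -> s1 ++ s2 = t1 ++ t2 -> s1 = t1 /\ s2 = t2.
Proof.
by elim: s1 t1 => [|x s IH] [|y t] //= [E] [-> /(IH _ E)[-> ->]].
Qed.

(** The shape tells where to cut each of the flattened lists, so the record can be rebuilt from
    them. This turns an equality of records into equalities of enumerations. *)
Lemma theta_inj (X I D : Type) (th th' : theta X I D) :
  shape th = shape th' -> exts th = exts th' -> ints th = ints th' ->
  word th = word th' -> th = th'.
Proof.
case: th th' => u w p q l [u' w' p' q' l']; rewrite /shape /exts /ints /word /=.
move=> [sl sp sq] /cat_inj[|pX]; first by rewrite !size_map.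
case/cat_inj=> [|qX lX]; first by rewrite !size_map.
move=> [-> -> lI] /cat_inj[|pD]; first by rewrite !size_map.
case/cat_inj=> [|qD lD]; first by rewrite !size_map.
have pair_eq (a b : seq (X * D)) : map fst a = map fst b -> map snd a = map snd b -> a = b.
  by elim: a b => [|[x d] a IH] [|[y e] b] //= [-> E] [-> /(IH _ E) ->].
rewrite (pair_eq p p') // (pair_eq q q') //; congr Theta.
elim: l l' sl lX lI lD {p p' q q' sp sq pX qX pD qD} => [|[h r] l IH] [|[h' r'] l'] //=.
move=> [sr sl] /cat_inj[|rX lX]; first by rewrite !size_map.
case/cat_inj=> [|rI lI]; first by rewrite !size_map.
case=> -> /cat_inj[|rD lD].
  have := size_line_word (h', r); have := size_line_word (h', r').
  by rewrite /= => -[->] [->]; rewrite sr.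
rewrite (IH l') //; congr ((_, _) :: _).
elim: r r' sr rX rI rD => [|[x k i d] r IHr] [|[x' k' i' d'] r'] //=.
by move=> [sr] [-> E1] [-> E2] [-> -> E3]; rewrite (IHr r').
Qed.

Lemma nth_index_map (A : Type) (B : eqType) (k : A -> B) (d : A) (s : seq A) i :
  uniq (map k s) -> (i < size s)%N -> index (k (nth d s i)) (map k s) = i.
Proof.
move=> us si; rewrite -(nth_map d (k d)) // index_uniq ?size_map //.
Qed.

Lemma full_bij (T U : finType) (s : seq T) (t : seq U) :
  full s -> full t -> size s = size t -> exists2 f : T -> U, bijective f & map f s = t.
Proof.
move=> fs ft st.
case: s fs st => [|x0 s0] fs st.
  have noT (x : T) : False by have := full_mem x fs.
  have noU (x : U) : False.
    by have := full_mem x ft; rewrite (size0nil (esym st)).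
  exists (fun x => False_rect U (noT x)); last by rewrite (size0nil (esym st)).
  by exists (fun x => False_rect T (noU x)) => x; [case: (noT x) | case: (noU x)].
move: fs st; set s := x0 :: s0 => fs st.
have y0 : U by case: (t) st => // y.
exists (fun x => nth y0 t (index x s)).
  exists (fun y => nth x0 s (index y t)) => x.
    by rewrite index_uniq ?(full_uniq ft) ?nth_index ?(full_mem _ fs) // -st index_mem (full_mem _ fs).
  by rewrite index_uniq ?(full_uniq fs) ?nth_index ?(full_mem _ ft) // st index_mem (full_mem _ ft).
apply: (@eq_from_nth _ y0); rewrite size_map // => i si.
by rewrite (nth_map x0) // index_uniq ?(full_uniq fs).
Qed.

Definition entry_ok (G : ograph) (a : half_edge G * vertex G * vertex G) : bool :=
  (inc G a.1.1 == a.1.2) && (inc G (hflip a.1.1) == a.2).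

Notation gstep G := (step 'I_(n_ext G) 'I_(n_int G) (half_edge G)).
Notation gline G := (line 'I_(n_ext G) 'I_(n_int G) (half_edge G)).
Notation gtheta G := (theta 'I_(n_ext G) 'I_(n_int G) (half_edge G)).

Definition eword G (th : gtheta G) : seq (edge G) := map fst (word th).

(** Fullness of the three lists says that the record exhausts [G]: every vertex and every edge
    occurs exactly once, an edge through one of its halves. The table then determines [inc G]. *)
Record good (G : ograph) (th : gtheta G) : Prop := Good {
  good_exts : full (exts th);
  good_ints : full (ints th);
  good_word : full (eword th);
  good_lines : size (tl th) = 3;
  good_tp : (size (tp th) <= 1)%N;
  good_tq : (size (tq th) <= 1)%N;
  good_tab : all (@entry_ok G) (tab th) }.

(** A boolean form, so that [xchoose] can select a record. *)
Definition goodb (G : ograph) (th : gtheta G) : bool :=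
  [&& full (exts th), full (ints th), full (eword th), size (tl th) == 3,
      (size (tp th) <= 1)%N, (size (tq th) <= 1)%N & all (@entry_ok G) (tab th)].

Lemma goodP (G : ograph) (th : gtheta G) : reflect (good th) (goodb th).
Proof.
apply: (iffP and5P) => [[? ? ? /eqP ? /and3P[? ? ?]]|[? ? ? /eqP ? ? ? ?]]; first by split.
by split=> //; apply/and3P.
Qed.

Lemma good_map (G H : ograph) f g r s (th : gtheta G) : @siso G H f g r s ->
  good th -> good (map_theta f g (hmap r s) th : gtheta H) .
Proof.
move=> [fb gb rb incH] [fx fi fw l3 p1 q1 tb]; split.
- by rewrite exts_map full_map.
- by rewrite ints_map full_map.
- by rewrite /eword word_map -map_comp (map_comp r fst) full_map.
- by rewrite size_map.
- by rewrite size_map.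
- by rewrite size_map.
rewrite tab_map all_map; apply: sub_all tb => -[[h a] b] /andP[/= /eqP ha /eqP hb].
by rewrite /entry_ok /= -hmap_hflip !incH ha hb !eqxx.
Qed.

Lemma eword_map (G H : ograph) f g r s (th : gtheta G) :
  eword (map_theta f g (hmap r s) th : gtheta H) = map r (eword th).
Proof. by rewrite /eword word_map -!map_comp. Qed.

(** The enumerations of the two graphs have equal lengths and are matched position by position; the
    rows of the two tables then correspond. *)
Lemma good_siso (G H : ograph) (th : gtheta G) (th' : gtheta H) :
  good th -> good th' -> shape th = shape th' ->
  exists f g r s, @siso G H f g r s /\ map r (eword th) = eword th'.
Proof.
move=> gd gd' sE.
have ssx (X I D : Type) (t : theta X I D) : size (exts t) =
    ((shape t).1.2 + ((shape t).2 + sumn (shape t).1.1))%N.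
  by rewrite /exts !size_cat !size_map size_flatten /seq.shape -map_comp; congr (_ + (_ + sumn _))%N;
    apply: eq_map => l /=; rewrite size_map.
have ssi (X I D : Type) (t : theta X I D) : size (ints t) = (sumn (shape t).1.1).+2.
  by rewrite /ints /= size_flatten /seq.shape -map_comp; congr (sumn _).+2;
    apply: eq_map => l /=; rewrite size_map.
have ssw (X I D : Type) (t : theta X I D) : size (word t) =
    ((shape t).1.2 + ((shape t).2 + sumn [seq n.*2.+1 | n <- (shape t).1.1]))%N.
  rewrite /word !size_cat !size_map size_flatten /seq.shape -!map_comp; congr (_ + (_ + sumn _))%N.
  by apply: eq_map => l; apply: size_line_word.
have [f fb fE] := full_bij (good_exts gd) (good_exts gd') ltac:(by rewrite !ssx sE).
have [g gb gE] := full_bij (good_ints gd) (good_ints gd') ltac:(by rewrite !ssi sE).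
have [r rb rE] := full_bij (good_word gd) (good_word gd') ltac:(by rewrite !size_map !ssw sE).
(* An edge is reversed exactly when the two words represent it by halves with different flags. *)
pose s (e : edge G) := ((e, true) \in word th) (+) ((r e, true) \in word th').
(* As every edge occurs once in the word, membership of [(e, true)] reveals which half represents
   [e]. *)
have bitE (T : finType) (w : seq (T * bool)) h : uniq (map fst w) -> h \in w ->
    ((h.1, true) \in w) = h.2.
  case: h => e [] //= uw ew; apply/negP => ew'.
  have ni : index (e, true) w != index (e, false) w.
    by apply/eqP => E; have := index_inj (e, true) ew' ew E.
  have := nth_index_map (e, true) uw (i := index (e, true) w).
  have := nth_index_map (e, true) uw (i := index (e, false) w).
  rewrite !index_mem !nth_index // => /(_ ew) /= E1 /(_ ew') /= E2.
  by rewrite -E1 -E2 eqxx in ni.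
have wE : map (hmap r s) (word th) = word th'.
  have E1 : map fst (map (hmap r s) (word th)) = map fst (word th').
    by rewrite -[RHS]rE /eword -!map_comp.
  have E2 : map snd (map (hmap r s) (word th)) = map snd (word th').
    have -> : map snd (word th') = map (fun e => (e, true) \in word th') (eword th').
      rewrite -map_comp; apply/eq_in_map => h hw /=.
      by rewrite bitE //; apply: full_uniq (good_word gd').
    rewrite -rE -!map_comp; apply/eq_in_map => -[e b] hw /=.
    have /= bE := bitE _ _ _ (full_uniq (good_word gd)) hw.
    by rewrite /s bE addKb.
  by rewrite -(zip_unzip (map _ _)) /unzip1 /unzip2 E1 E2 zip_unzip.
exists f, g, r, s; split=> //; split=> //.
have thE : map_theta f g (hmap r s) th = th' :> gtheta H.
  by apply: theta_inj; rewrite ?shape_map ?exts_map ?ints_map ?word_map.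
have tabE := tab_map f g (hmap r s) th; rewrite thE in tabE.
(* A row of the table fixes the ends of both halves of its edge, so checking rows covers all
   half-edges. *)
have main h : h \in word th -> inc H (hmap r s h) = map_vertex f g (inc G h) /\
    inc H (hmap r s (hflip h)) = map_vertex f g (inc G (hflip h)).
  rewrite -tab_word => /mapP[a ath ->].
  have /andP[/eqP -> /eqP ->] := allP (good_tab gd) a ath.
  have : (hmap r s a.1.1, map_sum f g a.1.2, map_sum f g a.2) \in tab th'.
    by rewrite tabE; apply/mapP; exists a.
  by move/(allP (good_tab gd')) => /andP[/= /eqP -> /eqP]; rewrite hmap_hflip => ->.
move=> [e b]; have : e \in eword th := full_mem e (good_word gd).
case/mapP=> -[e' b'] hw /= ->; have [H1 H2] := main _ hw.
by have [->//|] := eqVneq b b'; case: b b' {hw} H1 H2 => -[].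
Qed.

(** * Existence of theta graphs of every shape *)

Definition realize_inc (X I E : finType) (th : theta X I E) :
    {ffun 'I_#|E| * bool -> 'I_#|X| + 'I_#|I|} :=
  [ffun h => let e := enum_val h.1 in
    let a := nth (e, inr (tu th), inr (tu th)) (tab th) (index e (word th)) in
    map_sum enum_rank enum_rank (if h.2 then a.2 else a.1.2)].

Definition realize (X I E : finType) (th : theta X I E) : ograph :=
  @OGraph #|X| #|I| #|E| (realize_inc th)
    (map inl (enum predT) ++ map inr (map enum_rank (word th))).

(** In the abstract record the edges themselves stand in the places of the half-edges; in the graph
    each of them is represented by its [false] half, the tail. *)
Definition realize_theta (X I E : finType) (th : theta X I E) : gtheta (realize th) :=
  map_theta enum_rank enum_rank (fun e => (enum_rank e, false)) th.

Lemma edges_of_cat (X E : Type) (s t : seq (X + E)) :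
  edges_of (s ++ t) = edges_of s ++ edges_of t.
Proof. exact: pmap_cat. Qed.

Lemma edges_of_inl (X E : Type) (s : seq X) : edges_of (map (@inl X E) s) = [::].
Proof. by elim: s. Qed.

Lemma edges_of_inr (X E : Type) (s : seq E) : edges_of (map (@inr X E) s) = s.
Proof. by elim: s => //= x s IH; rewrite /edges_of /= -/(edges_of _) IH. Qed.

Section Realize.
Variables (X I E : finType) (th : theta X I E).
Hypotheses (fx : full (exts th)) (fi : full (ints th)) (fw : full (word th)).

Lemma eword_realize : eword (realize_theta th) = map enum_rank (word th).
Proof. by rewrite /eword word_map -map_comp. Qed.

Lemma eds_realize : eds (realize th) = eword (realize_theta th).
Proof. by rewrite edges_of_cat edges_of_inl edges_of_inr eword_realize. Qed.

Lemma realize_order : is_order (ord (realize th)).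
Proof.
apply/fullP; split.
  rewrite cat_uniq !map_inj_uniq ?enum_uniq ?(full_uniq fw) //;
    try by [exact: enum_rank_inj | move=> x y []].
  by rewrite -enumT enum_uniq andbT; apply/hasPn => _ /mapP[e _ ->]; apply/negP => /mapP[].
case=> [v|e0]; rewrite mem_cat; first by rewrite map_f ?mem_enum.
by rewrite -[e0]enum_valK [X in _ || X]map_f ?orbT // map_f // (full_mem _ fw).
Qed.

Lemma realize_good : size (tl th) = 3 -> (size (tp th) <= 1)%N -> (size (tq th) <= 1)%N ->
  good (realize_theta th).
Proof.
move=> l3 p1 q1; split; rewrite ?size_map //.
- by rewrite exts_map full_map // ; apply: enum_rank_bij.
- by rewrite ints_map full_map //; apply: enum_rank_bij.
- by rewrite eword_realize full_map //; apply: enum_rank_bij.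
rewrite tab_map all_map; apply/allP => -[[e a] b] ath.
have key d : nth d (tab th) (index e (word th)) = (e, a, b).
  have us : uniq [seq a.1.1 | a <- tab th] by rewrite tab_word (full_uniq fw).
  rewrite -(nth_index d ath) -{1}tab_word.
  by rewrite -[e]/((e, a, b).1.1) -{1}(nth_index d ath) nth_index_map // index_mem.
by rewrite /entry_ok /= !ffunE /= !enum_rankK !key /= !eqxx.
Qed.

End Realize.

(** Arbitrary finite types are allowed so that a new hair can be adjoined by passing to [option]
    types, without renumbering ordinals. *)
Definition shape_exists (ns : seq nat) (p q : nat) : Prop :=
  exists (X I E : finType) (th : theta X I E),
    [/\ full (exts th), full (ints th), full (word th) & shape th = (ns, p, q)].

Lemma full_option (T : finType) (s : seq T) : full s -> full (None :: map Some s).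
Proof.
case/fullP=> us sT; apply/fullP; split.
  rewrite /= map_inj_uniq ?us ?andbT; last by move=> x y [].
  by apply/negP => /mapP[].
by case=> [x|]; rewrite inE ?eqxx // map_f.
Qed.

Lemma shape_exists_step ns1 n ns2 p q :
  shape_exists (ns1 ++ n :: ns2) p q -> shape_exists (ns1 ++ n.+1 :: ns2) p q.
Proof.
case=> X [I [E [th [fx fi fw sE]]]].
pose th1 := map_theta (@Some X) (@Some I) (fun e => Some (Some e)) th.
have [l1 [[h r] [l2 [lE s1 s2 sr]]]] : exists l1 l l2, [/\ tl th1 = l1 ++ l :: l2,
   [seq size l.2 | l <- l1] = ns1, [seq size l.2 | l <- l2] = ns2 & size l.2 = n].
  have : [seq size l.2 | l <- tl th1] = ns1 ++ n :: ns2.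
    by have := shape_map (@Some X) (@Some I) (fun e => Some (Some e)) th;
       rewrite sE => -[].
  elim: ns1 (tl th1) {sE} => [|k ns1 IH] [|l ls] //= [ks lsE].
    by exists [::], l, ls; split.
  have [l1 [l' [l2 [-> s1 s2 sl]]]] := IH _ lsE.
  by exists (l :: l1), l', l2; split=> //=; rewrite s1 ks.
(* A hair vertex is inserted at the beginning of the line: [None] is the new first edge, [Some None]
   is the hair, and the line continues with its former first edge [h]. *)
pose L : line (option X) (option I) (option (option E)) := (None, Step None (Some None) None h :: r).
pose th2 := Theta (tu th1) (tw th1) (tp th1) (tq th1) (l1 ++ L :: l2).
exists (option X), (option I), (option (option E)), th2; split.
- rewrite -(full_perm (s := None :: exts th1)); first by rewrite exts_map full_option.
  by rewrite /th2 /exts lE !map_cat !flatten_cat /=; apply/permP => P; rewrite /= !count_cat /= ?count_cat; lia.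
- rewrite -(full_perm (s := None :: ints th1)); first by rewrite ints_map full_option.
  by rewrite /th2 /ints lE !map_cat !flatten_cat /=; apply/permP => P; rewrite /= !count_cat /= ?count_cat; lia.
- rewrite -(full_perm (s := None :: Some None :: word th1)).
    by rewrite word_map (map_comp Some Some) -(map_cons Some None) !full_option.
  by rewrite /th2 /word lE !map_cat !flatten_cat /=; apply/permP => P; rewrite /= !count_cat /= ?count_cat; lia.
have := shape_map (@Some X) (@Some I) (fun e => Some (Some e)) th.
rewrite sE -/th1 => -[_ <- <-].
by rewrite /shape /th2 /= map_cat /= s1 s2 -sr.
Qed.

Lemma shape_existsP a b c (p q : bool) : shape_exists [:: a; b; c] p q.
Proof.
have step1 ns1 n ns2 : shape_exists (ns1 ++ 0%N :: ns2) p q -> shape_exists (ns1 ++ n :: ns2) p q.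
  by move=> H; elim: n => // n; apply: shape_exists_step.
apply: (step1 [::]); apply: (step1 [:: 0%N]); apply: (step1 [:: 0%N; 0%N]) => /=.
suff base0 : shape_exists [:: 0; 0; 0]%N 0 0.
  have baseq : shape_exists [:: 0; 0; 0]%N 0 q.
    case: (q) => //; case: base0 => X [I [E [th [fx fi fw sE]]]].
    pose th1 := map_theta (@Some X) (@id I) (@Some E) th.
    have p0 : tp th = [::] by case: sE => _ /size0nil.
    have q0 : tq th = [::] by case: sE => _ _ /size0nil.
    pose th2 := Theta (tu th1) (tw th1) [::] [:: (None, None)] (tl th1).
    exists (option X), I, (option E), th2; split.
    - by have := full_option fx; rewrite -(exts_map _ (@id I) (@Some E)) /exts /= p0 q0.
    - by have := fi; rewrite -[ints th]map_id -(ints_map (@Some X) (@id I) (@Some E)).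
    - by have := full_option fw; rewrite -(word_map (@Some X) (@id I)) /word /= p0 q0.
    have := shape_map (@Some X) (@id I) (@Some E) th.
    by rewrite sE -/th1 /shape /= => -[-> _ _].
  case: (p) => //; case: baseq => X [I [E [th [fx fi fw sE]]]].
  pose th1 := map_theta (@Some X) (@id I) (@Some E) th.
  have p0 : tp th = [::] by case: sE => _ /size0nil.
  pose th2 := Theta (tu th1) (tw th1) [:: (None, None)] (tq th1) (tl th1).
  exists (option X), I, (option E), th2; split.
  - by have := full_option fx; rewrite -(exts_map _ (@id I) (@Some E)) /exts /= p0.
  - by have := fi; rewrite -[ints th]map_id -(ints_map (@Some X) (@id I) (@Some E)).
  - by have := full_option fw; rewrite -(word_map (@Some X) (@id I)) /word /= p0.
  have := shape_map (@Some X) (@id I) (@Some E) th.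
  by rewrite sE -/th1 /shape /= => -[-> _ ->].
(* The bare theta graph: two vertices, three edges and no hairs. *)
pose o3 k : 'I_3 := inord k.
exists void, bool, 'I_3, (Theta false true [::] [::] [:: (o3 0%N, [::]); (o3 1%N, [::]); (o3 2%N, [::])]).
split=> //; apply/fullP; split=> //.
- by case.
- by rewrite /word /= !inE -!val_eqE /= !inordK.
by case=> -[|[|[|]]] //= k3; rewrite !inE -!val_eqE /= !inordK.
Qed.

(** * Permuting the lines and mirroring, with their signs *)

Definition set_lines (X I D : Type) (th : theta X I D) (l : seq (line X I D)) :=
  Theta (tu th) (tw th) (tp th) (tq th) l.

(** A line with n hairs has 2n + 1 edges, an odd number, so exchanging two lines is an odd
    permutation of edges. This is the source of the antisymmetry in a, b, c. *)
Lemma par_lines (X I D : Type) b (l l' : seq (line X I D)) : par b l l' ->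
  par b (flatten (map (@line_word _ _ _) l)) (flatten (map (@line_word _ _ _) l')).
Proof.
elim=> {b l l'}.
- exact: par_nil.
- by move=> b x s t _; rewrite [_ :: s]lock [_ :: t]lock -!lock [X in par _ X]/= [X in par _ _ X]/=; apply: par_catl.
- move=> x y s; have := par_block (line_word x) (line_word y) (flatten (map (@line_word _ _ _) s)).
  by rewrite !size_line_word /= !odd_double.
- by move=> b c s t u _ H1 _ H2; apply: par_trans H1 H2.
Qed.

Lemma par_set_lines (X I D : Type) b (th : theta X I D) l : par b (tl th) l ->
  par b (word th) (word (set_lines th l)).
Proof. by move=> H; do 2!apply: par_catl; apply: par_lines. Qed.

Lemma flatten_perm (T : eqType) (U : Type) (f : U -> seq T) b (l l' : seq U) :
  par b l l' -> perm_eq (flatten (map f l)) (flatten (map f l')).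
Proof.
elim=> {b l l'} //=.
- by move=> b x s t _; rewrite perm_cat2l.
- by move=> x y s; rewrite perm_catCA.
- by move=> b c s t u _ H1 _ H2; apply: perm_trans H1 H2.
Qed.

Lemma par_size (T : Type) b (s t : seq T) : par b s t -> size s = size t.
Proof. by elim=> {b s t} //= [b x s t _ ->|b c s t u _ -> _ ->]. Qed.

Section GoodOps.
Variable G : ograph.
Implicit Types th : gtheta G.

Lemma eword_par th th' b : par b (word th) (word th') -> par b (eword th) (eword th').
Proof. exact: par_map. Qed.

Lemma good_set_lines th b l : good th -> par b (tl th) l -> good (set_lines th l).
Proof.
move=> [fx fi fw l3 p1 q1 tb] pl; split=> //=.
- rewrite -(full_perm (s := exts th)) // /exts !perm_cat2l.
  exact: flatten_perm pl.
- rewrite -(full_perm (s := ints th)) // /ints !perm_cons.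
  exact: flatten_perm pl.
- by rewrite -(full_perm (par_perm (eword_par (par_set_lines pl)))).
- by rewrite -(par_size pl).
apply/allP => a; move: tb => /allP tb.
rewrite mem_cat mem_cat => /or3P[H|H|H]; apply: tb; rewrite !mem_cat ?H ?orbT //.
by rewrite (perm_mem (flatten_perm _ pl)) H !orbT.
Qed.

(** The line is traversed with an accumulator. At the hair vertex [sv a], reached along [h], the
    reversed line continues with [hflip h]. *)
Fixpoint rev_steps (h : half_edge G) (r acc : seq (gstep G)) :=
  if r is a :: r' then rev_steps (sh a) r' (Step (sx a) (sk a) (sv a) (hflip h) :: acc)
  else (hflip h, acc).

Definition rev_line (l : gline G) := rev_steps l.1 l.2 [::].

Definition mirror th : gtheta G :=
  Theta (tw th) (tu th) (tq th) (tp th) (map rev_line (tl th)).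

Lemma rev_line_exts l : perm_eq (map (@sx _ _ _) (rev_line l).2) (map (@sx _ _ _) l.2).
Proof.
rewrite /rev_line; case: l => h r /=; rewrite -[X in perm_eq _ X]cats0.
rewrite -[[::] in X in perm_eq _ X]/(map (@sx _ _ _) (nil : seq (gstep G))).
elim: r h [::] => [|a r IH] h acc //=.
apply: perm_trans (IH _ _) _ => /=.
by rewrite (perm_catCA _ [:: _]) /=.
Qed.

Lemma rev_line_ints l : perm_eq (map (@sv _ _ _) (rev_line l).2) (map (@sv _ _ _) l.2).
Proof.
rewrite /rev_line; case: l => h r /=; rewrite -[X in perm_eq _ X]cats0.
rewrite -[[::] in X in perm_eq _ X]/(map (@sv _ _ _) (nil : seq (gstep G))).
elim: r h [::] => [|a r IH] h acc //=.
apply: perm_trans (IH _ _) _ => /=.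
by rewrite (perm_catCA _ [:: _]) /=.
Qed.

Lemma rev_line_word l : map fst (line_word (rev_line l)) = rev (map fst (line_word l)).
Proof.
pose W (acc : seq (gstep G)) :=
  map fst (flatten [seq [:: sk a; sh a] | a <- acc]).
have gen r h acc : map fst (line_word (rev_steps h r acc)) =
    rev (map fst (line_word (h, r))) ++ W acc.
  elim: r h acc => [|a r IH] h acc //.
  by rewrite [rev_steps _ _ _]/= IH /line_word /= !rev_cons -!cats1 -!catA.
by rewrite /rev_line gen cats0; case: l.
Qed.

(** Loop invariant of [rev_steps]: the accumulator holds a valid part of the reversed line from [x]
    to [s], beginning with the hair at [x]; the edge by which the reversed line enters [x] is still
    missing. *)
Definition tail_ok (x : 'I_(n_int G)) acc (s : 'I_(n_int G)) : Prop :=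
  match acc with
  | [::] => x = s
  | a :: r => sv a = x /\ all (@entry_ok G)
      ((sk a, inr x, inl (sx a)) :: line_tab x s (sh a) r)
  end.

Lemma rev_steps_tab h r acc x s t :
  all (@entry_ok G) (line_tab x t h r) -> tail_ok x acc s ->
  all (@entry_ok G) (line_tab t s (rev_steps h r acc).1 (rev_steps h r acc).2).
Proof.
have base h' acc' x' t' : entry_ok (h', inr x', inr t') -> tail_ok x' acc' s ->
    all (@entry_ok G) (line_tab t' s (hflip h') acc').
  case/andP=> /= /eqP h1 /eqP h2.
  case: acc' => [|a acc'] /= => [E|[E /andP[E1 E2]]]; rewrite {1}/entry_ok /= hflipK h1 h2 ?E !eqxx //=.
  by rewrite E1 E2.
elim: r h acc x => [|a r IH] h acc x /=; first by rewrite andbT; apply: base.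
case/and3P=> hx ka rt xs; apply: (IH _ _ _ rt) => /=; split=> //.
by rewrite ka; apply: base hx xs.
Qed.

Lemma good_mirror th : good th -> good (mirror th).
Proof.
move=> [fx fi fw l3 p1 q1 tb]; split=> //=; rewrite ?size_map //.
- rewrite -(full_perm (s := exts th)) // /exts perm_catCA !perm_cat2l /=.
  elim: (tl th) => //= l ls IH; apply: perm_cat => //.
  by rewrite perm_sym; apply: rev_line_exts.
- rewrite -(full_perm (s := ints th)) // /ints /=.
  rewrite (perm_catCA [:: tu th] [:: tw th]) /= !perm_cons.
  elim: (tl th) => //= l ls IH; apply: perm_cat => //.
  by rewrite perm_sym; apply: rev_line_ints.
- rewrite -(full_perm (s := eword th)) // /eword /word /= !map_cat perm_catCA !perm_cat2l.
  elim: (tl th) => [|l ls IH] //.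
  rewrite [X in perm_eq X _](_ : _ = map fst (line_word l) ++
    map fst (flatten (map (@line_word _ _ _) ls))); last by rewrite -map_cat.
  rewrite [X in perm_eq _ X](_ : _ = map fst (line_word (rev_line l)) ++
    map fst (flatten (map (@line_word _ _ _) (map rev_line ls)))); last by rewrite -map_cat.
  by rewrite perm_cat // rev_line_word perm_sym perm_rev.
move: tb; rewrite /tab !all_cat => /and3P[/= -> -> /=].
elim: (tl th) => //= l ls IH; rewrite !all_cat => /andP[H /IH ->].
by rewrite andbT; apply: rev_steps_tab H _.
Qed.

Lemma shape_mirror th : shape (mirror th) = ((shape th).1.1, size (tq th), size (tp th)).
Proof.
rewrite /shape /= -map_comp; congr (_, _, _); apply: eq_map => l /=.
by rewrite -(size_map (@sx _ _ _)) (perm_size (rev_line_exts l)) size_map.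
Qed.

(** Exchanging the two blocks of hairs at the branch vertices gives pq. Reversing a line of 2n + 1
    edges makes n(2n + 1) inversions, which has the parity of n. *)
Lemma par_mirror th :
  par (odd (sumn (shape th).1.1) (+) (odd (size (tp th)) && odd (size (tq th))))
    (eword th) (eword (mirror th)).
Proof.
rewrite /eword /word !map_cat addbC.
set p := map fst (map snd (tp th)); set q := map fst (map snd (tq th)).
have := par_block p q (map fst (flatten (map (@line_word _ _ _) (tl th)))).
rewrite !size_map => H; apply: par_trans H _; do 2!apply: par_catl.
rewrite /shape /=; elim: (tl th) => [|l ls IH]; first exact: par_nil.
rewrite [X in par X](_ : _ = odd (size l.2) (+) odd (sumn [seq size l.2 | l <- ls])); last by rewrite /= oddD.
rewrite [X in par _ X](_ : _ = map fst (line_word l) ++ map fst (flatten (map (@line_word _ _ _) ls))); last by rewrite -map_cat.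
rewrite [X in par _ _ X](_ : _ = map fst (line_word (rev_line l)) ++
  map fst (flatten (map (@line_word _ _ _) (map rev_line ls)))); last by rewrite -map_cat.
apply: par_cat => //; rewrite rev_line_word.
have := par_rev (map fst (line_word l)); rewrite size_map size_line_word.
by rewrite bin2 /= -doubleMr doubleK oddM /= odd_double.
Qed.

End GoodOps.

(** * Counting half-edges, and uniqueness of theta structures *)

Definition is_int (X I : Type) (v : X + I) : bool := if v is inr _ then true else false.

(* The half-edges at v that belong to the frame, and those that are hairs, for
   graphs all of whose hairs are single edges. *)
Definition fstar (G : ograph) (v : vertex G) : {set half_edge G} :=
  [set h | (inc G h == v) && is_int (inc G (hflip h))].

Definition hstar (G : ograph) (v : vertex G) : {set half_edge G} :=
  [set h | (inc G h == v) && ~~ is_int (inc G (hflip h))].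

Definition inner (X I D : Type) (th : theta X I D) : seq I :=
  flatten [seq map (@sv _ _ _) l.2 | l <- tl th].

Lemma uniq_flatten_mem (T : eqType) (ss : seq (seq T)) s : uniq (flatten ss) -> s \in ss -> uniq s.
Proof.
elim: ss => //= s' ss IH; rewrite cat_uniq inE => /and3P[us _ uss] /orP[/eqP->//|].
exact: IH.
Qed.

Section Counting.
Variables (G : ograph) (th : gtheta G).
Hypothesis gth : good th.

Lemma card_tab (Q : vertex G -> vertex G -> bool) :
  #|[set h | Q (inc G h) (inc G (hflip h))]| =
  (count (fun a => Q a.1.2 a.2) (tab th) + count (fun a => Q a.2 a.1.2) (tab th))%N.
Proof.
(* The word picks one half of each edge; together with the opposite halves it lists every half-edge
   exactly once. Half-edges can thus be counted by reading the table in both directions. *)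
pose hl := word th ++ map (@hflip _) (word th).
have uw := full_uniq (good_word gth).
have hu : uniq hl.
  rewrite cat_uniq (map_uniq uw) map_inj_uniq ?(map_uniq uw) ?andbT /=; last exact: can_inj (@hflipK _).
  apply/hasPn => _ /mapP[h hw ->]; apply/negP => hw'.
  have ni : index (hflip h) (word th) != index h (word th).
    apply/eqP => E; have := index_inj h hw' hw E.
    by case: (h) => e [].
  have := nth_index_map h uw (i := index (hflip h) (word th)).
  have := nth_index_map h uw (i := index h (word th)).
  rewrite !index_mem !nth_index // => /(_ hw) /= E1 /(_ hw') /= E2.
  by rewrite -E1 -E2 eqxx in ni.
have hf h : h \in hl.
  have /mapP[h' hw E] : h.1 \in eword th := full_mem _ (good_word gth).
  have [E2|E2] := eqVneq h.2 h'.2.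
    by rewrite mem_cat (_ : h = h') ?hw //; case: h h' E E2 {hw} => ? ? [? ?] /= -> ->.
  rewrite mem_cat (_ : h = hflip h') ?map_f ?orbT //.
  by case: h h' E E2 {hw} => ? [] [? []] //= ->.
rewrite cardsE -(eq_card (A := [pred h in hl | Q (inc G h) (inc G (hflip h))])); last first.
  by move=> h; rewrite !inE hf.
have -> : #|[pred h in hl | Q (inc G h) (inc G (hflip h))]| =
    size (filter (fun h => Q (inc G h) (inc G (hflip h))) hl).
  rewrite -(card_uniqP (filter_uniq _ hu)); apply: eq_card => h.
  by rewrite !inE mem_filter andbC.
rewrite size_filter count_cat count_map -tab_word !count_map; congr (_ + _)%N;
  apply: eq_in_count => a /(allP (good_tab gth)) /andP[/eqP ha /eqP hb] /=.
  by rewrite ha hb.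
by rewrite hflipK ha hb.
Qed.

Lemma count_tab (Q : pred (vertex G * vertex G)) :
  count (fun a => Q (a.1.2, a.2)) (tab th) =
  (count (fun a => Q (inr (tu th), inl a.1)) (tp th) +
   count (fun a => Q (inr (tw th), inl a.1)) (tq th) +
   sumn [seq count (fun a => Q (a.1.2, a.2)) (line_tab (tu th) (tw th) l.1 l.2) | l <- tl th])%N.
Proof.
rewrite /tab !count_cat !count_map addnA; congr (_ + _)%N.
by rewrite count_flatten -map_comp.
Qed.

Lemma count_cst (T : Type) (b : bool) (s : seq T) : count (fun=> b) s = (size s * b)%N.
Proof. by case: b; [rewrite count_predT muln1 | rewrite count_pred0 muln0]. Qed.

Lemma line_frame_count v s t h r :
  (count (fun a => (a.1.2 == inr v) && is_int a.2) (line_tab s t h r : seq (half_edge G * vertex G * vertex G)) +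
   count (fun a => (a.2 == inr v) && is_int a.1.2) (line_tab s t h r : seq (half_edge G * vertex G * vertex G)) =
   (s == v) + (t == v) + 2 * count_mem v (map (@sv _ _ _) r))%N.
Proof.
elim: r s h => [|a r IH] s h /=; rewrite ?andbT ?andbF /=.
  by rewrite !(inj_eq (@inr_inj _ _)); case: (s == v); case: (t == v).
have := IH (sv a) (sh a); rewrite !(inj_eq (@inr_inj _ _)).
by case: (s == v); case: (t == v); case: (sv a == v) => /=; lia.
Qed.

Lemma line_hair_count v s t h r :
  (count (fun a => (a.1.2 == inr v) && ~~ is_int a.2) (line_tab s t h r : seq (half_edge G * vertex G * vertex G)) +
   count (fun a => (a.2 == inr v) && ~~ is_int a.1.2) (line_tab s t h r : seq (half_edge G * vertex G * vertex G)) =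
   count_mem v (map (@sv _ _ _) r))%N.
Proof.
elim: r s h => [|a r IH] s h /=; rewrite ?andbT ?andbF //=.
have := IH (sv a) (sh a); rewrite !(inj_eq (@inr_inj _ _)).
by case: (s == v); case: (t == v); case: (sv a == v) => /=; lia.
Qed.

Lemma card_fstar v : #|fstar (inr v : vertex G)| =
  (3 * (tu th == v) + 3 * (tw th == v) + 2 * count_mem v (inner th))%N.
Proof.
rewrite (card_tab (fun a b => (a == inr v) && is_int b)).
rewrite (count_tab (fun ab => (ab.1 == inr v) && is_int ab.2)).
rewrite (count_tab (fun ab => (ab.2 == inr v) && is_int ab.1)) /=.
rewrite !count_cst !andbF !muln0 !add0n /inner count_flatten -map_comp.
have := good_lines gth; case: (tl th) => [|[h1 r1] [|[h2 r2] [|[h3 r3] []]]] //= _.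
have := line_frame_count v (tu th) (tw th) h1 r1.
have := line_frame_count v (tu th) (tw th) h2 r2.
have := line_frame_count v (tu th) (tw th) h3 r3.
by move=> /= H1 H2 H3; lia.
Qed.

Lemma card_hstar v : #|hstar (inr v : vertex G)| =
  (size (tp th) * (tu th == v) + size (tq th) * (tw th == v) + count_mem v (inner th))%N.
Proof.
rewrite (card_tab (fun a b => (a == inr v) && ~~ is_int b)).
rewrite (count_tab (fun ab => (ab.1 == inr v) && ~~ is_int ab.2)).
rewrite (count_tab (fun ab => (ab.2 == inr v) && ~~ is_int ab.1)) /=.
rewrite !count_cst !andbT !muln0 !add0n !(inj_eq (@inr_inj _ _)) /inner count_flatten -map_comp.
have := good_lines gth; case: (tl th) => [|[h1 r1] [|[h2 r2] [|[h3 r3] []]]] //= _.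
have := line_hair_count v (tu th) (tw th) h1 r1.
have := line_hair_count v (tu th) (tw th) h2 r2.
have := line_hair_count v (tu th) (tw th) h3 r3.
by move=> /= H1 H2 H3; lia.
Qed.

Lemma inner_uniq : [/\ uniq (inner th), tu th != tw th, tu th \notin inner th & tw th \notin inner th].
Proof.
have := full_uniq (good_ints gth); rewrite /= !inE negb_or.
by case/and3P=> /andP[? ?] ? ?.
Qed.

Lemma ints_case v : [\/ v = tu th, v = tw th | v \in inner th].
Proof.
have := full_mem v (good_ints gth); rewrite !inE => /or3P[/eqP|/eqP|] ?;
  by [apply: Or31 | apply: Or32 | apply: Or33].
Qed.

Lemma fstar_tu : #|fstar (inr (tu th) : vertex G)| = 3.
Proof.
case: inner_uniq => _ uw ui _; rewrite card_fstar eqxx eq_sym (negbTE uw).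
by rewrite (count_memPn ui).
Qed.

Lemma fstar_tw : #|fstar (inr (tw th) : vertex G)| = 3.
Proof.
case: inner_uniq => _ uw _ wi; rewrite card_fstar eqxx (negbTE uw).
by rewrite (count_memPn wi).
Qed.

Lemma fstar_inner v : v \in inner th -> #|fstar (inr v : vertex G)| = 2.
Proof.
case: inner_uniq => iu _ ui wi vi; rewrite card_fstar count_uniq_mem // vi.
by case: eqP vi ui => [-> ->|] // _ vi _; case: eqP vi wi => [-> ->|].
Qed.

Lemma hstar_tu : #|hstar (inr (tu th) : vertex G)| = size (tp th).
Proof.
case: inner_uniq => _ uw ui _; rewrite card_hstar eqxx eq_sym (negbTE uw).
by rewrite (count_memPn ui) muln1 muln0 !addn0.
Qed.

Lemma hstar_tw : #|hstar (inr (tw th) : vertex G)| = size (tq th).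
Proof.
case: inner_uniq => _ uw _ wi; rewrite card_hstar eqxx (negbTE uw).
by rewrite (count_memPn wi) muln1 muln0 !addn0.
Qed.

Lemma hstar_inner v : v \in inner th -> #|hstar (inr v : vertex G)| = 1.
Proof.
case: inner_uniq => iu _ ui wi vi; rewrite card_hstar count_uniq_mem // vi.
by case: eqP vi ui => [-> ->|] // _ vi _; case: eqP vi wi => [-> ->|] //; rewrite !muln0.
Qed.

Lemma line_good l : l \in tl th -> [/\ all (@entry_ok G) (line_tab (tu th) (tw th) l.1 l.2),
  uniq (map fst (line_word l)) & {subset map (@sv _ _ _) l.2 <= inner th}].
Proof.
move=> lth; split.
- apply/allP => a al; apply: (allP (good_tab gth)).
  rewrite !mem_cat; apply/or3P/Or33/flattenP.
  by exists (line_tab (tu th) (tw th) l.1 l.2) => //; apply: map_f.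
- have := full_uniq (good_word gth); rewrite /eword /word !map_cat !cat_uniq.
  case/and3P=> _ _ /and3P[_ _].
  rewrite map_flatten -map_comp => uf.
  by apply: (uniq_flatten_mem uf); apply: (map_f (map fst \o @line_word _ _ _)).
- by move=> v vl; apply/flattenP; exists (map (@sv _ _ _) l.2) => //; apply: (map_f (fun l => map (@sv _ _ _) l.2)).
Qed.

(** Three distinct elements of a set with three elements. Consequently two structures with the same
    [tu] start their lines with the same half-edges, up to order. *)
Lemma firsts_fstar : uniq (map fst (tl th)) /\ map fst (tl th) =i fstar (inr (tu th) : vertex G).
Proof.
have u1 : uniq (map fst (tl th)).
  have := full_uniq (good_word gth); rewrite /eword /word !map_cat !cat_uniq.
  case/and3P=> _ _ /and3P[_ _] /map_uniq.
  elim: (tl th) => [|[h r] ls IH] //.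
  rewrite (_ : flatten _ = line_word (h, r) ++ flatten (map (@line_word _ _ _) ls)) //.
  rewrite cat_uniq => /and3P[_ hn /IH E]; rewrite map_cons cons_uniq E andbT.
  apply: contra hn => /mapP[l ll /= ->]; apply/hasP; exists l.1; last by rewrite inE eqxx.
  by apply/flattenP; exists (line_word l); [apply: map_f | rewrite inE eqxx].
have sub : {subset map fst (tl th) <= fstar (inr (tu th) : vertex G)}.
  move=> _ /mapP[l /line_good[lt _ _] ->]; rewrite inE.
  by case: (l) lt => h [|a r] /= /andP[/andP[/= -> /eqP ->] _].
split=> //; apply/subset_cardP; last by apply/subsetP.
by rewrite fstar_tu (card_uniqP u1) size_map (good_lines gth).
Qed.

End Counting.

Lemma eq_card1 (T : finType) (A : {set T}) x y : #|A| = 1 -> x \in A -> y \in A -> x = y.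
Proof. by move/eqP/cards1P=> [z ->]; rewrite !inE => /eqP-> /eqP->. Qed.

Lemma eq_card2 (T : finType) (A : {set T}) z x y :
  #|A| = 2 -> z \in A -> x \in A -> y \in A -> x != z -> y != z -> x = y.
Proof.
move=> A2 zA xA yA xz yz; apply: (eq_card1 (A := A :\ z)); rewrite ?inE ?xz ?yz //.
by move: A2; rewrite (cardsD1 z) zA => -[].
Qed.

Lemma line_unique (G : ograph) (s s' t t' : 'I_(n_int G)) h r r' :
  all (@entry_ok G) (line_tab s t h r) -> all (@entry_ok G) (line_tab s' t' h r') ->
  uniq (map fst (line_word (h, r))) -> uniq (map fst (line_word (h, r'))) ->
  (forall v, v \in map (@sv _ _ _) r -> #|fstar (inr v : vertex G)| = 2 /\ #|hstar (inr v : vertex G)| = 1) ->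
  (forall v, v \in map (@sv _ _ _) r' -> #|fstar (inr v : vertex G)| = 2) ->
  #|fstar (inr t : vertex G)| = 3 -> #|fstar (inr t' : vertex G)| = 3 ->
  r = r' /\ t = t'.
Proof.
move=> ok ok' u u' c c' ct ct'.
elim: r s s' h r' ok ok' u u' c c' => [|a r IH] s s' h [|a' r'] /=.
- case/andP=> /andP[/= _ /eqP E1] _ /andP[/andP[/= _]].
  by rewrite E1 => /eqP[->].
- case/andP=> /andP[/= _ /eqP E1] _ /and3P[/andP[/= _]].
  rewrite E1 => /eqP[E] _ _ _ _ _ /(_ (sv a')).
  by rewrite inE eqxx -E ct => /(_ isT).
- case/and3P=> /andP[/= _ /eqP E1] _ _ /andP[/andP[/= _]].
  rewrite E1 => /eqP[E] _ _ _ /(_ (sv a)).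
  by rewrite inE eqxx E ct' => /(_ isT) [].
case/and3P=> /andP[/= hs hv] /andP[/= kv kx] ok /and3P[/andP[/= hs' hv'] /andP[/= kv' kx'] ok'].
move=> /and4P[ha ka ua ur] /and4P[ha' ka' ua' ur'] c c'.
have [c2 c1] : #|fstar (inr (sv a) : vertex G)| = 2 /\ #|hstar (inr (sv a) : vertex G)| = 1.
  by apply: c; rewrite inE eqxx.
have vE : sv a' = sv a by move: hv'; rewrite (eqP hv) => /eqP[].
have kE : sk a' = sk a.
  apply: (eq_card1 c1); rewrite inE; first by rewrite -vE kv' (eqP kx').
  by rewrite kv (eqP kx).
have xE : sx a' = sx a by move: kx'; rewrite kE (eqP kx) => /eqP[].
have tail_inc s0 t0 h0 (r0 : seq (gstep G)) :
    all (@entry_ok G) (line_tab s0 t0 h0 r0) -> h0 \in fstar (inr s0 : vertex G).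
  by case: r0 => [|b r0] /= /andP[/andP[/= h1 /eqP h2] _]; rewrite inE h1 h2.
have hE : sh a' = sh a.
  (* [hflip h] is the half-edge of arrival; each line leaves by the only other frame half-edge. *)
  apply: (eq_card2 (z := hflip h) c2); rewrite ?(tail_inc _ _ _ _ ok) //.
  - by rewrite inE hflipK hv (eqP hs).
  - by rewrite -vE (tail_inc _ _ _ _ ok').
  - by apply: contra ha' => /eqP E; rewrite !inE E eqxx orbT.
  - by apply: contra ha => /eqP E; rewrite !inE E eqxx orbT.
have [] := IH (sv a) (sv a') (sh a) r' ok.
- by rewrite -hE.
- exact/andP.
- by rewrite -hE; apply/andP.
- by move=> v vr; apply: c; rewrite inE vr orbT.
- by move=> v vr; apply: c'; rewrite inE vr orbT.
move=> rE tE.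
split=> //; rewrite rE; congr (_ :: _).
by case: (a) (a') vE kE xE hE => ? ? ? ? [? ? ? ?] /= -> -> -> ->.
Qed.

Lemma par_of_perm (A : Type) (B : eqType) (k : A -> B) (s : seq A) (t : seq B) :
  perm_eq (map k s) t -> exists b l, par b s l /\ map k l = t.
Proof.
elim: t s => [|y t IH] s st.
  by exists false, s; split; [exact: par_refl | apply/size0nil; rewrite (perm_size st)].
have : y \in map k s by rewrite (perm_mem st) inE eqxx.
move=> ys; have [s1 [x [s2 [sE xE]]]] : exists s1 x s2, s = s1 ++ x :: s2 /\ k x = y.
  elim: (s) ys => //= z s' IHs; rewrite inE => /orP[/eqP->|/IHs[s1 [x [s2 [-> <-]]]]].
    by exists [::], z, s'.
  by exists (z :: s1), x, s2.
have [|b [l [pl lE]]] := IH (s1 ++ s2).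
  by move: st; rewrite sE !map_cat /= xE perm_catC /= perm_cons perm_catC.
exists (odd (size s1) (+) b), (x :: l); split; last by rewrite /= xE lE.
rewrite sE; apply: par_trans (par_cons x pl).
exact/par_sym/par_move.
Qed.

Section Weights.

(** These are the signs of [par_lines] and [par_mirror], which makes the weight times the sign of
    the word independent of the chosen structure. *)
Definition sym_weight (W : seq nat -> nat -> nat -> rat) : Prop :=
  (forall b ns ns' p q, par b ns ns' -> W ns' p q = (-1) ^+ b * W ns p q) /\
  (forall ns p q, W ns q p = (-1) ^+ (odd (sumn ns) (+) (odd p && odd q)) * W ns p q).

Definition weight (X I D : Type) (W : seq nat -> nat -> nat -> rat) (th : theta X I D) :=
  W (shape th).1.1 (shape th).1.2 (shape th).2.

Variables (W : seq nat -> nat -> nat -> rat).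
Hypothesis symW : sym_weight W.
Variable G : ograph.
Implicit Types th : gtheta G.

(** The lines are forced by [line_unique], which also gives the second branch vertex; the hairs at
    the branch vertices are forced because there is at most one at each. *)
Lemma same_theta th th' : good th -> good th' -> tu th = tu th' ->
  map fst (tl th) = map fst (tl th') -> th = th'.
Proof.
move=> gd gd' uE fE.
have lineE l l' : l \in tl th -> l' \in tl th' -> l.1 = l'.1 -> l.2 = l'.2 /\ tw th = tw th'.
  move=> /(line_good gd)[] ok un sub /(line_good gd')[] ok' un' sub' hE.
  case: l l' ok un sub ok' un' sub' hE => h r [h' r'] /= ok un sub ok' un' sub' hE; subst h'.
  apply: (line_unique ok ok' un un'); rewrite ?(fstar_tw gd) ?(fstar_tw gd') //.
    by move=> v /sub vi; rewrite (fstar_inner gd) // (hstar_inner gd).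
  by move=> v /sub' vi; rewrite (fstar_inner gd').
have lsE : tl th = tl th'.
  elim: (tl th) (tl th') lineE fE => [|[h r] ls IH] [|[h' r'] ls'] //= lineE [hE fE].
  have [|//|//|rE _] := lineE (h, r) (h', r'); rewrite ?inE ?eqxx //.
  rewrite /= in rE; rewrite rE hE; congr (_ :: _); apply: IH => // l l' ll ll'.
  by apply: lineE; rewrite inE ?ll ?ll' orbT.
have wE : tw th = tw th'.
  have := good_lines gd; case E: (tl th) => [|l ls] // _.
  have lth : l \in tl th by rewrite E inE eqxx.
  by have [] := lineE l l lth; rewrite -?lsE.
have hairE (v : 'I_(n_int G)) (p p' : seq ('I_(n_ext G) * half_edge G)) :
    (size p <= 1)%N -> size p = #|hstar (inr v : vertex G)| -> size p' = size p ->
    all (@entry_ok G) [seq (a.2, inr v, inl a.1) | a <- p] ->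
    all (@entry_ok G) [seq (a.2, inr v, inl a.1) | a <- p'] -> p = p'.
  case: p p' => [|[x d] [|? ?]] [|[x' d'] [|? ?]] // _ c1 _.
  rewrite /= !andbT => /andP[/= dv dx] /andP[/= dv' dx'].
  have dE : d = d' by apply: (eq_card1 (esym c1)); rewrite inE ?dv ?dv' ?(eqP dx) ?(eqP dx').
  by move: dx'; rewrite -dE (eqP dx) => /eqP[->].
have /= := good_tab gd; rewrite /tab !all_cat => /and3P[pE qE _].
have /= := good_tab gd'; rewrite /tab !all_cat => /and3P[pE' qE' _].
have ppE : tp th = tp th'.
  apply: (hairE (tu th)) => //; first exact: good_tp gd.
  - by rewrite (hstar_tu gd).
  - by rewrite -(hstar_tu gd') -(hstar_tu gd) uE.
  - by rewrite uE.
have qqE : tq th = tq th'.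
  apply: (hairE (tw th)) => //; first exact: good_tq gd.
  - by rewrite (hstar_tw gd).
  - by rewrite -(hstar_tw gd') -(hstar_tw gd) wE.
  - by rewrite wE.
by case: (th) (th') uE wE ppE qqE lsE => ? ? ? ? ? [? ? ? ? ?] /= -> -> -> -> ->.
Qed.

Lemma weight_set_lines th l b : par b (tl th) l ->
  weight W (set_lines th l) = (-1) ^+ b * weight W th.
Proof. by move=> pl; rewrite /weight /shape /=; apply: (proj1 symW); apply: par_map. Qed.

Lemma weight_mirror th : weight W (mirror th) =
  (-1) ^+ (odd (sumn (shape th).1.1) (+) (odd (size (tp th)) && odd (size (tq th)))) * weight W th.
Proof. by rewrite /weight shape_mirror /= (proj2 symW). Qed.

(** The vertex [tu th'] has three frame half-edges, hence is one of the two branch vertices of [th].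
    After mirroring if necessary, the two structures differ by a permutation of the lines. *)
Lemma weight_unique th th' : good th -> good th' ->
  weight W th' = sgn (eword th) (eword th') * weight W th.
Proof.
move=> gd gd'; have [fw fw'] := (good_word gd, good_word gd').
have core th1 : good th1 -> tu th1 = tu th' ->
    weight W th' = sgn (eword th1) (eword th') * weight W th1.
  move=> gd1 uE; have fw1 := good_word gd1.
  have [u1 f1] := firsts_fstar gd1; have [u' f'] := firsts_fstar gd'.
  have /par_of_perm[b [l [pl lE]]] : perm_eq (map fst (tl th1)) (map fst (tl th')).
    by apply: uniq_perm => // h; rewrite f1 f' uE.
  have gd2 := good_set_lines gd1 pl.
  have E : set_lines th1 l = th' by apply: same_theta.
  rewrite -[X in weight W X]E (weight_set_lines pl); congr (_ * _).
  by rewrite -E (sgn_par (eword_par (par_set_lines pl))).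
have [uE|uE|ui] := ints_case gd (tu th'); first exact: core.
  have gdr := good_mirror gd.
  rewrite (core (mirror th)) ?uE // weight_mirror mulrA; congr (_ * _).
  rewrite -(sgn_par (par_mirror th) fw) mulrC (sgn_trans fw (good_word gdr) fw') //.
by have := fstar_tu gd'; rewrite (fstar_inner gd ui).
Qed.

End Weights.

Definition hedge (G : ograph) (e : edge G) : bool := [exists b, ~~ is_int (inc G (e, b))].

(** * Theta graphs are two-loop hairy *)

Section CellGraph.
Variable G : ograph.
Implicit Types (X A : {set cell G}) (c d : cell G).

Lemma cell_adj_sym X : symmetric (cell_adj X).
Proof. by move=> [v|e] [w|e'] //; rewrite /cell_adj andbCA. Qed.

Lemma connect_adj_sym X : connect_sym (cell_adj X).
Proof. exact/sym_connect_sym/cell_adj_sym. Qed.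

Lemma component_sub X A c : c \in A ->
  (forall d d', cell_adj X d d' -> d \in A -> d' \in A) -> component X c \subset A.
Proof.
move=> cA cl; apply/subsetP => d; rewrite inE => /connectP[p].
elim: p c cA => [|c' p IH] c cA /=; first by move=> _ ->.
by case/andP=> cc' pp; apply: IH pp; apply: cl cc' cA.
Qed.

Lemma half_incident h : incident (inc G h) h.1.
Proof. by apply/existsP; exists h.2; case: h => e b /=. Qed.

(** Without [e] the univalent end is an isolated point, which is a tree. The rest of the graph has
    lost one vertex and one edge, so it keeps Betti number 2 and is not a tree. *)
Lemma ext_tree_type e b : connected [set: cell G] -> betti1 [set: cell G] = 2 ->
  valence (inc G (e, b)) = 1%N -> tree_type e.
Proof.
move=> /forall_inP cG bG val1.
pose x := inc G (e, b); pose y := inc G (e, ~~ b); pose X : {set cell G} := [set~ inr e].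
have starx h : inc G h = x -> h = (e, b).
  by move=> hx; apply: (eq_card1 val1); rewrite inE ?hx.
have incx e' : incident x e' -> e' = e by case/existsP=> b' /eqP /starx [].
have xy : x != y.
  by apply/eqP => xy; have [] := starx (e, ~~ b) (esym xy); case: (b).
have ince v : incident v e -> v = x \/ v = y.
  case/existsP=> b' /eqP <-; have [->|nb] := eqVneq b' b; [by left | right].
  by rewrite /y; case: b nb {val1 x y starx incx xy} => [] ; case: b'.
have compx : component X (inl x) = [set inl x].
  apply/eqP; rewrite eqEsubset sub1set inE connect0 andbT.
  apply: component_sub => [|c d]; rewrite !inE // => adj /eqP cE; move: adj; rewrite cE.
  by case: d => [v|e'] /and3P[_ eX] // /incx eE; move: eX; rewrite eE !inE eqxx.
have compy : component X (inl y) = ~: [set inr e; inl x].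
  apply/eqP; rewrite eqEsubset; apply/andP; split.
    apply: component_sub => [|c d]; rewrite !inE.
      by rewrite /= eq_sym; apply: contra xy => /eqP[->].
    case/and3P; rewrite !inE => ce de adj _; rewrite negb_or de /=.
    apply: contraL adj => /eqP dE; rewrite dE; case: c ce => // e' ce; apply/negP => /incx eE.
    by rewrite eE eqxx in ce.
  (* Adding back [e] and [x] gives a set closed under adjacency in the whole graph, so by
     connectedness it contains every cell. *)
  pose B := component X (inl y) :|: [set inr e; inl x].
  have BT : component [set: cell G] (inl y) \subset B.
    apply: component_sub => [|c d]; rewrite !inE ?connect0 //.
    case/and3P=> _ _ adj /orP[yc|/orP[/eqP cE|/eqP cE]]; last 2 first.
    - move: adj; rewrite cE; case: d => // v /ince[]->; rewrite ?eqxx ?orbT //.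
      by rewrite connect0.
    - by move: adj; rewrite cE; case: d => // e' /incx ->; rewrite eqxx !orbT.
    have [->|de] := eqVneq d (inr e); first by rewrite orbT.
    apply/orP; left; apply: (connect_trans yc); apply: connect1.
    rewrite /cell_adj !inE de /= adj andbT; apply: contraTneq yc => ->.
    have: inr e \notin component X (inl y); last by rewrite inE.
    apply/negP => /(subsetP (component_sub (A := X) _ _)); rewrite !inE eqxx => /(_ _ _) H.
    by have := H isT (fun c d => fun adj => let: And3 _ b _ := and3P adj in fun _ => b).
  apply/subsetP => c; rewrite inE => cn.
  have : c \in B by apply: (subsetP BT); rewrite inE; apply: (forall_inP (cG _ (in_setT _))); rewrite in_setT.
  by rewrite inE (negbTE cn) orbF.
have treex : is_tree (component X (inl x)).
  rewrite compx /is_tree; apply/andP; split.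
    by apply/forall_inP => c /set1P->; apply/forall_inP => d /set1P->; rewrite connect0.
  rewrite /betti1 (_ : [set v | _] = [set x]); last by apply/setP => v; rewrite !inE.
  rewrite (_ : [set e' | _] = set0); last by apply/setP => v; rewrite !inE.
  by rewrite cards1 cards0.
have treey : is_tree (component X (inl y)) = false.
  apply/negbTE/negP => /andP[_]; rewrite compy => /eqP.
  move: bG; rewrite /betti1.
  rewrite (_ : [set v | inl v \in [set: cell G]] = [set: vertex G]); last by apply/setP => v; rewrite !inE.
  rewrite (_ : [set v | inr v \in [set: cell G]] = [set: edge G]); last by apply/setP => v; rewrite !inE.
  rewrite (_ : [set v | _] = [set~ x]); last by apply/setP => v; rewrite !inE.
  rewrite (_ : [set e' | _] = [set~ e]); last by apply/setP => v; rewrite !inE orbF.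
  have := cardsC [set x]; have := cardsC [set e]; rewrite !cards1 !cardsT.
  by move=> <- <-; lia.
have yx : inl y \notin component X (inl x) by rewrite compx inE; apply: contra xy => /eqP[->].
have xny : inl x \notin component X (inl y) by rewrite compy !inE eqxx orbT.
rewrite /tree_type -/X; move: treex treey yx xny; rewrite /x /y.
by case: (b) => /= H1 H2 H3 H4; rewrite H1 H2 ?H3 ?H4.
Qed.

Lemma path_adj X c p : path (cell_adj [set: cell G]) c p -> {subset c :: p <= X} ->
  path (cell_adj X) c p.
Proof.
elim: p c => //= c' p IH c /andP[/and3P[_ _ cc'] pp] sX.
rewrite IH ?andbT //; last by move=> d dp; apply: sX; rewrite inE dp orbT.
by rewrite /cell_adj cc' !sX ?inE ?eqxx ?orbT.
Qed.

Lemma path_adj_last X c p : path (cell_adj [set: cell G]) c p -> {subset c :: p <= X} ->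
  connect (cell_adj X) c (last c p).
Proof. by move=> pp sX; apply/connectP; exists p => //; apply: path_adj. Qed.

(** As [d] occurs at most once on the path, the part before [c] or the part after [c] avoids it. *)
Lemma path_minus X c0 p c d : path (cell_adj [set: cell G]) c0 p -> uniq (c0 :: p) ->
  (forall c, c \in c0 :: p -> c != d -> c \in X) -> c \in c0 :: p -> c != d ->
  (c0 != d) && connect (cell_adj X) c c0 || (last c0 p != d) && connect (cell_adj X) c (last c0 p).
Proof.
move=> pp up pX cp; case/splitPl: cp pp up pX => p1 p2 cE; subst c.
rewrite cat_path last_cat -cat_cons cat_uniq => /andP[pp1 pp2] /and3P[_ dis _] pX cd.
have [d1|d1] := boolP (d \in c0 :: p1); last first.
  apply/orP; left; apply/andP; split.
    by apply: contra d1 => /eqP->; rewrite inE eqxx.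
  rewrite connect_adj_sym; apply: path_adj_last => // c cp1; apply: pX.
    by rewrite mem_cat cp1.
  by apply: contraNneq d1 => <-.
have d2 : d \notin p2 by apply: contra dis => d2; apply/hasP; exists d.
apply/orP; right; apply/andP; split.
  by have := mem_last (last c0 p1) p2; rewrite inE => /orP[/eqP->|lp]; rewrite ?cd //;
     apply: contraNneq d2 => <-.
apply: path_adj_last => // c; rewrite inE => /orP[/eqP->|cp2]; apply: pX; rewrite ?mem_cat ?mem_last ?cp2 ?orbT //.
by apply: contraNneq d2 => <-.
Qed.

End CellGraph.

Fixpoint line_cells (G : ograph) (t : 'I_(n_int G)) (h : half_edge G)
    (r : seq (gstep G)) : seq (cell G) :=
  if r is a :: r' then [:: inr h.1, inl (inr (sv a)) & line_cells t (sh a) r']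
  else [:: inr h.1; inl (inr t)].

Section LineCells.
Variable G : ograph.
Implicit Types (t : 'I_(n_int G)) (h : half_edge G).

Lemma line_cells_path s t h r : all (@entry_ok G) (line_tab s t h r) ->
  path (cell_adj [set: cell G]) (inl (inr s)) (line_cells t h r).
Proof.
have inc2 h' v w : entry_ok (h', v, w) -> incident v h'.1 /\ incident w h'.1.
  by case/andP=> /= /eqP <- /eqP <-; split; [| rewrite -[h'.1]/((hflip h').1)]; apply: half_incident.
elim: r s h => [|a r IH] s h /=.
  by rewrite andbT => /inc2[]; rewrite /cell_adj !inE => -> ->.
by case/and3P=> /inc2[i1 i2] _ /IH ->; rewrite /cell_adj !inE i1 i2.
Qed.

Lemma line_cells_last t h r c : last c (line_cells t h r) = inl (inr t).
Proof. by elim: r h c => //= a r IH h c. Qed.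

Lemma mem_line_cells_edge t h r e : (inr e \in line_cells t h r) =
  (e == h.1) || (e \in map (fun a => (sh a).1) r).
Proof.
elim: r h => [|a r IH] h /=; first by rewrite !inE orbF.
by rewrite !inE IH.
Qed.

Lemma mem_line_cells_vertex t h r v : (inl (inr v) \in line_cells t h r) =
  (v == t) || (v \in map (@sv _ _ _) r).
Proof.
elim: r h => [|a r IH] h /=; first by rewrite !inE orbF.
by rewrite !inE IH /= orbCA.
Qed.

Lemma mem_line_cells_ext t h r x : (inl (inl x) \in line_cells t h r) = false.
Proof. by elim: r h => [|a r IH] h /=; rewrite !inE ?IH. Qed.

Lemma next_edges_word h (r : seq (gstep G)) e :
  (e == h.1) || (e \in map (fun a => (sh a).1) r) -> e \in map fst (line_word (h, r)).
Proof.
rewrite inE; case: eqP => //= _; elim: r => //= a r IH; rewrite !inE => /orP[->|/IH->]; by rewrite !orbT.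
Qed.

Lemma line_cells_uniq t h r : uniq (map fst (line_word (h, r))) ->
  uniq (map (@sv _ _ _) r) -> t \notin map (@sv _ _ _) r -> uniq (line_cells t h r).
Proof.
elim: r h => [|a r IH] h //= /and3P[hn kn uw] /andP[an ur]; rewrite inE negb_or => /andP[ta tr].
rewrite IH // mem_line_cells_vertex negb_or (eq_sym (sv a)) ta an !andbT inE /= mem_line_cells_edge.
by apply: contra hn => /next_edges_word H; rewrite inE H orbT.
Qed.

End LineCells.

Section GoodTheta.
Variables (G : ograph) (th : gtheta G).
Hypothesis gth : good th.

(** The frame, described without tree-type edges; [frame_theta] identifies the two once the
    tree-type edges are known to be the hairs. *)
Definition theta_cell (c : cell G) : bool :=
  match c with inl v => is_int v | inr e => ~~ hedge e end.

Lemma tab_frame a : a \in tab th -> is_int a.2 ->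
  exists2 l, l \in tl th & inr a.1.1.1 \in line_cells (tw th) l.1 l.2.
Proof.
rewrite !mem_cat => /or3P[/mapP[b _ ->]|/mapP[b _ ->]|] //.
case/flattenP=> _ /mapP[[h r] lth ->] al ai; exists (h, r) => //.
rewrite mem_line_cells_edge /=; move: al; rewrite /=.
elim: r (tu th) h {lth} => [|b r IH] s h /=; first by rewrite inE => /eqP->; rewrite eqxx.
rewrite !inE => /or3P[/eqP->|/eqP E|/IH->]; rewrite ?eqxx ?orbT //.
by rewrite E in ai.
Qed.

Lemma edge_entry e : exists2 a, a \in tab th & a.1.1.1 = e.
Proof.
have : e \in eword th := full_mem e (good_word gth).
by rewrite /eword -tab_word => /mapP[_ /mapP[a ath ->] ->]; exists a.
Qed.

Lemma tab_hedge a : a \in tab th -> hedge a.1.1.1 = ~~ is_int a.2.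
Proof.
move=> ath; have /andP[/eqP h1 /eqP h2] := allP (good_tab gth) a ath.
have i1 : is_int a.1.2.
  move: ath; rewrite !mem_cat => /or3P[/mapP[b _ ->]|/mapP[b _ ->]|] //.
  case/flattenP=> _ /mapP[[h r] lth ->] /=.
  elim: r (tu th) h {lth} => [|b r IH] s h /=; first by rewrite inE => /eqP->.
  by rewrite !inE => /or3P[/eqP->|/eqP->|/IH].
apply/existsP/idP => [[b]|ni]; last first.
  by exists (~~ a.1.1.2); rewrite -[(_, _)]/(hflip a.1.1) h2.
have [->|nb] := eqVneq b a.1.1.2; first by rewrite -surjective_pairing h1 i1.
by rewrite (_ : (_, _) = hflip a.1.1) ?h2 // /hflip; congr pair; case: b (a.1.1.2) nb => [] [].
Qed.

Lemma theta_cell_line c : theta_cell c ->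
  exists2 l, l \in tl th & c \in inl (inr (tu th)) :: line_cells (tw th) l.1 l.2.
Proof.
have l0 : exists l, l \in tl th.
  by have := good_lines gth; case: (tl th) => // l ls _; exists l; rewrite inE eqxx.
case: c => [[x|v]|e] //= => [_|ne].
  have [l lth] := l0; have [->|->|] := ints_case gth v.
  - by exists l; rewrite // inE eqxx.
  - by exists l; rewrite // inE mem_line_cells_vertex eqxx orbT.
  case/flattenP=> _ /mapP[l' lth' ->] vl; exists l' => //.
  by rewrite inE mem_line_cells_vertex vl !orbT.
have [a ath ae] := edge_entry e.
have [|l lth al] := tab_frame ath; first by move: ne; rewrite -ae (tab_hedge ath) negbK.
by exists l; rewrite // inE -ae al orbT.
Qed.

Lemma line_cells_theta l c : l \in tl th ->
  c \in inl (inr (tu th)) :: line_cells (tw th) l.1 l.2 -> theta_cell c.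
Proof.
move=> lth; case: c => [[x|v]|e] //; first by rewrite inE mem_line_cells_ext.
rewrite inE mem_line_cells_edge /= => el.
suff [a ath [ae ai]] : exists2 a, a \in tab th & a.1.1.1 = e /\ is_int a.2.
  by rewrite -ae (tab_hedge ath) negbK.
suff [a al H] : exists2 a, a \in line_tab (tu th) (tw th) l.1 l.2 & a.1.1.1 = e /\ is_int a.2.
  exists a => //; rewrite !mem_cat; apply/or3P/Or33/flattenP.
  by exists (line_tab (tu th) (tw th) l.1 l.2) => //; apply: map_f.
case: l el {lth} => h r /=; elim: r (tu th) h => [|b r IH] s h /=.
  by rewrite orbF => /eqP->; exists (h, inr s, inr (tw th)); rewrite ?inE.
case/orP=> [/eqP->|]; first by exists (h, inr s, inr (sv b)); rewrite ?inE ?eqxx.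
by rewrite inE => /(IH (sv b))[a al H]; exists a; rewrite // !inE al !orbT.
Qed.

Lemma tcells_uniq l : l \in tl th -> uniq (inl (inr (tu th)) :: line_cells (tw th) l.1 l.2).
Proof.
move=> lth; have [_ uw sub] := line_good gth lth; have [ui uw' un wn] := inner_uniq gth.
rewrite /= mem_line_cells_vertex negb_or uw' (contra (@sub _) un) /=.
apply: line_cells_uniq; first by case: (l) uw.
  by apply: (uniq_flatten_mem ui); apply: (map_f (fun l => map (@sv _ _ _) l.2)).
by apply: contra wn; apply: sub.
Qed.

(** Two lines meet only in the branch vertices, so any other cell lies on at most one of them. *)
Lemma avoid_line d : d != inl (inr (tu th)) -> d != inl (inr (tw th)) ->
  exists2 l, l \in tl th & d \notin inl (inr (tu th)) :: line_cells (tw th) l.1 l.2.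
Proof.
move=> du dw; have := good_lines gth; have [ui _ _ _] := inner_uniq gth.
have := full_uniq (good_word gth); rewrite /eword /word !map_cat !cat_uniq.
case/and3P=> _ _ /and3P[_ _]; rewrite map_flatten -map_comp; move: ui; rewrite /inner.
case: (tl th) => [|l1 [|l2 ls]] // ui uw _.
have [d1|d1] := boolP (d \in inl (inr (tu th)) :: line_cells (tw th) l1.1 l1.2); last first.
  by exists l1; rewrite ?inE ?eqxx.
exists l2; first by rewrite !inE eqxx orbT.
apply/negP; move: d1; rewrite !(in_cons, negb_or) (negbTE du) /=.
case: d du dw => [[x|v]|e] du dw; first by rewrite mem_line_cells_ext.
  have vw : v != tw th by apply: contra dw => /eqP->.
  rewrite !mem_line_cells_vertex (negbTE vw) /= => v1 v2; move: ui; rewrite /= cat_uniq => /and3P[_ /hasP[]]; exists v => //.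
  by rewrite mem_cat v2.
rewrite !mem_line_cells_edge => /next_edges_word e1 /next_edges_word e2.
move: uw; rewrite (_ : flatten _ = map fst (line_word l1) ++
  flatten (map (map fst \o @line_word _ _ _) (l2 :: ls))) // cat_uniq => /and3P[_ /hasP[]].
exists e; last by case: (l1) e1.
by apply/flattenP; exists (map fst (line_word l2)); [rewrite inE eqxx | case: (l2) e2].
Qed.

(** Along its own line every cell reaches a branch vertex without meeting [d], and some line joins
    the branch vertices while avoiding [d]. Taking for [d] a vertex excludes cut vertices, an edge
    shows that frame edges are not tree-type, and an external vertex gives connectedness of the
    theta part. *)
Lemma theta_minus_connected (X : {set cell G}) d c c' :
  (forall c, theta_cell c -> c != d -> c \in X) ->
  theta_cell c -> theta_cell c' -> c != d -> c' != d -> connect (cell_adj X) c c'.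
Proof.
move=> dX.
pose U : cell G := inl (inr (tu th)); pose W : cell G := inl (inr (tw th)).
have toUW c0 : theta_cell c0 -> c0 != d ->
    (U != d) && connect (cell_adj X) c0 U || (W != d) && connect (cell_adj X) c0 W.
  move=> tc cd; have [l lth cl] := theta_cell_line tc.
  have [ok _ _] := line_good gth lth.
  have := path_minus (line_cells_path ok) (tcells_uniq lth) _ cl cd.
  rewrite line_cells_last; apply=> c1 c1l; apply: dX.
  exact: line_cells_theta lth c1l.
have main r : (forall c0, theta_cell c0 -> c0 != d -> connect (cell_adj X) c0 r) ->
    theta_cell c -> theta_cell c' -> c != d -> c' != d -> connect (cell_adj X) c c'.
  move=> H tc tc' cd cd'; apply: connect_trans (H _ tc cd) _.
  by rewrite connect_adj_sym; apply: H.
have [Ud|Ud] := eqVneq U d.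
  by apply: (main W) => c0 tc cd; have := toUW c0 tc cd; rewrite Ud eqxx => /andP[].
have [Wd|Wd] := eqVneq W d.
  by apply: (main U) => c0 tc cd; have := toUW c0 tc cd; rewrite Wd eqxx /= orbF => /andP[].
have UW : connect (cell_adj X) U W.
  have [l lth dl] : exists2 l, l \in tl th & d \notin U :: line_cells (tw th) l.1 l.2.
    by apply: avoid_line; rewrite eq_sym.
  have [ok _ _] := line_good gth lth.
  rewrite /W -(line_cells_last (tw th) l.1 l.2 U); apply: path_adj_last (line_cells_path ok) _ => c0 cl.
  apply: dX; first exact: line_cells_theta lth cl.
  by apply: contraNneq dl => <-.
apply: (main U) => c0 tc cd; have /orP[/andP[]//|/andP[_ cW]] := toUW c0 tc cd.
by apply: connect_trans cW _; rewrite connect_adj_sym.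
Qed.

End GoodTheta.

Lemma card_star (G : ograph) (v : vertex G) : #|star v| = (#|fstar v| + #|hstar v|)%N.
Proof.
rewrite -(cardsID [set h | is_int (inc G (hflip h))] (star v)); congr (_ + _)%N.
  by apply: eq_card => h; rewrite !inE.
by apply: eq_card => h; rewrite !inE andbC.
Qed.

Lemma hedge_half (G : ograph) (h : half_edge G) :
  hedge h.1 = ~~ (is_int (inc G h) && is_int (inc G (hflip h))).
Proof.
rewrite negb_and; apply/existsP/orP => [[b]|[H|H]]; last 2 first.
- by exists h.2; rewrite -surjective_pairing.
- by exists (~~ h.2).
case: h => e b'; rewrite /hflip /=; have [->|] := eqVneq b b'; first by left.
by case: b b' => [] [] // _; right.
Qed.

Section GoodHairy.
Variables (G : ograph) (th : gtheta G).
Hypothesis gth : good th.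

Lemma tab_inc a : a \in tab th -> inc G a.1.1 = a.1.2 /\ inc G (hflip a.1.1) = a.2.
Proof. by move/(allP (good_tab gth)) => /andP[/eqP ? /eqP]. Qed.

Lemma tab_inner a : a \in tab th -> is_int a.1.2.
Proof.
rewrite !mem_cat => /or3P[/mapP[b _ ->]|/mapP[b _ ->]|] //.
case/flattenP=> _ /mapP[[h r] lth ->] /=.
elim: r (tu th) h {lth} => [|b r IH] s h /=; first by rewrite inE => /eqP->.
by rewrite !inE => /or3P[/eqP->|/eqP->|/IH].
Qed.

Lemma line_ext_count x s t h r :
  (count (fun a => (a.1.2 == inl x)) (line_tab s t h r : seq (half_edge G * vertex G * vertex G)) +
   count (fun a => (a.2 == inl x)) (line_tab s t h r : seq (half_edge G * vertex G * vertex G)) =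
   count_mem x (map (@sx _ _ _) r))%N.
Proof.
elim: r s h => [|a r IH] s h //=.
by have := IH (sv a) (sh a); rewrite !(inj_eq (@inl_inj _ _)); case: (sx a == x) => /=; lia.
Qed.

Lemma valence_ext x : valence (inl x : vertex G) = 1%N.
Proof.
have -> : valence (inl x : vertex G) = count_mem x (exts th).
  rewrite /valence /star (card_tab gth (fun a b => a == inl x)).
  rewrite (count_tab th (fun ab => ab.1 == inl x)).
  rewrite (count_tab th (fun ab => ab.2 == inl x)) /=.
  rewrite !count_cst !muln0 !add0n.
  rewrite /exts !count_cat !count_map count_flatten -map_comp.
  rewrite (eq_count (a2 := fun a => a.1 == x)); last by move=> a /=; rewrite (inj_eq (@inl_inj _ _)).
  rewrite [count _ (tq th)](eq_count (a2 := fun a => a.1 == x)); last by move=> a /=; rewrite (inj_eq (@inl_inj _ _)).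
  have := good_lines gth; case: (tl th) => [|[h1 r1] [|[h2 r2] [|[h3 r3] []]]] //= _.
  have := line_ext_count x (tu th) (tw th) h1 r1.
  have := line_ext_count x (tu th) (tw th) h2 r2.
  have := line_ext_count x (tu th) (tw th) h3 r3.
  move=> /= H1 H2 H3.
  have E1 : count (preim fst (eq_op^~ x)) (tp th) = count (fun a => a.1 == x) (tp th) by [].
  have E2 : count (preim fst (eq_op^~ x)) (tq th) = count (fun a => a.1 == x) (tq th) by [].
  by rewrite E1 E2; lia.
by rewrite count_uniq_mem ?(full_uniq (good_exts gth)) // (full_mem _ (good_exts gth)).
Qed.

Lemma valence_int v : valence (inr v : vertex G) =
  (3 + size (tp th) * (tu th == v) + size (tq th) * (tw th == v))%N.
Proof.
rewrite /valence card_star (card_fstar gth) (card_hstar gth).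
have [iu uw ui wi] := inner_uniq gth.
have [->|->|vi] := ints_case gth v.
- by rewrite eqxx eq_sym (negbTE uw) (count_memPn ui); lia.
- by rewrite eqxx (negbTE uw) (count_memPn wi); lia.
have uv : tu th != v by apply: contraNneq ui => ->.
have wv : tw th != v by apply: contraNneq wi => ->.
by rewrite (negbTE uv) (negbTE wv) count_uniq_mem // vi; lia.
Qed.

Lemma card_ext : n_ext G = ((shape th).1.2 + (shape th).2 + sumn (shape th).1.1)%N.
Proof.
have := full_size (good_exts gth); rewrite card_ord => E; apply: etrans (esym E) _.
rewrite /exts !size_cat !size_map size_flatten /seq.shape -map_comp addnA; congr (_ + sumn _)%N.
by apply: eq_map => l /=; rewrite size_map.
Qed.

Lemma card_int : n_int G = (sumn (shape th).1.1).+2.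
Proof.
have := full_size (good_ints gth); rewrite card_ord => E; apply: etrans (esym E) _.
rewrite /ints /= size_flatten /seq.shape -map_comp; congr (sumn _).+2.
by apply: eq_map => l /=; rewrite size_map.
Qed.

Lemma card_edge : n_edge G = ((shape th).1.2 + (shape th).2 + (sumn (shape th).1.1).*2 + 3)%N.
Proof.
have := full_size (good_word gth); rewrite card_ord => E; apply: etrans (esym E) _.
rewrite size_map /word !size_cat !size_map size_flatten /seq.shape -map_comp.
rewrite (eq_map (g := fun l => (size l.2).*2.+1)); last by move=> l; apply: size_line_word.
rewrite /shape; have := good_lines gth; case: (tl th) => [|l1 [|l2 [|l3 []]]] //= _.
by lia.
Qed.

Lemma good_betti1 : betti1 [set: cell G] = 2.
Proof.
rewrite /betti1 (_ : [set v | inl v \in [set: cell G]] = [set: vertex G]); last by apply/setP => v; rewrite !inE.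
rewrite (_ : [set v | inr v \in [set: cell G]] = [set: edge G]); last by apply/setP => v; rewrite !inE.
rewrite !cardsT card_sum !card_ord.
by have := card_ext; have := card_int; have := card_edge; lia.
Qed.

Hypothesis ext0 : (0 < n_ext G)%N.

Lemma ext_entry x : exists2 a, a \in tab th & a.2 = inl x.
Proof.
have : (0 < valence (inl x : vertex G))%N by rewrite valence_ext.
case/card_gt0P=> h; rewrite inE => /eqP hx.
have [a ath ae] := edge_entry gth h.1; exists a => //.
have [a1 a2] := tab_inc ath.
have [E|E] := eqVneq h a.1.1.
  by have := tab_inner ath; rewrite -a1 -E hx.
rewrite -a2 -hx; congr (inc G _).
by case: a.1.1 h ae E {hx a1 a2} => e b [e' b'] /= ->; rewrite xpair_eqE eqxx /hflip /=; case: b b' => [] [].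
Qed.

Lemma good_connected : connected [set: cell G].
Proof.
pose U : cell G := inl (inr (tu th)).
suff main c : connect (cell_adj [set: cell G]) c U.
  apply/forall_inP => c _; apply/forall_inP => d _; apply: connect_trans (main c) _.
  by rewrite connect_adj_sym.
have tcase c0 : theta_cell c0 -> connect (cell_adj [set: cell G]) c0 U.
  (* The removed cell is an external vertex, so nothing is taken away from the theta part. *)
  move=> tc; apply: (theta_minus_connected gth (d := inl (inl (Ordinal ext0)))) => //.
  - by move=> c1 _ _; rewrite in_setT.
  - by case: c0 tc => [[x|v]|e].
have hcase a : a \in tab th -> connect (cell_adj [set: cell G]) (inr a.1.1.1) U.
  move=> ath; have [a1 _] := tab_inc ath; have := tab_inner ath.
  case E : a.1.2 => [|v] // _; apply: connect_trans (tcase (inl (inr v)) isT).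
  by apply: connect1; rewrite /cell_adj !inE -E -a1; apply: half_incident.
case: c => [[x|v]|e]; last 2 first.
- exact: tcase.
- by have [a ath <-] := edge_entry gth e; apply: hcase.
have [a ath ax] := ext_entry x; apply: connect_trans (hcase a ath).
have [_ a2] := tab_inc ath; rewrite ax in a2.
apply: connect1; rewrite /cell_adj !inE -a2.
by rewrite -[a.1.1.1]/((hflip a.1.1).1); apply: half_incident.
Qed.

Lemma good_tree_type (e : edge G) : tree_type e = hedge e.
Proof.
have [/existsP[b]|nh] := boolP (hedge e).
  case E : (inc G (e, b)) => [x|//] _.
  by apply: (ext_tree_type (b := b)); rewrite ?good_connected ?good_betti1 // E valence_ext.
apply/negbTE; rewrite /tree_type negb_and negbK; apply/orP; left; rewrite inE.
move: nh; rewrite -[e]/((e, false).1) hedge_half negbK /hflip /= => /andP[i1 i2].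
by apply: (theta_minus_connected gth (d := inr e)) => // c _; rewrite !inE.
Qed.

Lemma frame_theta c : (c \in frame G) = theta_cell c.
Proof.
rewrite inE; case: c => [[x|v]|e] /=; last by rewrite good_tree_type.
  apply/negbTE/existsP => -[e /andP[]]; rewrite good_tree_type => nh /existsP[b /eqP E].
  by case/negP: nh; apply/existsP; exists b; rewrite E.
apply/existsP.
have : (0 < #|fstar (inr v : vertex G)|)%N.
  have [->|->|vi] := ints_case gth v; rewrite ?(fstar_tu gth) ?(fstar_tw gth) //.
  by rewrite (fstar_inner gth vi).
case/card_gt0P=> h; rewrite inE => /andP[/eqP h1 h2]; exists h.1.
by rewrite good_tree_type hedge_half h1 h2 /= -h1 half_incident.
Qed.

Lemma good_Egraph : is_order (ord G) -> is_Egraph G.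
Proof.
move=> oG; apply/and5P; split=> //; first exact: good_connected.
  by apply/forallP => x; rewrite valence_ext.
by apply/forallP => v; rewrite valence_int -addnA leq_addr.
Qed.

Lemma good_two_loop_hairy : is_order (ord G) -> two_loop_hairy G.
Proof.
move=> oG; apply/and4P; split; rewrite ?good_Egraph ?good_betti1 //.
  apply/forallP => v; rewrite /cut_vertex negb_and negbK; apply/orP; right.
  apply/forall_inP => c cX; apply/forall_inP => d dX.
  apply: (theta_minus_connected gth (d := inl v)) => [c' tc cv|||| ].
  - by rewrite in_setD1 cv frame_theta.
  - by move: cX; rewrite in_setD1 frame_theta => /andP[].
  - by move: dX; rewrite in_setD1 frame_theta => /andP[].
  - by move: cX; rewrite in_setD1 => /andP[].
  - by move: dX; rewrite in_setD1 => /andP[].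
apply/forallP => e; apply/implyP => te; rewrite /is_hair te /=.
move: te; rewrite good_tree_type => /existsP[b].
case E : (inc G (e, b)) => [x|//] _; apply/existsP; exists b.
have hstar1 v : (#|hstar (inr v : vertex G)| <= 1)%N.
  have [->|->|vi] := ints_case gth v; rewrite ?(hstar_tu gth) ?(hstar_tw gth) ?(good_tp gth) ?(good_tq gth) //.
  by rewrite (hstar_inner gth vi).
have [v Ev] : exists v, inc G (e, ~~ b) = inr v.
  have [a ath ae] := edge_entry gth e; have [a1 _] := tab_inc ath; have := tab_inner ath.
  case E2 : a.1.2 => [|v] // _; exists v; rewrite -E2 -a1.
  have : a.1.1 = (e, ~~ b); last by move->.
  case: a.1.1 ae a1 => e' b' /= -> ; rewrite E2 => a1.
  by have [bE|] := eqVneq b b'; [rewrite -bE E in a1 | case: b b' {E a1} => [] []].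
apply/and3P; split; first by rewrite E valence_ext.
  by rewrite Ev frame_theta.
apply/forallP => e'; apply/implyP => /andP[]; rewrite good_tree_type Ev => he' /existsP[b' /eqP E'].
have h' : (e', b') \in hstar (inr v : vertex G).
  by move: he'; rewrite -[e']/((e', b').1) hedge_half inE E' eqxx /=.
have h : (e, ~~ b) \in hstar (inr v : vertex G) by rewrite inE Ev eqxx /hflip /= negbK E.
have : (e', b') = (e, ~~ b); last by case=> ->.
by apply: (eq_card1 (A := hstar (inr v : vertex G))) => //; apply/eqP; rewrite eqn_leq hstar1; apply/card_gt0P; exists (e, ~~ b).
Qed.

Lemma good_defect : defect G = ((shape th).1.2 + (shape th).2)%N.
Proof.
rewrite /defect.
under eq_bigr => v _ do rewrite valence_int.
rewrite (eq_bigr (fun v => ((size (tp th) * (tu th == v))%N%:Z + (size (tq th) * (tw th == v))%N%:Z))); last by move=> v _; lia.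
rewrite big_split /= (bigD1 (tu th)) //= eqxx big1 ?addr0; last by move=> v /negbTE vu; rewrite eq_sym vu muln0.
rewrite (bigD1 (tw th)) //= eqxx big1 ?addr0; last by move=> v /negbTE vu; rewrite eq_sym vu muln0.
by rewrite !muln1.
Qed.

End GoodHairy.

(** * Two-loop hairy graphs are theta graphs *)

Section Walk.
Variable G : ograph.
Implicit Types h : half_edge G.

(** The other frame half-edge at a vertex that has exactly two of them, and the identity in all
    other cases; with this default it is an involution. *)
Definition mate h : half_edge G :=
  if (h \in fstar (inc G h)) && (#|fstar (inc G h)| == 2)
  then odflt h [pick h' in fstar (inc G h) :\ h] else h.

Lemma mate_inc h : inc G (mate h) = inc G h.
Proof.
rewrite /mate; case: ifP => // _; case: pickP => //= h'.
by rewrite !inE => /andP[_ /andP[/eqP]].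
Qed.

Lemma mate_fix h : #|fstar (inc G h)| != 2 -> mate h = h.
Proof. by move=> c; rewrite /mate (negbTE c) andbF. Qed.

Lemma mate_other h : h \in fstar (inc G h) -> #|fstar (inc G h)| = 2 ->
  mate h \in fstar (inc G h) /\ mate h != h.
Proof.
move=> hf c2; rewrite /mate hf c2 eqxx /=; case: pickP => [h'|none] /=.
  by rewrite inE => /andP[h'h h'f]; split=> //; move: h'h; rewrite inE.
have : #|fstar (inc G h) :\ h| = 1%N by move: c2; rewrite (cardsD1 h) hf => -[].
by rewrite (eq_card0 none).
Qed.

Lemma mateK : involutive mate.
Proof.
move=> h; have [/andP[hf /eqP c2]|ncond] := boolP ((h \in fstar (inc G h)) && (#|fstar (inc G h)| == 2)).
  have [mf mh] := mate_other hf c2.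
  have [] := @mate_other (mate h); rewrite ?mate_inc // => mmf mmh.
  by apply: (eq_card2 c2 mf) => //; rewrite eq_sym.
have mh : mate h = h by rewrite /mate (negbTE ncond).
by rewrite !mh.
Qed.

Lemma mate_frame h : h \in fstar (inc G h) -> mate h \in fstar (inc G h).
Proof.
move=> hf; have [c2|c2] := eqVneq #|fstar (inc G h)| 2; last by rewrite mate_fix.
by case: (mate_other hf c2).
Qed.

(** One step of a walk: cross the edge, then leave by the other frame half-edge. Being composed of
    two involutions it is a bijection, and at a branch vertex the walk is reflected. *)
Definition eta h := mate (hflip h).

Lemma eta_inj : injective eta.
Proof. by move=> h h' /(can_inj mateK) /(can_inj (@hflipK _)). Qed.

Lemma iter_eta_inj n : injective (iter n eta).
Proof. by elim: n => //= n IH x y /eta_inj /IH. Qed.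

Lemma eta_inc h : inc G (eta h) = inc G (hflip h).
Proof. exact: mate_inc. Qed.

Definition fhalf h := is_int (inc G h) && is_int (inc G (hflip h)).

Lemma fhalf_flip h : fhalf (hflip h) = fhalf h.
Proof. by rewrite /fhalf hflipK andbC. Qed.

Lemma fhalf_mate h : fhalf h -> fhalf (mate h).
Proof.
move=> /andP[i1 i2]; have : h \in fstar (inc G h) by rewrite inE eqxx i2.
by move/mate_frame; rewrite inE /fhalf => /andP[/eqP -> ->]; rewrite i1.
Qed.

Lemma fhalf_eta h : fhalf h -> fhalf (eta h).
Proof. by move=> fh; apply: fhalf_mate; rewrite fhalf_flip. Qed.

Lemma fhalf_iter n h : fhalf h -> fhalf (iter n eta h).
Proof. by move=> fh; elim: n => //= n; apply: fhalf_eta. Qed.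

Lemma fstar_fhalf h v : h \in fstar (inr v : vertex G) = (inc G h == inr v) && fhalf h.
Proof. by rewrite inE /fhalf; case: eqP => //= ->. Qed.

End Walk.

Lemma line_tab_steps (G : ograph) s t h r (a : gstep G) :
  all (@entry_ok G) (line_tab s t h r) -> a \in r ->
  [/\ inc G (sh a) = inr (sv a), inc G (sk a) = inr (sv a) & inc G (hflip (sk a)) = inl (sx a)].
Proof.
elim: r s h => [|b r IH] s h //= /and3P[_ /andP[/eqP k1 /eqP k2] ok]; rewrite inE => /orP[/eqP->|]; last exact: IH ok.
split=> //; by case: r ok {IH} => [|c r] /= /andP[/andP[/eqP]].
Qed.

Section TabLists.
Variables (X I D : eqType) (th : theta X I D).

Definition listed (v : X + I) : bool :=
  match v with inl x => x \in exts th | inr i => i \in ints th end.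

Lemma tab_listed a : a \in tab th -> listed a.1.2 && listed a.2.
Proof.
rewrite !mem_cat => /or3P[/mapP[b bp ->]|/mapP[b bp ->]|].
- by rewrite /= /ints /exts inE eqxx !mem_cat map_f.
- by rewrite /= /ints /exts !inE eqxx orbT !mem_cat (map_f fst bp) ?orbT.
case/flattenP=> _ /mapP[[h r] lth ->] /= al.
have sub1 x : x \in map (@sx _ _ _) r -> listed (inl x).
  move=> xr; rewrite /= !mem_cat; apply/or3P/Or33/flattenP.
  by exists (map (@sx _ _ _) r) => //; apply: (map_f (fun l => map (@sx _ _ _) l.2) lth).
have sub2 x : x \in map (@sv _ _ _) r -> listed (inr x).
  move=> xr; rewrite /= !inE; apply/or3P/Or33/flattenP.
  by exists (map (@sv _ _ _) r) => //; apply: (map_f (fun l => map (@sv _ _ _) l.2) lth).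
have lu : listed (inr (tu th)) by rewrite /= inE eqxx.
have lw : listed (inr (tw th)) by rewrite /= !inE eqxx orbT.
elim: r (tu th) h lu sub1 sub2 al {lth} => [|b r IH] s h ls sub1 sub2 /=.
  by rewrite inE => /eqP->; rewrite ls lw.
rewrite !inE => /or3P[/eqP->|/eqP->|].
- by rewrite ls sub2 //= inE eqxx.
- by rewrite sub2 ?sub1 //= inE eqxx.
by apply: IH => [|x xr|x xr]; [apply: sub2 | apply: sub1 | apply: sub2]; rewrite /= inE ?eqxx ?xr ?orbT.
Qed.

Lemma ext_tab x : x \in exts th -> exists2 a, a \in tab th & a.2 = inl x.
Proof.
rewrite !mem_cat => /or3P[/mapP[b bp ->]|/mapP[b bp ->]|].
- by exists (b.2, inr (tu th), inl b.1) => //; rewrite !mem_cat; apply/or3P/Or31/mapP; exists b.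
- by exists (b.2, inr (tw th), inl b.1) => //; rewrite !mem_cat; apply/or3P/Or32/mapP; exists b.
case/flattenP=> _ /mapP[l lth ->] xl.
suff [a al ax] : exists2 a, a \in line_tab (tu th) (tw th) l.1 l.2 & a.2 = inl x.
  exists a => //; rewrite !mem_cat; apply/or3P/Or33/flattenP.
  by exists (line_tab (tu th) (tw th) l.1 l.2) => //; apply: map_f.
case: l xl {lth} => h r /=; elim: r (tu th) h => //= b r IH s h.
rewrite inE => /orP[/eqP->|/(IH (sv b) (sh b))[a al ax]].
  by exists (sk b, inr (sv b), inl (sx b)) => //; rewrite !inE eqxx orbT.
by exists a; rewrite // !inE al !orbT.
Qed.

End TabLists.

Section Classification.
Variable G : ograph.
Hypothesis hG : two_loop_hairy G.

Let oG : is_order (ord G). Proof. by case/and4P: hG => /and5P[]. Qed.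
Let cG : connected [set: cell G]. Proof. by case/and4P: hG => /and5P[]. Qed.
Let bG : betti1 [set: cell G] = 2. Proof. by case/and4P: hG => _ /eqP. Qed.
Let vx x : valence (inl x : vertex G) = 1%N.
Proof. by case/and4P: hG => /and5P[_ _ _ /forallP/(_ x)/eqP]. Qed.
Let vi v : (3 <= valence (inr v : vertex G))%N.
Proof. by case/and4P: hG => /and5P[_ _ _ _ /forallP/(_ v)]. Qed.

(** A tree-type edge is a hair, hence has a univalent end, which is external because internal
    vertices have valence at least 3. The converse is [ext_tree_type]. *)
Lemma hairy_tree_type (e : edge G) : tree_type e = hedge e.
Proof.
apply/idP/existsP => [te|[b]].
  case/and4P: hG => _ _ _ /forallP/(_ e)/implyP/(_ te)/andP[_ /existsP[b /and3P[/eqP val1 _ _]]].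
  by exists b; case: (inc G (e, b)) val1 => // v val1; have := vi v; rewrite val1.
case E : (inc G (e, b)) => [x|//] _.
by apply: (ext_tree_type (b := b)) => //; rewrite E vx.
Qed.

Lemma ext_not_frame x : inl (inl x) \notin frame G.
Proof.
rewrite inE; apply/existsP => -[e /andP[]]; rewrite hairy_tree_type => /existsP nh /existsP[b /eqP E].
by case: nh; exists b; rewrite E.
Qed.

Lemma hair_ends (h : half_edge G) : ~~ is_int (inc G h) -> is_int (inc G (hflip h)) /\
  forall e', hedge e' -> incident (inc G (hflip h)) e' -> e' = h.1.
Proof.
move=> nh; have he : hedge h.1 by apply/existsP; exists h.2; rewrite -surjective_pairing.
have te : tree_type h.1 by rewrite hairy_tree_type.
case/and4P: hG => _ _ _ /forallP/(_ h.1)/implyP/(_ te)/andP[_ /existsP[b /and3P[/eqP val1 fr /forallP un]]].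
(* The end of the hair opposite to [b] lies in the frame, which contains no external vertex. *)
have hb : b = h.2.
  apply/eqP/negPn/negP => nb; have E : (h.1, ~~ b) = h by case: (h) b nb {val1 fr un} => e [] [].
  by move: fr; rewrite E; case: (inc G h) nh => // x _; rewrite (negbTE (ext_not_frame x)).
move: fr un; rewrite hb -/(hflip h); case E : (inc G (hflip h)) => [x|v] fr un.
  by rewrite (negbTE (ext_not_frame x)) in fr.
by split=> // e' he' ie'; apply/eqP; apply: (implyP (un e')); rewrite hairy_tree_type he'.
Qed.

Lemma hstar_le1 v : (#|hstar (inr v : vertex G)| <= 1)%N.
Proof.
apply/card_le1_eqP => h h'; rewrite !inE => /andP[/eqP hv nh] /andP[/eqP hv' nh'].
have [_ un] := hair_ends nh; rewrite hflipK in un.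
have he' : hedge h'.1 by rewrite hedge_half negb_and nh' orbT.
have E : h'.1 = h.1 by apply: un => //; rewrite hv -hv' half_incident.
have [|nE] := eqVneq h' h; first by [].
have : h' = hflip h by case: (h) (h') E nE => e b [e' b'] /= ->; rewrite xpair_eqE eqxx /hflip /=; case: b b' => [] [].
by move=> E2; move: nh; rewrite -E2 hv'.
Qed.

Lemma fstar_ge2 v : (2 <= #|fstar (inr v : vertex G)|)%N.
Proof. by have := vi v; rewrite /valence card_star; have := hstar_le1 v; lia. Qed.

Lemma hstar_1 v : #|fstar (inr v : vertex G)| = 2 -> #|hstar (inr v : vertex G)| = 1%N.
Proof. by have := vi v; rewrite /valence card_star; have := hstar_le1 v; lia. Qed.

Lemma card_by_vertex (A : {set half_edge G}) (I : finType) (k : I -> vertex G) :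
  injective k -> (forall h, h \in A -> exists i, inc G h = k i) ->
  (\sum_(i : I) #|[set h in A | inc G h == k i]| = #|A|)%N.
Proof.
move=> ki kA; rewrite -[RHS]sum1_card.
under eq_bigr => i _ do rewrite -sum1_card.
rewrite (exchange_big_dep (fun h => h \in A)) /=; last by move=> i h _; rewrite inE => /andP[].
apply: eq_bigr => h hA; have [i hi] := kA h hA.
rewrite (big_pred1 i) // => j; rewrite inE hA hi (inj_eq ki) eq_sym.
by [].
Qed.

Lemma card_ext_half : #|[set h : half_edge G | ~~ is_int (inc G h)]| = n_ext G.
Proof.
rewrite -(@card_by_vertex [set h | ~~ is_int (inc G h)] 'I_(n_ext G) inl (@inl_inj _ _)); last first.
  by move=> h; rewrite inE; case: (inc G h) => // x _; exists x.
rewrite -[RHS](card_ord) -sum1_card; apply: eq_bigr => x _.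
rewrite -(vx x); apply: eq_card => h; rewrite !inE andbC.
by case: eqP => // ->.
Qed.

Lemma card_hair_half : #|[set h : half_edge G | is_int (inc G h) && ~~ is_int (inc G (hflip h))]| = n_ext G.
Proof.
apply: etrans card_ext_half; rewrite -(card_imset _ (can_inj (@hflipK (edge G)))); apply: eq_card => h; rewrite !inE.
apply/imsetP/idP => [[h' ]|nh].
  by rewrite inE => /andP[_ ? ->].
by exists (hflip h); rewrite ?hflipK // inE hflipK nh andbT; case: (hair_ends nh).
Qed.

Lemma sum_hstar : (\sum_(v : 'I_(n_int G)) #|hstar (inr v : vertex G)| = n_ext G)%N.
Proof.
apply: etrans card_hair_half; rewrite -(@card_by_vertex [set h | is_int (inc G h) && ~~ is_int (inc G (hflip h))]
  'I_(n_int G) inr (@inr_inj _ _)).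
  by apply: eq_bigr => v _; apply: eq_card => h; rewrite !inE; case: eqP => [->|] //=; rewrite ?andbT ?andbF.
by move=> h; rewrite inE => /andP[]; case: (inc G h) => // v _ _; exists v.
Qed.

(** Betti number 2 means that there is one edge more than vertices. Discarding both halves of all
    hairs leaves [2 * n_int G + 2] frame half-edges, so the total excess over two per vertex is
    2. *)
Lemma sum_fstar : (\sum_(v : 'I_(n_int G)) #|fstar (inr v : vertex G)| = 2 * n_int G + 2)%N.
Proof.
have E1 : (\sum_(v : 'I_(n_int G)) #|fstar (inr v : vertex G)| = #|[set h : half_edge G | fhalf h]|)%N.
  rewrite -(@card_by_vertex [set h | fhalf h] 'I_(n_int G) inr (@inr_inj _ _)); last first.
    by move=> h; rewrite inE => /andP[]; case: (inc G h) => // v _ _; exists v.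
  by apply: eq_bigr => v _; apply: eq_card => h; rewrite fstar_fhalf !inE andbC.
have E2 := card_ext_half; have E3 := card_hair_half.
have E4 : (#|[set h : half_edge G | fhalf h]| + (n_ext G + n_ext G) = 2 * n_edge G)%N.
  transitivity #|[set: half_edge G]|; last by rewrite cardsT card_prod card_bool card_ord mulnC.
  have := cardsC [set h : half_edge G | ~~ is_int (inc G h)].
  have := cardsID [set h : half_edge G | is_int (inc G (hflip h))]
    (~: [set h : half_edge G | ~~ is_int (inc G h)]).
  rewrite (_ : _ :&: _ = [set h | fhalf h]); last by apply/setP => h; rewrite !inE negbK.
  rewrite (_ : _ :\: _ = [set h | is_int (inc G h) && ~~ is_int (inc G (hflip h))]); last first.
    by apply/setP => h; rewrite !inE negbK andbC.
  by move=> H1 H2; rewrite cardsT -H2 -H1 E2 E3 addnCA.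
rewrite E1; have := bG; rewrite /betti1.
rewrite (_ : [set v | inl v \in [set: cell G]] = [set: vertex G]); last by apply/setP => v; rewrite !inE.
rewrite (_ : [set v | inr v \in [set: cell G]] = [set: edge G]); last by apply/setP => v; rewrite !inE.
by rewrite !cardsT card_sum !card_ord; lia.
Qed.

Lemma int_frame v : inl (inr v) \in frame G.
Proof.
rewrite inE; apply/existsP; have : (0 < #|fstar (inr v : vertex G)|)%N by apply: leq_trans (fstar_ge2 v).
case/card_gt0P=> h; rewrite inE => /andP[/eqP h1 h2]; exists h.1.
by rewrite hairy_tree_type hedge_half h1 h2 /= -h1 half_incident.
Qed.

Definition branch (v : vertex G) := (2 < #|fstar v|)%N.

Lemma walk_line m (h : half_edge G) s t : fhalf h -> inc G h = inr s ->
  (forall i, (i < m)%N -> ~~ branch (inc G (hflip (iter i (@eta G) h)))) ->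
  inc G (hflip (iter m (@eta G) h)) = inr t ->
  exists r : seq (gstep G),
    [/\ all (@entry_ok G) (line_tab s t h r), map (@sh _ _ _) r = traject (@eta G) (eta h) m &
        forall v, v \in map (@sv _ _ _) r -> #|fstar (inr v : vertex G)| = 2].
Proof.
elim: m h s => [|m IH] h s fh hs nb ht.
  by exists [::]; split=> //; rewrite /= /entry_ok /= hs ht !eqxx.
case E : (inc G (hflip h)) => [x|v]; first by case/andP: fh => _; rewrite E.
have v2 : #|fstar (inr v : vertex G)| = 2.
  by apply/eqP; rewrite eqn_leq fstar_ge2 andbT leqNgt -E; apply: (nb 0%N).
have [k kv] : exists k, k \in hstar (inr v : vertex G) by apply/card_gt0P; rewrite hstar_1.
move: kv; rewrite inE => /andP[/eqP kv kx].
case Ex : (inc G (hflip k)) kx => [x|//] _.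
have [||i im||r [ok rE r2]] := IH (eta h) v; rewrite ?eta_inc -?iterSr //.
- exact: fhalf_eta.
- by apply: (nb i.+1).
exists (Step x k v (eta h) :: r); split=> /=; first by rewrite /entry_ok /= hs E kv Ex !eqxx.
  by rewrite rE.
by move=> v'; rewrite inE => /orP[/eqP->|/r2].
Qed.

End Classification.

(** * Walks along the frame from a branch vertex *)

Section Assembly.
Variable G : ograph.
Hypothesis hG : two_loop_hairy G.

Let cG : connected [set: cell G]. Proof. by case/and4P: hG => /and5P[]. Qed.
Let bG : betti1 [set: cell G] = 2. Proof. by case/and4P: hG => _ /eqP. Qed.
Let vx x : valence (inl x : vertex G) = 1%N.
Proof. by case/and4P: hG => /and5P[_ _ _ /forallP/(_ x)/eqP]. Qed.

Local Notation nxt := (@eta G).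

Lemma branchN v : ~~ branch (inr v : vertex G) -> #|fstar (inr v : vertex G)| = 2.
Proof. by move=> nb; apply/eqP; rewrite eqn_leq fstar_ge2 // andbT leqNgt. Qed.

Section FromBranch.
Variables (u : 'I_(n_int G)) (a : half_edge G).
Hypotheses (bu : branch (inr u : vertex G)) (au : a \in fstar (inr u : vertex G)).

Let fa : fhalf a. Proof. by move: au; rewrite fstar_fhalf => /andP[]. Qed.
Let ia : inc G a = inr u. Proof. by move: au; rewrite fstar_fhalf => /andP[/eqP]. Qed.

Lemma mate_branch h : branch (inc G h) -> mate h = h.
Proof. by move=> b; apply: mate_fix; move: b; rewrite /branch; case: eqP => // ->. Qed.

Lemma walk_stops : exists m, branch (inc G (hflip (iter m nxt a))) /\
  forall i, (i < m)%N -> ~~ branch (inc G (hflip (iter i nxt a))).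
Proof.
have ex : exists m, branch (inc G (hflip (iter m nxt a))).
  (* The walk is periodic, and one step before it is back at [a] its far end is the branch vertex
     [u]. *)
  exists (order nxt a).-1; set g := iter _ _ _.
  have gE : nxt g = a.
    by rewrite /g -iterS prednK ?order_gt0 // iter_order //; apply: eta_inj.
  have /(congr1 (@mate G)) := gE; rewrite /eta mateK => ->.
  by rewrite mate_inc ia.
case: (ex_minnP ex) => m bm mm; exists m; split=> // i im.
by apply/negP => /mm; rewrite leqNgt im.
Qed.

Variable m : nat.
Hypothesis bm : branch (inc G (hflip (iter m nxt a))).
Hypothesis nb : forall i, (i < m)%N -> ~~ branch (inc G (hflip (iter i nxt a))).

Lemma walk_inc i : inc G (iter i.+1 nxt a) = inc G (hflip (iter i nxt a)).
Proof. by rewrite iterS eta_inc. Qed.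

Lemma walk_int i : exists v, inc G (iter i nxt a) = inr v.
Proof.
by have /andP[] := fhalf_iter i fa; case: (inc G _) => // v _ _; exists v.
Qed.

Lemma walk_bivalent i v : (0 < i <= m)%N -> inc G (iter i nxt a) = inr v ->
  #|fstar (inr v : vertex G)| = 2.
Proof.
by case: i => // i /andP[_ im] <-; rewrite walk_inc; have := nb im; rewrite -walk_inc;
  have [w ->] := walk_int i.+1; apply: branchN.
Qed.

(** This is where the absence of cut vertices enters. If the walk returned to [u], its intermediate
    cells would be closed under adjacency in the frame minus [u], as a vertex with two frame
    half-edges offers no exit. But [u] has a third frame half-edge, which would then be separated
    from them. *)
Lemma walk_no_return : inc G (hflip (iter m nxt a)) != inr u.
Proof.
apply/eqP => ret; pose X := frame G :\ inl (inr u).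
have cX : connected X.
  case/and4P: hG => _ _ /forallP/(_ (inr u)) + _; rewrite negb_and negbK => /orP[|//].
  by rewrite (int_frame hG).
(* The edges of the walk and its vertices other than [u]. *)
pose A := [set c : cell G | match c with
  | inr e => [exists i : 'I_m.+1, e == (iter i nxt a).1]
  | inl v => [exists i : 'I_m.+1, (0 < i)%N && (v == inc G (iter i nxt a))] end].
have inA i : (i <= m)%N -> inr (iter i nxt a).1 \in A.
  by move=> im; rewrite inE; apply/existsP; exists (Ordinal (im : (i < m.+1)%N)).
have clA c d : cell_adj X c d -> c \in A -> d \in A.
  case: c d => [v|e] [w|e'] /and3P[cX' dX] //= adj; rewrite inE => /existsP[[i im] /=]; last first.
    move=> /eqP eE; subst e; clear cX'; case/existsP: adj => b /eqP wE; rewrite inE.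
    move: im; rewrite ltnS => im.
    have [E|E] := eqVneq b (iter i nxt a).2.
      rewrite E -surjective_pairing in wE; case: i im {E} wE => [|i] im wE.
        by move: dX; rewrite in_setD1 -wE /= ia eqxx.
      by apply/existsP; exists (Ordinal (im : (i.+1 < m.+1)%N)); rewrite wE /= eqxx.
    have {E}wE : inc G (hflip (iter i nxt a)) = w.
      by rewrite -wE; congr (inc G _); rewrite /hflip; congr pair; case: (b) (_.2) E => [] [].
    move: im; rewrite leq_eqVlt => /orP[/eqP iE|im].
      by move: dX; rewrite in_setD1 -wE iE ret eqxx.
    by apply/existsP; exists (Ordinal (im : (i.+1 < m.+1)%N)); rewrite -wE walk_inc /= eqxx.
  case/andP=> i0 /eqP vE; subst v; case: i i0 im cX' adj => // i _; rewrite ltnS => im _ /existsP[b /eqP hv].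
  have [v Ev] := walk_int i.+1.
  have v2 : #|fstar (inr v : vertex G)| = 2 by apply: walk_bivalent Ev; rewrite im.
  have ne : ~~ hedge e' by move: dX; rewrite in_setD1 inE /= hairy_tree_type.
  have f1 : (e', b) \in fstar (inr v : vertex G).
    by rewrite inE hv Ev eqxx /=; move: ne; rewrite -[e']/((e', b).1) hedge_half negbK => /andP[].
  have f2 : iter i.+1 nxt a \in fstar (inr v : vertex G) by rewrite fstar_fhalf Ev eqxx fhalf_iter.
  have f3 : hflip (iter i nxt a) \in fstar (inr v : vertex G).
    by rewrite fstar_fhalf -walk_inc Ev eqxx fhalf_flip fhalf_iter.
  have n23 : iter i.+1 nxt a != hflip (iter i nxt a).
    by have [] := @mate_other G (hflip (iter i nxt a)); rewrite -walk_inc Ev.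
  have [E|E] := eqVneq (e', b) (hflip (iter i nxt a)).
    have -> : e' = (iter i nxt a).1 by case: E.
    exact/inA/ltnW.
  have -> : e' = (iter i.+1 nxt a).1 by rewrite -(eq_card2 v2 f3 f1 f2 E n23).
  exact: inA.
have [g gu [ga gm]] : exists2 g, g \in fstar (inr u : vertex G) & g != a /\ g != hflip (iter m nxt a).
  have : (0 < #|fstar (inr u : vertex G) :\ a :\ hflip (iter m nxt a)|)%N.
    have := bu; rewrite /branch (cardsD1 a) au (cardsD1 (hflip (iter m nxt a)) (_ :\ _)).
    by case: (_ \in _); rewrite !add1n ?add0n !ltnS //; apply: ltnW.
  by case/card_gt0P=> g; rewrite !inE => /and3P[gm ga gu]; exists g; rewrite ?inE.
have frameX h : fhalf h -> inr h.1 \in X.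
  by move=> fh; rewrite in_setD1 /= inE hairy_tree_type // hedge_half negbK.
have fg : fhalf g by move: gu; rewrite fstar_fhalf => /andP[].
have ig : inc G g = inr u by move: gu; rewrite fstar_fhalf => /andP[/eqP].
have : inr g.1 \in component X (inr a.1).
  by rewrite inE; apply: (forall_inP (forall_inP cX _ (frameX _ fa))); apply: frameX.
move/(subsetP (component_sub (inA 0%N isT) clA)); rewrite inE => /existsP[[i im] /= /eqP gE].
(* The edge of [g] is traversed by the walk in one of the two directions. As [g] is neither the
   first half-edge nor the flip of the last one, [u] would be an intermediate vertex, where no
   branching occurs. *)
have [E|E] := eqVneq g.2 (iter i nxt a).2.
  have {E}E : g = iter i nxt a by move: gE E; case: (g) (iter i nxt a) => e b [e' b'] /= -> ->.
  case: i im {gE} E => [|i]; first by move=> _ /= E; rewrite E eqxx in ga.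
  rewrite ltnS => im E; have := bu; rewrite -ig E => bb.
  by have := nb im; rewrite -walk_inc bb.
have {E}E : g = hflip (iter i nxt a).
  by move: gE E; case: (g) (iter i nxt a) => e b [e' b'] /= ->; rewrite /hflip /=; case: b b' => [] [].
move: im; rewrite ltnS leq_eqVlt => /orP[/eqP iE|im]; first by rewrite E iE eqxx in gm.
by have := nb im; rewrite -E ig bu.
Qed.

(** At the second branch vertex the walk is reflected and retraces the line, so its orbit consists
    of both halves of each frame edge of the line. *)
Lemma walk_back i : (i <= m)%N -> iter (m.+1 + i) nxt a = hflip (iter (m - i) nxt a).
Proof.
elim: i => [|i IH] im; first by rewrite addn0 subn0 iterS; apply: mate_branch.
rewrite addnS iterS IH ?(ltnW im) // /eta hflipK.
by rewrite -{1}(subnSK im) iterS /eta mateK.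
Qed.

(** On the way out this is [walk_no_return] and the choice of [m]; on the way back it follows by
    reflection. It makes walks from different half-edges at [u] disjoint. *)
Lemma walk_leaves i : (0 < i < m.*2.+2)%N -> inc G (iter i nxt a) != inr u.
Proof.
case: i => // i /= im; rewrite walk_inc.
have [{}im|mi] := ltnP i m; first by apply: contraNneq (nb im) => ->.
move: mi; rewrite leq_eqVlt => /orP[/eqP<-|mi]; first exact: walk_no_return.
have -> : i = (m.+1 + (i - m.+1))%N by lia.
rewrite walk_back; last by lia.
rewrite hflipK; have -> : (m - (i - m.+1) = (m - (i - m.+1)).-1.+1)%N by lia.
rewrite walk_inc; apply: contraNneq (nb (i := (m - (i - m.+1)).-1) _) => [->//|].
by lia.
Qed.

End FromBranch.

Lemma card_fhalf : #|[set h : half_edge G | fhalf h]| = (2 * n_int G + 2)%N.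
Proof.
rewrite -(sum_fstar hG) -(@card_by_vertex _ [set h | fhalf h] 'I_(n_int G) inr (@inr_inj _ _)).
  by apply: eq_bigr => v _; apply: eq_card => h; rewrite fstar_fhalf !inE andbC.
by move=> h; rewrite inE => /andP[]; case: (inc G h) => // v _ _; exists v.
Qed.

Lemma exists_branch : exists u, branch (inr u : vertex G).
Proof.
apply/existsP; rewrite -[X in is_true X]negbK negb_exists; apply/negP => /forallP nb.
have := sum_fstar hG; rewrite (eq_bigr (fun=> 2%N)); last by move=> v _; apply: branchN.
by rewrite sum_nat_const card_ord; lia.
Qed.

(** Every branch vertex uses at least 1 of the total excess 2, so two of them exhaust it. *)
Lemma branch_pair u w : branch (inr u : vertex G) -> branch (inr w : vertex G) -> u != w ->
  [/\ #|fstar (inr u : vertex G)| = 3, #|fstar (inr w : vertex G)| = 3 &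
      forall v, branch (inr v : vertex G) -> v = u \/ v = w].
Proof.
rewrite /branch => bu bw uw; pose F v := (#|fstar (inr v : vertex G)| - 2)%N.
have sF : (\sum_(v : 'I_(n_int G)) F v = 2)%N.
  have := sum_fstar hG; rewrite (eq_bigr (fun v => F v + 2)%N).
    by rewrite big_split /= sum_nat_const card_ord; lia.
  by move=> v _; rewrite /F subnK // fstar_ge2.
have e1 : (F u + F w + \sum_(v | (v != u) && (v != w)) F v = 2)%N.
  by move: sF; rewrite (bigD1 u) //= (bigD1 w) /= ?addnA // eq_sym.
have Fu : (0 < F u)%N by rewrite /F subn_gt0.
have Fw : (0 < F w)%N by rewrite /F subn_gt0.
have [F1 F2] : F u = 1%N /\ F w = 1%N by lia.
have e0 : (\sum_(v | (v != u) && (v != w)) F v = 0)%N by lia.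
split; [by move: F1; rewrite /F; lia | by move: F2; rewrite /F; lia | move=> v bv].
have [->|vu] := eqVneq v u; first by left.
have [->|vw] := eqVneq v w; first by right.
move/eqP: e0; rewrite sum_nat_eq0 => /forallP/(_ v); rewrite vu vw /F subn_eq0.
by rewrite leqNgt bv.
Qed.

Lemma hair_list (v : 'I_(n_int G)) : exists p : seq ('I_(n_ext G) * half_edge G),
  [/\ size p = #|hstar (inr v : vertex G)|, map snd p =i hstar (inr v : vertex G) &
      all (@entry_ok G) [seq (b.2, inr v, inl b.1) | b <- p]].
Proof.
have := hstar_le1 hG v; rewrite leq_eqVlt ltnS leqn0 => /orP[/cards1P[h hE]|/eqP h0].
  have : h \in hstar (inr v : vertex G) by rewrite hE set11.
  rewrite inE => /andP[hv]; case E : (inc G (hflip h)) => [x|//] _.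
  exists [:: (x, h)]; split=> [|k|]; rewrite ?hE ?cards1 //=.
    by rewrite !inE.
  by rewrite /entry_ok /= hv E eqxx.
exists [::]; split=> // h; move/eqP: h0; rewrite cards_eq0 => /eqP->.
by rewrite !inE.
Qed.

Definition orbit_line (u w : 'I_(n_int G)) (l : gline G) : Prop :=
  [/\ all (@entry_ok G) (line_tab u w l.1 l.2),
      map (@sh _ _ _) l.2 = traject nxt (nxt l.1) (size l.2),
      forall v, v \in map (@sv _ _ _) l.2 -> #|fstar (inr v : vertex G)| = 2,
      forall i, (0 < i < (size l.2).*2.+2)%N -> inc G (iter i nxt l.1) != inr u &
      forall i, (i <= size l.2)%N ->
        iter ((size l.2).+1 + i) nxt l.1 = hflip (iter (size l.2 - i) nxt l.1)].

Lemma exists_orbit_line u a : branch (inr u : vertex G) -> a \in fstar (inr u : vertex G) ->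
  exists w l, [/\ l.1 = a, w != u, branch (inr w : vertex G) & orbit_line u w l].
Proof.
move=> bu au; have [m [bm nb]] := walk_stops bu au.
have /andP[/eqP ia fa] : (inc G a == inr u) && fhalf a by rewrite -fstar_fhalf.
case Ew : (inc G (hflip (iter m nxt a))) (bm) => [x|w] bw.
  by have := fhalf_iter m fa; rewrite /fhalf Ew andbF.
have [r [ok rE r2]] := walk_line hG fa ia nb Ew.
have sr : size r = m by rewrite -(size_map (@sh _ _ _)) rE size_traject.
exists w, (a, r); split=> //.
  by have := walk_no_return bu au nb; rewrite Ew; apply: contra => /eqP->.
split; rewrite /= ?sr //.
- by move=> i im; apply: (walk_leaves bu au bm nb im).
- by move=> i im; apply: (walk_back bm im).
Qed.

End Assembly.

Lemma uniq_flatten (T : eqType) (U : eqType) (f : U -> seq T) (s : seq U) :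
  uniq s -> (forall x, x \in s -> uniq (f x)) ->
  (forall x y z, x \in s -> y \in s -> z \in f x -> z \in f y -> x = y) ->
  uniq (flatten (map f s)).
Proof.
elim: s => //= x s IH /andP[xs us] uf dis; rewrite cat_uniq uf ?inE ?eqxx //= IH //; last 2 first.
- by move=> y ys; apply: uf; rewrite inE ys orbT.
- by move=> y y' z ys ys'; apply: dis; rewrite inE ?ys ?ys' orbT.
rewrite andbT; apply/hasPn => z /flattenP[_ /mapP[y ys ->] zy]; apply/negP => zx.
move: xs; rewrite (dis x y z) ?ys // ?inE ?eqxx // ?ys ?orbT //.
Qed.

Lemma uniq_size_le (T : finType) (A : {pred T}) (s : seq T) :
  uniq s -> {subset s <= A} -> (size s <= #|A|)%N.
Proof. by move=> us sA; rewrite cardE; apply: uniq_leq_size us _ => x /sA; rewrite mem_enum. Qed.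

Lemma uniq_mem_card (T : finType) (A : {pred T}) (s : seq T) x :
  uniq s -> {subset s <= A} -> (#|A| <= size s)%N -> x \in A -> x \in s.
Proof.
move=> us sA As xA; apply/negPn/negP => xs.
have /(uniq_size_le (s := x :: s)) : {subset x :: s <= A}.
  by move=> y; rewrite inE => /orP[/eqP->|/sA].
by rewrite /= xs us => /(_ isT); rewrite ltnNge As.
Qed.

(** Fullness of a candidate theta is obtained from this: connectedness shows that everything is
    listed, and a count excludes repetitions. *)
Lemma full_of_size (T : finType) (s : seq T) :
  (forall x, x \in s) -> (size s <= #|T|)%N -> full s.
Proof.
move=> sT ss; apply/fullP; split=> //.
apply: (leq_size_uniq (enum_uniq T)); first by move=> x _.
by rewrite -cardE.
Qed.

Lemma lt_double2 n i : (i <= n)%N -> (i.+1 < n.*2.+2)%N.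
Proof. lia. Qed.

(** * The three walks from a branch vertex cover the graph *)

Section Assemble.
Variable G : ograph.
Hypothesis hG : two_loop_hairy G.

Let cG : connected [set: cell G]. Proof. by case/and4P: hG => /and5P[]. Qed.
Let bG : betti1 [set: cell G] = 2. Proof. by case/and4P: hG => _ /eqP. Qed.
Let vx x : valence (inl x : vertex G) = 1%N.
Proof. by case/and4P: hG => /and5P[_ _ _ /forallP/(_ x)/eqP]. Qed.

Local Notation nxt := (@eta G).

Variables (u w : 'I_(n_int G)) (p q : seq ('I_(n_ext G) * half_edge G)).
Variable ls : seq (gline G).
Hypotheses (u3 : #|fstar (inr u : vertex G)| = 3) (w3 : #|fstar (inr w : vertex G)| = 3).
Hypothesis uw : u != w.
Hypothesis only : forall v, branch (inr v : vertex G) -> v = u \/ v = w.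
Hypotheses (sp : size p = #|hstar (inr u : vertex G)|) (sq : size q = #|hstar (inr w : vertex G)|).
Hypotheses (mp : map snd p =i hstar (inr u : vertex G)) (mq : map snd q =i hstar (inr w : vertex G)).
Hypotheses (okp : all (@entry_ok G) [seq (b.2, inr u, inl b.1) | b <- p]).
Hypotheses (okq : all (@entry_ok G) [seq (b.2, inr w, inl b.1) | b <- q]).
Hypothesis fls : map fst ls = enum (fstar (inr u : vertex G)).
Hypothesis lls : forall l, l \in ls -> orbit_line u w l.

Let th : gtheta G := Theta u w p q ls.

Let M := sumn [seq size l.2 | l <- ls].

Let uls : uniq (map fst ls). Proof. by rewrite fls enum_uniq. Qed.

Let sls : size ls = 3. Proof. by rewrite -(size_map fst) fls -cardE u3. Qed.

Let first_at l : l \in ls -> inc G l.1 = inr u /\ fhalf l.1.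
Proof.
move=> ll; have : l.1 \in fstar (inr u : vertex G) by rewrite -mem_enum -fls map_f.
by rewrite fstar_fhalf => /andP[/eqP].
Qed.

(** A full period of the walk: out along the line and back. *)
Let oline (l : gline G) : seq (half_edge G) := traject nxt l.1 (size l.2).*2.+2.

Implicit Types (l : gline G).

Lemma mem_oline l h : reflect (exists2 i, (i < (size l.2).*2.+2)%N & h = iter i nxt l.1) (h \in oline l).
Proof.
by apply: (iffP trajectP) => -[i im ->]; exists i.
Qed.

(** Cancelling the common steps would bring one walk back to [u] before its period is over. *)
Lemma oline_aux l l' i j : l \in ls -> l' \in ls -> (i < (size l.2).*2.+2)%N -> (j <= i)%N ->
  iter i nxt l.1 = iter j nxt l'.1 -> i = j.
Proof.
move=> ll ll' im ji; rewrite -(subnKC ji) iterD => /iter_eta_inj E.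
case: (posnP (i - j)) => [->|ij]; first by rewrite addn0.
have [_ _ _ lv _] := lls ll.
have bound : (0 < i - j < (size l.2).*2.+2)%N by rewrite ij; apply: leq_ltn_trans im; apply: leq_subr.
by have := lv _ bound; rewrite E (first_at ll').1 eqxx.
Qed.

Lemma oline_inj l l' i j : l \in ls -> l' \in ls ->
  (i < (size l.2).*2.+2)%N -> (j < (size l'.2).*2.+2)%N ->
  iter i nxt l.1 = iter j nxt l'.1 -> i = j /\ l.1 = l'.1.
Proof.
move=> ll ll' im jm E; have ij : i = j.
  by case/orP: (leq_total i j) => ij; [apply/esym; apply: (oline_aux ll' ll) | apply: (oline_aux ll ll')].
by split=> //; move: E; rewrite ij => /iter_eta_inj.
Qed.

Lemma line_fst_inj l l' : l \in ls -> l' \in ls -> l.1 = l'.1 -> l = l'.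
Proof.
move=> ll ll' E; have := nth_index_map l uls (i := index l ls).
have := nth_index_map l uls (i := index l' ls).
rewrite !index_mem !nth_index // => /(_ ll') E1 /(_ ll) E2.
by rewrite -[l](nth_index l ll) -[l' in RHS](nth_index l ll') -E1 -E2 E.
Qed.

Lemma olines_uniq : uniq (flatten (map oline ls)).
Proof.
apply: uniq_flatten; first exact: map_uniq uls.
  move=> l ll; rewrite /oline; apply/(uniqP l.1) => i j; rewrite !inE size_traject => im jm.
  rewrite !nth_traject // => E; by case: (oline_inj ll ll im jm E).
move=> l l' z ll ll' /mem_oline[i im ->] /mem_oline[j jm E].
by apply: line_fst_inj => //; case: (oline_inj ll ll' im jm E).
Qed.

(** The three disjoint orbits have total length 2M + 6 and consist of frame half-edges, of which
    there are [2 * n_int G + 2]. *)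
Lemma M_le : (M + 2 <= n_int G)%N.
Proof.
have : (size (flatten (map oline ls)) <= #|[set h : half_edge G | fhalf h]|)%N.
  apply: uniq_size_le olines_uniq _ => h /flattenP[_ /mapP[l ll ->] /mem_oline[i _ ->]].
  by rewrite inE fhalf_iter // (first_at ll).2.
rewrite card_fhalf // size_flatten /seq.shape -map_comp.
rewrite (eq_map (g := fun l => (size l.2).*2.+2)); last by move=> l; rewrite /= size_traject.
rewrite /M; case: ls sls => [|l1 [|l2 [|l3 []]]] //= _; lia.
Qed.

Lemma oline_word l h : l \in ls -> h \in oline l -> h.1 \in eword th.
Proof.
move=> ll hl; suff H : h.1 \in map fst (line_word l).
  case/mapP: H => k kl ->; apply: map_f; rewrite !mem_cat; apply/or3P/Or33/flattenP.
  by exists (line_word l) => //; apply: map_f.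
have [_ lE _ _ back] := lls ll.
have small i : (i <= size l.2)%N -> (iter i nxt l.1).1 \in map fst (line_word l).
  case: i => [_|i il]; first by rewrite inE eqxx.
  have : iter i.+1 nxt l.1 \in map (@sh _ _ _) l.2.
    by rewrite lE iterSr; apply/trajectP; exists i.
  case/mapP=> a al ->; rewrite -[(sh a).1]/(fst (sh a)); apply: map_f.
  rewrite inE; apply/orP; right; apply/flattenP; exists [:: sk a; sh a]; last by rewrite !inE eqxx orbT.
  by apply/mapP; exists a.
case/mem_oline: hl => i im ->; have [il|li] := leqP i (size l.2); first exact: small.
have -> : i = ((size l.2).+1 + (i - (size l.2).+1))%N by lia.
rewrite back; last by lia.
by apply: small; lia.
Qed.

Lemma fstar_word v h : v \in ints th -> h \in fstar (inr v : vertex G) -> h.1 \in eword th.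
Proof.
move=> vth hv; have [E|E] := eqVneq v u.
  have : h \in map fst ls by rewrite fls mem_enum -E.
  by case/mapP=> l ll ->; apply: (oline_word ll); apply/mem_oline; exists 0%N.
have [E2|E2] := eqVneq v w.
  (* The half-edge at [w] with which the way back begins; the three lines give three distinct ones,
     which is all of [fstar] at [w]. *)
  pose g (l : gline G) := iter (size l.2).+1 nxt l.1.
  have gu : uniq (map g ls).
    rewrite map_inj_in_uniq; first exact: map_uniq uls.
    move=> l l' ll ll' /(oline_inj ll ll')[||_]; [exact: lt_double2 | exact: lt_double2 |].
    exact: line_fst_inj.
  have gw : {subset map g ls <= fstar (inr w : vertex G)}.
    move=> _ /mapP[l ll ->]; have [ok lE _ _ back] := lls ll.
    have := back 0%N isT; rewrite addn0 subn0 => gE.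
    rewrite fstar_fhalf fhalf_iter ?(first_at ll).2 // andbT /g gE.
    have -> : iter (size l.2) nxt l.1 = last l.1 (map (@sh _ _ _) l.2) by rewrite lE last_traject.
    case: (l) ok => a r /=; elim: r (u) a => [|b r IH] s a /=.
      by rewrite andbT => /andP[].
    by case/and3P=> _ _ /IH.
  have : h \in map g ls.
    by apply: (uniq_mem_card gu gw); rewrite ?w3 ?size_map ?sls // -E2.
  by case/mapP=> l ll ->; apply: (oline_word ll); apply/mem_oline; exists (size l.2).+1 => //; apply: lt_double2.
move: vth; rewrite !inE (negbTE E) (negbTE E2) /= => /flattenP[_ /mapP[l ll ->] /mapP[a al aE]].
have [ok lE l2 _ back] := lls ll.
have [a1 _ _] := line_tab_steps ok al.
have : sh a \in traject nxt (nxt l.1) (size l.2) by rewrite -lE map_f.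
case/trajectP=> i im iE; rewrite -iterSr in iE.
have v2 : #|fstar (inr v : vertex G)| = 2 by apply: l2; rewrite aE map_f.
have av : inc G (sh a) = inr v by rewrite a1 aE.
have fa : sh a \in fstar (inr v : vertex G).
  by rewrite fstar_fhalf av eqxx iE fhalf_iter // (first_at ll).2.
have [] := @mate_other G (sh a); rewrite av // => mf ma.
have [->|ha] := eqVneq h (sh a).
  by apply: (oline_word ll); apply/mem_oline; exists i.+1 => //; apply: lt_double2; apply: ltnW.
have hE : h = mate (sh a) by apply: (eq_card2 v2 fa).
have -> : h = hflip (iter i nxt l.1) by rewrite hE iE iterS /eta mateK.
by apply: (@oline_word l (iter i nxt l.1) ll); apply/mem_oline; exists i => //; apply/ltnW/lt_double2/ltnW.
Qed.

Lemma hstar_word v h : v \in ints th -> h \in hstar (inr v : vertex G) -> h.1 \in eword th.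
Proof.
move=> vth hv; apply: map_f; rewrite /word !mem_cat.
have [E|E] := eqVneq v u; first by rewrite mp -E hv.
have [E2|E2] := eqVneq v w; first by rewrite mq -E2 hv orbT.
move: vth; rewrite !inE (negbTE E) (negbTE E2) /= => /flattenP[_ /mapP[l ll ->] /mapP[a al aE]].
have [ok _ l2 _ _] := lls ll; have [_ a1 a2] := line_tab_steps ok al.
have v1 := hstar_1 hG (l2 (sv a) (map_f _ al)).
rewrite aE in hv; have -> : h = sk a by apply: (eq_card1 v1) => //; rewrite inE a1 a2 eqxx.
apply/or3P/Or33/flattenP; exists (line_word l); first exact: map_f.
rewrite inE; apply/orP; right; apply/flattenP; exists [:: sk a; sh a]; last by rewrite !inE eqxx.
by apply: (map_f (fun a => [:: sk a; sh a])).
Qed.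

Lemma tab_ok : all (@entry_ok G) (tab th).
Proof.
rewrite !all_cat okp okq /=; apply/allP => a /flattenP[_ /mapP[l ll ->]].
by have [ok _ _ _ _] := lls ll; apply/allP.
Qed.

(** The listed cells are closed under adjacency, because all half-edges at a listed vertex belong to
    listed edges. They contain [u], and the graph is connected. *)
Lemma theta_covers c : match c with inl v => listed th v | inr e => e \in eword th end.
Proof.
pose A := [set c : cell G | match c with inl v => listed th v | inr e => e \in eword th end].
have clA d d' : cell_adj [set: cell G] d d' -> d \in A -> d' \in A.
  case: d d' => [v|e] [v'|e'] /and3P[_ _] // /existsP[b /eqP hb]; rewrite !inE; last first.
    rewrite /eword -tab_word => /mapP[_ /mapP[a ath ->] eE].
    have /andP[/eqP a1 /eqP a2] := allP tab_ok a ath; have /andP[l1 l2] := tab_listed ath.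
    have [E|E] := eqVneq b a.1.1.2; first by rewrite -hb eE E -surjective_pairing a1.
    rewrite -hb (_ : (e, b) = hflip a.1.1) ?a2 // eE /hflip; congr pair.
    by case: b a.1.1.2 E {hb} => [] [].
  case: v hb => [x|v] hb; last first.
    move=> vth; rewrite -[e']/((e', b).1).
    have [H|H] := boolP (is_int (inc G (hflip (e', b)))).
      by apply: (fstar_word vth); rewrite inE hb eqxx.
    by apply: (hstar_word vth); rewrite inE hb eqxx.
  move=> /ext_tab[a ath ax]; have /andP[/eqP a1 /eqP a2] := allP tab_ok a ath.
  have E : (e', b) = hflip a.1.1 by apply: (eq_card1 (vx x)); rewrite inE ?hb ?a2 ?ax.
  rewrite -[e']/((e', b).1) E; apply: (map_f fst (x := a.1.1)); rewrite -tab_word.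
  by apply/mapP; exists a.
have uA : inl (inr u) \in A by rewrite inE /= inE eqxx.
suff : c \in A by rewrite inE.
apply: (subsetP (component_sub uA clA)); rewrite inE.
by apply: (forall_inP (forall_inP cG _ _)); rewrite in_setT.
Qed.

Lemma full_ints : full (ints th).
Proof.
apply: full_of_size => [v|]; first exact: (theta_covers (inl (inr v))).
rewrite card_ord /ints /= size_flatten /seq.shape -map_comp.
rewrite (eq_map (g := fun l => size l.2)); last by move=> l; rewrite /= size_map.
by have := M_le; rewrite -/M; lia.
Qed.

Lemma n_int_M : n_int G = M.+2.
Proof.
have := full_size full_ints; rewrite card_ord => <-.
rewrite /ints /= size_flatten /seq.shape -map_comp.
by rewrite (eq_map (g := fun l => size l.2)) // => l; rewrite /= size_map.
Qed.

Lemma n_ext_M : n_ext G = (size p + size q + M)%N.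
Proof.
apply: etrans (esym (sum_hstar hG)) _; rewrite (perm_big (ints th)) /=; last first.
  rewrite uniq_perm ?index_enum_uniq ?(full_uniq full_ints) // => v.
  by rewrite mem_index_enum (full_mem v full_ints).
rewrite /ints !big_cons sp sq -addnA; congr (_ + (_ + _))%N.
rewrite big_seq (eq_bigr (fun=> 1%N)).
  rewrite -big_seq sum1_size size_flatten /seq.shape -map_comp.
  by congr sumn; apply: eq_map => l; rewrite /= size_map.
move=> v /flattenP[_ /mapP[l ll ->]] vl; apply: hstar_1 => //.
by have [_ _ l2 _ _] := lls ll; apply: l2.
Qed.

Lemma full_exts : full (exts th).
Proof.
apply: full_of_size => [x|]; first exact: (theta_covers (inl (inl x))).
suff -> : size (exts th) = n_ext G by rewrite card_ord.
apply: etrans (esym n_ext_M); rewrite /exts !size_cat !size_map size_flatten /seq.shape -map_comp addnA.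
by rewrite (eq_map (g := fun l => size l.2)) // => l; rewrite /= size_map.
Qed.

Lemma full_eword : full (eword th).
Proof.
apply: full_of_size => [e|]; first exact: (theta_covers (inr e)).
rewrite card_ord /eword size_map /word !size_cat !size_map size_flatten /seq.shape -map_comp.
rewrite (eq_map (g := fun l => (size l.2).*2.+1)); last by move=> l; apply: size_line_word.
have : (n_edge G = n_ext G + n_int G + 1)%N.
  have := bG; rewrite /betti1.
  rewrite (_ : [set v | inl v \in [set: cell G]] = [set: vertex G]); last by apply/setP => v; rewrite !inE.
  rewrite (_ : [set v | inr v \in [set: cell G]] = [set: edge G]); last by apply/setP => v; rewrite !inE.
  by rewrite !cardsT card_sum !card_ord; lia.
have := n_ext_M; have := n_int_M; rewrite /M /th [tl _]/=.
by case: ls sls => [|l1 [|l2 [|l3 []]]] //= _; lia.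
Qed.

Lemma assembled : good th.
Proof.
split=> //; try exact: full_exts; try exact: full_ints; try exact: full_eword; try exact: tab_ok.
  by rewrite sp hstar_le1.
by rewrite sq hstar_le1.
Qed.

End Assemble.

Theorem hairy_good (G : ograph) : two_loop_hairy G -> exists th : gtheta G, good th.
Proof.
move=> hG; have [u bu] := exists_branch hG.
have [a0 a0u] : exists a, a \in fstar (inr u : vertex G).
  by apply/card_gt0P; apply: leq_trans bu.
have [w [_ [_ wu bw _]]] := exists_orbit_line hG bu a0u.
have [u3 w3 only] : [/\ #|fstar (inr u : vertex G)| = 3, #|fstar (inr w : vertex G)| = 3 &
      forall v, branch (inr v : vertex G) -> v = u \/ v = w].
  by apply: branch_pair; rewrite // eq_sym.
have [p [sp mp okp]] := hair_list hG u; have [q [sq mq okq]] := hair_list hG w.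
have [ls [fls lls]] : exists ls, map fst ls = enum (fstar (inr u : vertex G)) /\
    forall l, l \in ls -> orbit_line u w l.
  have : {subset enum (fstar (inr u : vertex G)) <= fstar (inr u : vertex G)}.
    by move=> h; rewrite mem_enum.
  elim: (enum _) => [|a s IH] sub; first by exists [::].
  have [|ls [fls lls]] := IH; first by move=> h hs; apply: sub; rewrite inE hs orbT.
  have [|w' [l [la w'u bw' ol]]] := exists_orbit_line hG bu (a := a); first by apply: sub; rewrite inE eqxx.
  have E : w' = w by case: (only w' bw') => // E; rewrite E eqxx in w'u.
  exists (l :: ls); split; first by rewrite /= la fls.
  by move=> l'; rewrite inE => /orP[/eqP->|/lls//]; rewrite -E.
by exists (Theta u w p q ls); apply: assembled; rewrite // eq_sym.
Qed.

Lemma hairy_goodb (G : ograph) : two_loop_hairy G -> exists th : gtheta G, goodb th.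
Proof. by case/hairy_good=> th /goodP; exists th. Qed.

(** * Functionals induced by weights *)

(* By [weight_unique], the value does not depend on the theta structure chosen. *)
Definition phi (W : seq nat -> nat -> nat -> rat) (G : ograph) : rat :=
  match two_loop_hairy G =P true with
  | ReflectT h => let th := xchoose (hairy_goodb h) in sgn (eword th) (eds G) * weight W th
  | ReflectF _ => 0
  end.

Lemma full_eds G : is_order (ord G) -> full (eds G).
Proof. by move=> oG; apply: full_edges_of. Qed.

Section Phi.
Variable W : seq nat -> nat -> nat -> rat.
Hypothesis symW : sym_weight W.

Lemma phi_good G (th : gtheta G) : is_order (ord G) -> (0 < n_ext G)%N -> good th ->
  phi W G = sgn (eword th) (eds G) * weight W th.
Proof.
move=> oG n0 gd; rewrite /phi; case: eqP => [h|]; last by rewrite (good_two_loop_hairy gd).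
set th' := xchoose _; have gd' : good th' by apply/goodP/xchooseP.
have fe := full_eds oG.
rewrite (weight_unique symW gd gd') mulrA; congr (_ * _).
rewrite mulrC (sgn_trans (good_word gd) (good_word gd') fe) //.
Qed.

Lemma phi_not_hairy G : ~~ two_loop_hairy G -> phi W G = 0.
Proof. by move=> nh; rewrite /phi; case: eqP => // h; rewrite h in nh. Qed.

Lemma siso_sym G H f g r s : @siso G H f g r s -> exists f' g' r' s',
  @siso H G f' g' r' s' /\ cancel r r'.
Proof.
move=> [[f' fK f'K] [g' gK g'K] [r' rK r'K] incH].
exists f', g', r', (s \o r'); split=> //; split; [by exists f | by exists g | by exists r |].
move=> h; have := incH (hmap r' (s \o r') h); rewrite /hmap /= r'K addbK -surjective_pairing => ->.
by case: (inc G _) => x /=; rewrite ?fK ?gK.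
Qed.

Lemma siso_n_ext G H f g r s : @siso G H f g r s -> n_ext G = n_ext H.
Proof. by case=> /bij_eq_card; rewrite !card_ord. Qed.

Lemma phi_siso G H f g r s : @siso G H f g r s -> is_order (ord G) -> is_order (ord H) ->
  phi W G = sgn (map r (eds G)) (eds H) * phi W H.
Proof.
move=> GH oG oH; have [fb gb rb incH] := GH.
have [hG|nG] := boolP (two_loop_hairy G).
  have [th gd] := hairy_good hG.
  have n0 : (0 < n_ext G)%N by case/and4P: hG => /and5P[].
  have n0' : (0 < n_ext H)%N by rewrite -(siso_n_ext GH).
  have gd' := good_map GH gd.
  rewrite (phi_good oG n0 gd) (phi_good oH n0' gd') eword_map /weight shape_map mulrA; congr (_ * _).
  rewrite -(sgn_map _ _ rb); have fw := full_map rb (good_word gd).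
  have fe := full_map rb (full_eds oG); have fh := full_eds oH.
  by rewrite [X in _ * X]sgn_sym // (sgn_trans fe fh fw) sgn_sym.
rewrite phi_not_hairy //; have [hH|nH] := boolP (two_loop_hairy H); last by rewrite phi_not_hairy ?mulr0.
(* If [H] is hairy, its theta structure is carried back along the inverse isomorphism, so [G] is
   hairy as well. *)
have [th gd] := hairy_good hH; have [f' [g' [r' [s' [HG _]]]]] := siso_sym GH.
have n0 : (0 < n_ext H)%N by case/and4P: hH => /and5P[].
have n0' : (0 < n_ext G)%N by rewrite (siso_n_ext GH).
by rewrite (good_two_loop_hairy (good_map HG gd)) in nG.
Qed.

End Phi.

(** All ordered graphs are included, not only hairy ones, since the relations range over the whole
    graph complex. *)
Definition invariant_functional (F : ograph -> rat) : Prop :=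
  forall G H f g r s, @siso G H f g r s -> is_order (ord G) -> is_order (ord H) ->
    F G = sgn (map r (eds G)) (eds H) * F H.

Lemma free_extBU (K : choiceType) (V : lmodType rat) (F : K -> V) G H a :
  free_ext F (<< G >> - a *: << H >>) = F G - a *: F H.
Proof. by rewrite free_extB free_extZ (free_extU F G) (free_extU F H). Qed.

(** Each of the three kinds of relation comes from an isomorphism up to edge directions, with the
    identity on cells for a flip and for a reordering. *)
Lemma kills_relations (m N : nat) (F : ograph -> rat) (x : {malg rat[ograph]}) :
  ~~ odd m -> ~~ odd N -> (0 < N)%N -> invariant_functional F ->
  relations m N x -> free_ext (F : ograph -> rat^o) x = 0.
Proof.
move=> m_even N_even N0 iF.
have idb (T : Type) : bijective (@id T) by exists id.
have ord_of G : is_Egraph G -> is_order (ord G) by case/and5P.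
apply: (@span_min _ (relation m N) (fun x => free_ext (F : ograph -> rat^o) x = 0)).
  split; first exact: free_ext0.
  by move=> a y z Fy Fz; rewrite free_ext_linear Fy Fz scaler0 addr0.
move=> _ [G H eG eH [f [g [r [fb gb rb incH ordH]]]]|G e eG|G s eG os].
- rewrite -[<< H >>]scale1r free_extBU.
  have GH : @siso G H f g r (fun=> false).
    by split=> // -[e b]; rewrite /hmap /= addbF incH.
  have oH := ord_of _ eH.
  rewrite (iF _ _ _ _ _ _ GH (ord_of _ eG) oH).
  suff -> : map r (eds G) = eds H by rewrite sgn_refl mul1r scale1r subrr.
  by rewrite ordH; elim: (ord G) => //= -[v|e] l IH; rewrite /edges_of /= -/(edges_of _) IH.
- rewrite free_extBU -signr_odd (negbTE N_even) expr0 scale1r.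
  have GH : @siso (@flip G e) G id id id (fun e' => e' == e).
    split=> // -[e' b]; rewrite ffunE /hmap /= addbC.
    by case: (inc G _).
  have oG := ord_of _ eG.
  rewrite (iF _ _ _ _ _ _ GH oG oG) map_id sgn_refl mul1r; exact: subrr.
rewrite free_extBU koszul_even //.
have GH : @siso (@reorder G s) G id id id (fun=> false).
  by split=> // -[e b]; rewrite /hmap /= addbF; case: (inc G _).
rewrite (iF _ _ _ _ _ _ GH os (ord_of _ eG)) map_id /= [sgn (edges_of (ord G)) _]sgn_sym; last 2 first.
- exact/full_eds/ord_of.
- exact: full_edges_of.
exact: subrr.
Qed.

(** * Invariance of the differential under isomorphisms *)

Section Split.
Variable G : ograph.
Implicit Types (v : 'I_(n_int G)) (A : {set half_edge G}).

Lemma eds_split v A : eds (split_vertex v A) = ord0 :: map (lift ord0) (eds G).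
Proof.
congr (_ :: _); rewrite /=.
by elim: (ord G) => //= -[w|e] l IH; rewrite /edges_of /= -/(edges_of _) IH.
Qed.

Lemma full_lift n (s : seq 'I_n) : full s -> full (ord0 :: map (lift ord0) s).
Proof.
case/fullP=> us sT; apply/fullP; split.
  rewrite /= map_inj_uniq ?us ?andbT; last exact: lift_inj.
  by apply/negP => /mapP[i _ /eqP]; rewrite eq_liftF.
move=> i; rewrite inE; case: (unliftP ord0 i) => [j|] ->; last by rewrite eqxx.
by rewrite map_f ?orbT.
Qed.

Lemma split_order v A : is_order (ord G) -> is_order (ord (split_vertex v A)).
Proof.
move=> /fullP[uo oT]; apply/fullP; split.
  have li : injective (@lift_cell G).
    move=> [[x|i]|e] [[x'|i']|e'] //=; [by move=> [->] | |].
      by move=> E; rewrite (lift_inj (inr_inj (inl_inj E))).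
    by move=> E; rewrite (lift_inj (inr_inj E)).
  rewrite /= map_inj_uniq // uo andbT inE /= andbC; apply/andP; split.
    by apply/negP => /mapP[[[x|i]|e] _ //= [/eqP]]; rewrite eq_liftF.
  by apply/negP => /mapP[[[x|i]|e] _ //= [/eqP]]; rewrite eq_liftF.
move=> [[x|i]|e]; rewrite !inE /=.
- by rewrite (map_f _ (oT (inl (inl x)))).
- case: (unliftP ord0 i) => [j|] ->; last by rewrite eqxx.
  by rewrite (map_f _ (oT (inl (inr j)))) orbT.
- case: (unliftP ord0 e) => [j|] ->; last by rewrite eqxx ?orbT.
  by rewrite (map_f _ (oT (inr j))) ?orbT.
Qed.

Lemma split_inc_lift v A e b : inc (split_vertex v A) (lift ord0 e, b) =
  if (e, b) \in A then inr ord0 else lift_vertex (inc G (e, b)).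
Proof. by rewrite ffunE /= liftK. Qed.

Lemma split_inc_new v A b : inc (split_vertex v A) (ord0, b) =
  if b then inr ord0 else inr (lift ord0 v).
Proof. by rewrite ffunE /= unlift_none. Qed.

Definition swap_new v (i : 'I_(n_int G).+1) : 'I_(n_int G).+1 :=
  if i == ord0 then lift ord0 v else if i == lift ord0 v then ord0 else i.

Lemma swap_newK v : involutive (swap_new v).
Proof.
move=> i; rewrite /swap_new; have [->|i0] := eqVneq i ord0; first by rewrite eq_sym eq_liftF eqxx.
by have [->|iv] := eqVneq i (lift ord0 v); rewrite ?eqxx // (negbTE i0) (negbTE iv).
Qed.

(** Exchanging the new vertex with [v] and reversing the new edge passes from one block to the
    other. The order of the edges is unchanged, so the choice made by [block] does not affect
    signs. *)
Lemma split_swap v A B : A :|: B = star (inr v) -> [disjoint A & B] ->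
  @siso (split_vertex v A) (split_vertex v B) id (swap_new v) id (fun e => e == ord0).
Proof.
move=> AB dAB; split; try by [exists id | exists (swap_new v); apply: swap_newK].
move=> [e b]; rewrite /hmap [fst _]/= [snd _]/=; case: (unliftP ord0 e) => [e'|] ->; last first.
  by rewrite eqxx addbT !split_inc_new; case: b; rewrite /= /swap_new ?eqxx // eq_sym eq_liftF.
rewrite eq_sym eq_liftF addbF !split_inc_lift.
have inA : ((e', b) \in A) || ((e', b) \in B) = (inc G (e', b) == inr v).
  by have := in_setU (e', b) A B; rewrite AB inE => ->.
have [hA|hA] := boolP ((e', b) \in A).
  rewrite (disjointFr dAB hA); move: inA; rewrite hA => /esym/eqP -> /=.
  by rewrite /swap_new eqxx.
have [hB|hB] := boolP ((e', b) \in B).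
  move: inA; rewrite hB orbT => /esym/eqP -> /=.
  by rewrite /swap_new eqxx eq_sym eq_liftF.
move: inA; rewrite (negbTE hA) (negbTE hB); case: (inc G (e', b)) => //= i /esym/eqP iv.
rewrite /swap_new eq_sym eq_liftF; case: eqP => // E.
by case: iv; rewrite (lift_inj E).
Qed.

Lemma admissible_blocks v P A B : admissible v P -> A \in P -> B \in P -> A != B ->
  A :|: B = star (inr v) /\ [disjoint A & B].
Proof.
case/and3P=> pP /eqP P2 _ AP BP AB; have PE : P = [set A; B].
  apply/eqP; rewrite eq_sym eqEcard P2 cards2 AB /= andbT.
  by apply/subsetP => C; rewrite !inE => /orP[/eqP->|/eqP->].
split; first by rewrite -(cover_partition pP) /finset.cover PE big_setU1 ?inE //= big_set1.
by case/and3P: pP => _ /trivIsetP/(_ A B AP BP AB).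
Qed.

Lemma block_in v P : admissible v P -> block P \in P.
Proof.
case/and3P=> _ /eqP P2 _; rewrite /block; case: pickP => //= none.
by move: P2; rewrite (eq_card0 none).
Qed.

Lemma split_block v P A : admissible v P -> A \in P -> block P = A \/
  @siso (split_vertex v (block P)) (split_vertex v A) id (swap_new v) id (fun e => e == ord0).
Proof.
move=> aP AP; have [->|nA] := eqVneq (block P) A; [by left | right].
by case: (admissible_blocks aP (block_in aP) AP nA) => ? ?; apply: split_swap.
Qed.

Lemma invariant_split F v P A : invariant_functional F -> is_order (ord G) ->
  admissible v P -> A \in P -> F (split_vertex v (block P)) = F (split_vertex v A).
Proof.
move=> iF oG aP AP; case: (split_block aP AP) => [->//|S].
have oA := split_order v A oG.
by rewrite (iF _ _ _ _ _ _ S (split_order v (block P) oG) oA) map_id !eds_split sgn_refl mul1r.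
Qed.

End Split.

Lemma sgn_lift n (s t : seq 'I_n) : full s -> full t ->
  sgn (ord0 :: map (lift ord0) s) (ord0 :: map (lift ord0) t) = sgn s t.
Proof.
move=> fs ft; have st : perm_eq (map id s) t.
  rewrite map_id uniq_perm ?(full_uniq fs) ?(full_uniq ft) // => x.
  by rewrite !(full_mem _ _).
have [b [l [pl lE]]] := par_of_perm st; rewrite map_id in lE; subst l.
rewrite (sgn_par pl fs) (sgn_par (par_cons ord0 (par_map (lift ord0) pl))) //.
exact: full_lift.
Qed.

(** The functional [F] composed with the differential, as a function on graphs. *)
Definition bdry_functional (F : ograph -> rat) (G : ograph) : rat :=
  \sum_(v < n_int G) \sum_(P | @admissible G v P) F (split_vertex v (block P)).

Section BoundaryInvariance.
Variables (F : ograph -> rat) (G H : ograph).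
Variables (f : 'I_(n_ext G) -> 'I_(n_ext H)) (g : 'I_(n_int G) -> 'I_(n_int H)).
Variables (r : edge G -> edge H) (s : edge G -> bool).
Hypotheses (iF : invariant_functional F) (GH : siso f g r s).
Hypotheses (oG : is_order (ord G)) (oH : is_order (ord H)).

Let rho : half_edge G -> half_edge H := hmap r s.

Let rb : bijective r. Proof. by case: GH. Qed.
Let rhob : bijective rho. Proof. exact: hmap_bij. Qed.

Definition lift_fun (n n' : nat) (k : 'I_n -> 'I_n') (i : 'I_n.+1) : 'I_n'.+1 :=
  if unlift ord0 i is Some j then lift ord0 (k j) else ord0.

Lemma lift_fun0 n n' (k : 'I_n -> 'I_n') : lift_fun k ord0 = ord0.
Proof. by rewrite /lift_fun unlift_none. Qed.

Lemma lift_fun_lift n n' (k : 'I_n -> 'I_n') i : lift_fun k (lift ord0 i) = lift ord0 (k i).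
Proof. by rewrite /lift_fun liftK. Qed.

Lemma lift_fun_bij n n' (k : 'I_n -> 'I_n') : bijective k -> bijective (lift_fun k).
Proof.
case=> k' kK k'K; exists (lift_fun k') => i;
  by case: (unliftP ord0 i) => [j|] ->; rewrite ?lift_fun0 // !lift_fun_lift ?kK ?k'K.
Qed.

Lemma split_siso v A : @siso (split_vertex v A) (split_vertex (g v) (rho @: A)) f (lift_fun g)
  (lift_fun r) (fun e => if unlift ord0 e is Some e' then s e' else false).
Proof.
have [fb gb _ incH] := GH.
split; rewrite ?lift_fun_bij //; try exact: lift_fun_bij.
move=> [e b]; case: (unliftP ord0 e) => [e'|] ->.
  rewrite /hmap /= liftK lift_fun_lift (split_inc_lift (G := H)) (split_inc_lift (G := G)).
  rewrite -[(r e', _)]/(rho (e', b)) (mem_imset _ _ (bij_inj rhob)).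
  case: ifP => _; first by rewrite /= lift_fun0.
  by rewrite incH; case: (inc G _) => [x|i] //=; rewrite lift_fun_lift.
rewrite /hmap /= unlift_none addbF lift_fun0 (split_inc_new (G := H)) (split_inc_new (G := G)).
by case: b; rewrite /= ?lift_fun0 ?lift_fun_lift.
Qed.

Let push (P : {set {set half_edge G}}) : {set {set half_edge H}} := [set rho @: A | A : {set half_edge G} in P].

Lemma push_bij : bijective push.
Proof.
have [rho' K K'] := rhob.
pose pull (Q : {set {set half_edge H}}) : {set {set half_edge G}} :=
  [set rho' @: A | A : {set half_edge H} in Q].
exists pull => P; rewrite /push /pull -imset_comp.
  apply/etrans/imset_id; apply: eq_imset => A /=.
  by rewrite -imset_comp; apply/etrans/imset_id; apply: eq_imset.
apply/etrans/imset_id; apply: eq_imset => A /=.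
by rewrite -imset_comp; apply/etrans/imset_id; apply: eq_imset.
Qed.

Lemma push_admissible v P : admissible (g v) (push P) = admissible v P.
Proof.
have ri := bij_inj rhob; congr [&& _, _ & _].
- rewrite -[inr (g v)]/(map_vertex f g (inr v)) (siso_star GH) imset_partition //.
- by rewrite card_imset //; apply: imset_inj.
apply/forall_inP/forall_inP => [H2 A AP|H2 _ /imsetP[A AP ->]].
  by rewrite -(card_imset _ ri) H2 //; apply: imset_f.
by rewrite card_imset // H2.
Qed.

Lemma bdry_functional_siso :
  bdry_functional F G = sgn (map r (eds G)) (eds H) * bdry_functional F H.
Proof.
have [fb gb _ incH] := GH.
rewrite mulr_sumr [RHS](reindex g) /=; last exact: onW_bij.
apply: eq_bigr => v _; rewrite mulr_sumr [RHS](reindex push) /=; last exact/onW_bij/push_bij.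
apply: eq_big => [P|P aP]; first by rewrite push_admissible.
have aP' : admissible (g v) (push P) by rewrite push_admissible.
have inP : rho @: block P \in push P by apply: imset_f; apply: (block_in aP).
rewrite (invariant_split iF oH aP' inP).
rewrite (iF (split_siso v (block P)) (split_order _ _ oG) (split_order _ _ oH)).
congr (_ * _); rewrite !eds_split [map _ _]/= lift_fun0 -map_comp.
rewrite (eq_map (g := lift ord0 \o r)); last by move=> e; rewrite /= lift_fun_lift.
by rewrite map_comp sgn_lift ?full_map ?full_eds.
Qed.

End BoundaryInvariance.

(** The dual form of the fact that the differential descends to the quotient by the relations:
    evaluations of boundaries depend only on the class of the chain. *)
Lemma bdry_functional_invariant F :
  invariant_functional F -> invariant_functional (bdry_functional F).
Proof. by move=> iF G H f g r s GH oG oH; apply: (bdry_functional_siso iF GH oG oH). Qed.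

Lemma free_ext_boundary F x : free_ext (F : ograph -> rat^o) (boundary x) =
  free_ext (bdry_functional F : ograph -> rat^o) x.
Proof.
rewrite /boundary free_ext_sum; apply: eq_bigr => G _.
rewrite free_extZ /boundary1 free_ext_sum; congr (_ *: _); apply: eq_bigr => v _.
by rewrite free_ext_sum; apply: eq_bigr => P _; rewrite free_extU.
Qed.

(** * Standard generators *)

(** Graph and theta structure are packed together in a boolean predicate, so that one choice fixes
    both. *)
Definition is_std a b c (p q : bool) (u : {G : ograph & gtheta G}) : bool :=
  [&& goodb (tagged u), shape (tagged u) == ([:: a; b; c], p : nat, q : nat),
      is_order (ord (tag u)) & eds (tag u) == eword (tagged u)].

Lemma std_exists a b c p q : exists u, is_std a b c p q u.
Proof.
have [X [I [E [th [fx fi fw sE]]]]] := shape_existsP a b c p q.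
have gd : good (realize_theta th).
  apply: realize_good => //; case: sE => l3 p1 q1.
  - by rewrite -(size_map (fun l => size l.2)) l3.
  - by rewrite p1 leq_b1.
  by rewrite q1 leq_b1.
exists (Tagged (fun G => gtheta G) (realize_theta th)); apply/and4P; split.
- exact/goodP.
- by rewrite /= shape_map sE.
- exact: realize_order.
by rewrite /= eds_realize.
Qed.

Definition std_pair a b c p q := xchoose (std_exists a b c p q).

(* The theta graph whose lines carry a, b and c hairs, and whose branch vertices
   carry p and q hairs, ordered along the lines. *)
Definition std a b c p q : ograph := tag (std_pair a b c p q).
Definition std_theta a b c p q : gtheta (std a b c p q) := tagged (std_pair a b c p q).

Lemma stdP a b c p q : [/\ good (std_theta a b c p q),
  shape (std_theta a b c p q) = ([:: a; b; c], p : nat, q : nat),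
  is_order (ord (std a b c p q)) & eds (std a b c p q) = eword (std_theta a b c p q)].
Proof. by have /and4P[/goodP ? /eqP ? ? /eqP ?] := xchooseP (std_exists a b c p q). Qed.

(* Otherwise unification of distinct standard graphs runs into [xchoose]. *)
Opaque std std_theta.

Lemma n_ext_std a b c p q : n_ext (std a b c p q) = (p + q + (a + b + c))%N.
Proof. by have [gd sE _ _] := stdP a b c p q; rewrite (card_ext gd) sE /= addn0 (addnA a). Qed.

Lemma std_hairy a b c (p q : bool) : (0 < p + q + (a + b + c))%N -> two_loop_hairy (std a b c p q).
Proof.
by have [gd sE oG _] := stdP a b c p q; rewrite -n_ext_std => n0; apply: good_two_loop_hairy gd n0 oG.
Qed.

Lemma std_defect a b c (p q : bool) : (0 < p + q + (a + b + c))%N -> defect (std a b c p q) = (p + q)%N.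
Proof.
have [gd sE oG _] := stdP a b c p q; rewrite -n_ext_std => n0.
by rewrite (good_defect gd n0); case: sE => _ <- <-.
Qed.

Section StdRelations.
Variables (m N : nat).
Hypotheses (m_even : ~~ odd m) (N_even : ~~ odd N) (N_gt0 : (0 < N)%N).

Local Notation eqv := (eqv_mod m N).

Lemma eqv_good G (th : gtheta G) a b c (p q : bool) :
  good th -> shape th = ([:: a; b; c], p : nat, q : nat) -> is_order (ord G) -> (0 < n_ext G)%N ->
  eqv << G >> (sgn (eword th) (eds G) *: << std a b c p q >>).
Proof.
move=> gd sE oG n0; have [gd' sE' oS eS] := stdP a b c p q.
have [f [g [r [s [GS wE]]]]] := good_siso gd gd' (etrans sE (esym sE')).
have := eqv_siso m_even N_even N_gt0 GS (good_Egraph gd n0 oG) oS.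
have rb : bijective r by case: GS.
by rewrite eS -wE sgn_map // sgn_sym ?full_eds ?(good_word gd).
Qed.

(** A second theta structure on a standard graph identifies it, up to sign, with another generator.
    All symmetries of the generators arise in this way. *)
Lemma eqv_std a b c (p q : bool) a' b' c' (p' q' s : bool) (th : gtheta (std a b c p q)) :
  (0 < p + q + (a + b + c))%N -> good th -> shape th = ([:: a'; b'; c'], p' : nat, q' : nat) ->
  par s (eword (std_theta a b c p q)) (eword th) ->
  eqv << std a b c p q >> ((-1) ^+ s *: << std a' b' c' p' q' >>).
Proof.
move=> n0 gd sE pw; have [gd' sE' oS eS] := stdP a b c p q.
rewrite -n_ext_std in n0.
have := eqv_good gd sE oS n0; rewrite eS sgn_sym ?(good_word gd) ?(good_word gd') //.
by rewrite (sgn_par pw) ?(good_word gd').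
Qed.

Lemma std_lines a b c (p q : bool) :
  exists l1 l2 l3, [/\ tl (std_theta a b c p q) = [:: l1; l2; l3],
    size l1.2 = a, size l2.2 = b & size l3.2 = c].
Proof.
have [_ [] lE _ _ _ _] := stdP a b c p q.
case: (tl _) lE => [|l1 [|l2 [|l3 [|? ?]]]] //= [la lb lc].
by exists l1, l2, l3.
Qed.

Lemma std_swap12 a b c (p q : bool) : (0 < p + q + (a + b + c))%N ->
  eqv << std a b c p q >> (- << std b a c p q >>).
Proof.
move=> n0; have [l1 [l2 [l3 [lE la lb lc]]]] := std_lines a b c p q.
have [gd [] _ sp sq _ _] := stdP a b c p q.
have pl : par true (tl (std_theta a b c p q)) [:: l2; l1; l3] by rewrite lE; apply: par_swap.
rewrite -scaleN1r; apply: (@eqv_std _ _ _ _ _ _ _ _ _ _ true (set_lines _ [:: l2; l1; l3])) => //.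
- exact: good_set_lines gd pl.
- by rewrite /shape /= sp sq la lb lc.
exact/eword_par/par_set_lines.
Qed.

Lemma std_swap23 a b c (p q : bool) : (0 < p + q + (a + b + c))%N ->
  eqv << std a b c p q >> (- << std a c b p q >>).
Proof.
move=> n0; have [l1 [l2 [l3 [lE la lb lc]]]] := std_lines a b c p q.
have [gd [] _ sp sq _ _] := stdP a b c p q.
have pl : par true (tl (std_theta a b c p q)) [:: l1; l3; l2] by rewrite lE; apply/par_cons/par_swap.
rewrite -scaleN1r; apply: (@eqv_std _ _ _ _ _ _ _ _ _ _ true (set_lines _ [:: l1; l3; l2])) => //.
- exact: good_set_lines gd pl.
- by rewrite /shape /= sp sq la lb lc.
exact/eword_par/par_set_lines.
Qed.

Lemma std_mirror a b c (p q : bool) : (0 < p + q + (a + b + c))%N ->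
  eqv << std a b c p q >> ((-1) ^+ (odd (a + b + c) (+) (p && q)) *: << std a b c q p >>).
Proof.
move=> n0; have [gd sE _ _] := stdP a b c p q; have [sl sp sq] := sE.
apply: (eqv_std (th := mirror (std_theta a b c p q))) => //.
- exact: good_mirror.
- by rewrite shape_mirror sE sp sq.
have := par_mirror (std_theta a b c p q).
by rewrite sE sp sq /= addn0 addnA !oddb.
Qed.

End StdRelations.

(** * Splitting a branch vertex *)

Lemma hflip_neq (T : eqType) (h : T * bool) : hflip h != h.
Proof. by case: h => e b; rewrite xpair_eqE eqxx /=; case: b. Qed.

Section SplitBranch.
Variables (G : ograph) (th : gtheta G).
Variables (x : 'I_(n_ext G)) (k h : half_edge G).
Variables (r : seq (gstep G)).
Variables (ls : seq (gline G)).
Hypotheses (gd : good th) (tpE : tp th = [:: (x, k)]) (tlE : tl th = (h, r) :: ls).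

Local Notation A := [set k; h].
Local Notation G' := (split_vertex (tu th) A).

Definition lift_half (a : half_edge G) : edge G' * bool := (lift ord0 a.1, a.2).

Local Notation lift_th := (map_theta id (lift ord0) lift_half th).

(* The half-edges k and h move to the new vertex, which thereby becomes the first
   hair vertex of the first line. *)
Definition split_theta : gtheta G' :=
  Theta (tu lift_th) (tw lift_th) [::] (tq lift_th)
    (((ord0, false), Step x (lift_half k) ord0 (lift_half h) ::
       map (map_step id (lift ord0) lift_half) r) ::
     map (map_line id (lift ord0) lift_half) ls).

Let tabs : seq (half_edge G * vertex G * vertex G) :=
  [seq (a.2, inr (tw th), inl a.1) | a <- tq th] ++
  (if r is a :: r' then
     (sk a, inr (sv a), inl (sx a)) :: line_tab (sv a) (tw th) (sh a) r' else [::]) ++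
  flatten [seq line_tab (tu th) (tw th) l.1 l.2 | l <- ls].

Let next : vertex G := if r is a :: _ then inr (sv a) else inr (tw th).

Let lift_entry (a : half_edge G * vertex G * vertex G) : half_edge G' * vertex G' * vertex G' :=
  (lift_half a.1.1, lift_vertex a.1.2, lift_vertex a.2).

Lemma tab_split_perm : perm_eq (tab th)
  [:: (k, inr (tu th), inl x), (h, inr (tu th), next) & tabs].
Proof.
rewrite /tab /tabs /next tpE tlE /= perm_cons; case: (r) => [|a r'] /=;
  exact: permEl (perm_catCA _ [:: _] _).
Qed.

Lemma tab_split_theta : perm_eq (tab split_theta)
  [:: ((ord0, false), inr (lift ord0 (tu th)), inr ord0), (lift_half k, inr ord0, inl x),
      (lift_half h, inr ord0, lift_vertex next) & map lift_entry tabs].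
Proof.
have lineE s t h0 r0 : line_tab (lift ord0 s) (lift ord0 t) (lift_half h0)
    (map (map_step id (lift ord0) lift_half) r0) = map lift_entry (line_tab s t h0 r0).
  by elim: r0 s h0 => //= a r0 IH s h0; rewrite IH.
rewrite /tab /tabs /next /= !map_cat map_flatten -!map_comp.
rewrite (eq_map (g := map lift_entry \o (fun l => line_tab (tu th) (tw th) l.1 l.2))); last first.
  by move=> l /=; rewrite lineE.
rewrite (eq_map (g := lift_entry \o (fun a => (a.2, inr (tw th), inl a.1))) _ (tq th)) //.
by case: (r) => [|a r'] /=; rewrite ?lineE; apply: permEl (perm_catCA _ [:: _; _; _] _).
Qed.

Let tabs_edges : [/\ k.1 != h.1, forall a, a \in tabs -> a.1.1.1 != k.1 &
  forall a, a \in tabs -> a.1.1.1 != h.1].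
Proof.
have := full_uniq (good_word gd); rewrite /eword -tab_word -map_comp.
rewrite (perm_uniq (perm_map _ tab_split_perm)) /= inE negb_or => /and3P[/andP[kh kt] ht _].
split=> // a aT; [apply: contraNneq kt | apply: contraNneq ht] => <-;
  by apply/mapP; exists a.
Qed.

Lemma split_theta_tab : all (@entry_ok G') (tab split_theta).
Proof.
have [kh tk thh] := tabs_edges.
have ok := good_tab gd; rewrite (perm_all _ tab_split_perm) /= in ok.
have /and3P[/andP[/= /eqP k1 /eqP k2] /andP[/= /eqP h1 /eqP h2] /allP okT] := ok.
have inc_lift a : inc G' (lift_half a) = if a \in A then inr ord0 else lift_vertex (inc G a).
  by case: a => e b; rewrite /lift_half /= (split_inc_lift (G := G)).
have flip_lift a : hflip (lift_half a) = lift_half (hflip a) by [].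
have kn : hflip k \notin A.
  rewrite !inE negb_or; apply/andP; split; first exact: hflip_neq.
  by apply: contraNneq kh => <-.
have hn : hflip h \notin A.
  rewrite !inE negb_or; apply/andP; split; last exact: hflip_neq.
  by rewrite eq_sym; apply: contraNneq kh => ->.
rewrite (perm_all _ tab_split_theta) /=; apply/and4P; split.
- by rewrite /entry_ok /= !(split_inc_new (G := G)) !eqxx.
- by rewrite /entry_ok [X in X.1.1]/= flip_lift !inc_lift (negbTE kn) !inE eqxx /= k2 /= !eqxx.
- by rewrite /entry_ok [X in X.1.1]/= flip_lift !inc_lift (negbTE hn) !inE eqxx orbT /= h2 !eqxx.
apply/allP => _ /mapP[a aT ->].
have /andP[/eqP a1 /eqP a2] := okT a aT.
have nA b : b.1 = a.1.1.1 -> b \notin A.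
  move=> bE; rewrite !inE negb_or; apply/andP; split.
    by apply: contraNneq (tk a aT) => <-; rewrite bE.
  by apply: contraNneq (thh a aT) => <-; rewrite bE.
by rewrite /entry_ok [X in X.1.1]/= flip_lift !inc_lift !(negbTE (nA _ _)) //= a1 a2 !eqxx.
Qed.

(** The new edge comes first in the order, followed by the hair. In the word of the new structure
    this block of two edges stands behind the hair of the other branch vertex, if any; moving two
    edges together costs no sign. *)
Lemma split_theta_par : par false (ord0 :: map (lift ord0) (eword th)) (eword split_theta).
Proof.
have tlE' : tl lift_th = map (map_line id (lift ord0) lift_half) ((h, r) :: ls) by rewrite /= tlE.
have wE : eword split_theta = map fst (map snd (tq lift_th)) ++ [:: ord0; lift ord0 k.1] ++
    map fst (flatten (map (@line_word _ _ _) (tl lift_th))).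
  by rewrite tlE' /eword /word /= map_cat.
have -> : map (lift ord0) (eword th) = eword (lift_th : gtheta G').
  by rewrite /eword word_map -!map_comp.
rewrite wE /eword /word /= tpE /= map_cat -[_ :: _ :: _]/([:: ord0; lift ord0 k.1] ++ _).
exact: (par_block [:: ord0; lift ord0 k.1]).
Qed.

Lemma good_split : good split_theta.
Proof.
have [fx fi fw l3 p1 q1 tb] := gd; split=> //=; rewrite ?size_map //.
- have eE : exts split_theta = map fst (tq th) ++ [:: x] ++ flatten [seq map (@sx _ _ _) l.2 | l <- tl th].
    rewrite /exts /= tlE /= -!map_comp; congr (_ ++ _ :: _ ++ flatten _).
    by apply: eq_map => l /=; rewrite -map_comp.
  by rewrite eE (full_perm (permEl (perm_catCA _ _ _))); move: fx; rewrite /exts tpE.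
- rewrite -(full_perm (s := ord0 :: map (lift ord0) (ints th))); first exact: full_lift.
  have -> : map (lift ord0) (ints th) = ints lift_th by rewrite ints_map.
  rewrite /ints /= tlE /=.
  exact: permEl (perm_catCA [:: ord0] [:: _; _] _).
- by rewrite -(full_perm (par_perm split_theta_par)) full_lift.
- by rewrite -l3 tlE.
exact: split_theta_tab.
Qed.

Lemma shape_split : shape split_theta = ((size r).+1 :: [seq size l.2 | l <- ls], 0%N, size (tq th)).
Proof.
rewrite /shape /= !size_map -map_comp; congr (_ :: _, _, _).
by apply: eq_map => l /=; rewrite size_map.
Qed.

End SplitBranch.

Section FourValent.
Variables (G : ograph) (v : 'I_(n_int G)) (k : half_edge G).
Hypotheses (kv : k \in star (inr v : vertex G)) (v4 : #|star (inr v : vertex G)| = 4).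
Local Notation S := (star (inr v : vertex G)).

(** A partition of four half-edges into two pairs is determined by the partner of the hair [k], so
    there are three of them, one for each line. *)
Definition pair_split (h : half_edge G) : {set {set half_edge G}} :=
  [set [set k; h]; S :\: [set k; h]].

Let pair_sub h : h \in S :\ k -> [/\ [set k; h] \subset S, #|[set k; h]| = 2,
  #|S :\: [set k; h]| = 2 & [set k; h] != S :\: [set k; h]].
Proof.
rewrite !inE => /andP[hk hv]; have sub : [set k; h] \subset S.
  by apply/subsetP => a; rewrite !inE => /orP[/eqP->|/eqP->] //; move: kv; rewrite inE.
have c2 : #|[set k; h]| = 2 by rewrite cards2 eq_sym hk.
split=> //; first by rewrite cardsD (setIidPr sub) v4 c2.
by apply/eqP => /setP/(_ k); rewrite !inE eqxx.
Qed.

Lemma pair_split_admissible h : h \in S :\ k -> admissible v (pair_split h).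
Proof.
move=> hS; have [sub c2 d2 ne] := pair_sub hS; apply/and3P; split.
- apply/and3P; split.
  + rewrite /finset.cover big_setU1 ?inE //= big_set1; apply/eqP.
    by rewrite -{1}(setIidPr sub) setID.
  + apply/trivIsetP => A B; rewrite !inE => /orP[/eqP->|/eqP->] /orP[/eqP->|/eqP->];
      rewrite ?eqxx // => _; last rewrite disjoint_sym;
      by rewrite -setI_eq0; apply/eqP/setP => a; rewrite !inE; case: (_ || _).
  by rewrite !inE negb_or !(eq_sym set0) -!cards_eq0 c2 d2.
- by rewrite cards2 ne.
by apply/forall_inP => A; rewrite !inE => /orP[/eqP->|/eqP->]; rewrite ?c2 ?d2.
Qed.

(** Both blocks have at least two of the four half-edges, hence exactly two; [h] is what the block
    of [k] contains besides [k]. *)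
Lemma admissible_pair_split P : admissible v P -> exists2 h, h \in S :\ k & P = pair_split h.
Proof.
move=> aP; have /and3P[pP P2 /forall_inP P2'] := aP.
have [A AP kA] : exists2 A, A \in P & k \in A.
  by apply/bigcupP; move: (cover_partition pP) => /setP/(_ k); rewrite kv.
have [B PE AB] : exists2 B, P = [set A; B] & A != B.
  have : #|P :\ A| = 1%N by move: P2; rewrite (cardsD1 A) AP => /eqP[].
  move/eqP/cards1P=> [B BE]; exists B; first by rewrite -BE setD1K.
  by move/setP/(_ B): BE; rewrite !inE eqxx eq_sym => /andP[].
have BP : B \in P by rewrite PE !inE eqxx orbT.
have [ABS dAB] := admissible_blocks aP AP BP AB.
have A2 : #|A| = 2.
  have := P2' _ AP; have := P2' _ BP; have := v4.
  by rewrite -ABS cardsU disjoint_setI0 // cards0; lia.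
have : #|A :\ k| = 1%N by move: A2; rewrite (cardsD1 k) kA => -[].
move/eqP/cards1P=> [h hE].
have /andP[hk hA] : (h != k) && (h \in A) by have := set11 h; rewrite -hE !inE.
have AE : A = [set k; h] by rewrite -hE setD1K.
exists h; first by rewrite !inE hk; have := in_setU h A B; rewrite ABS hA inE => ->.
rewrite /pair_split -AE PE; congr [set _; _].
by rewrite -ABS setDUl setDv set0U; apply/esym/setDidPl; rewrite disjoint_sym.
Qed.

Lemma pair_split_inj : {in S :\ k &, injective pair_split}.
Proof.
move=> h h' hS hS' E; have : [set k; h] \in pair_split h' by rewrite -E !inE eqxx.
rewrite !inE => /orP[/eqP|/eqP] /setP E2; last by have := E2 k; rewrite !inE eqxx.
have := E2 h; rewrite !inE eqxx orbT; move: hS; rewrite !inE => /andP[/negbTE-> _] /=.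
by move/esym/eqP.
Qed.

Lemma sum_admissible (V : nmodType) (F : {set {set half_edge G}} -> V) :
  \sum_(P | admissible v P) F P = \sum_(h in S :\ k) F (pair_split h).
Proof.
rewrite -(big_imset F pair_split_inj); apply: eq_bigl => P.
apply/idP/imsetP => [/admissible_pair_split[h hS ->]|[h hS ->]]; first by exists h.
exact: pair_split_admissible.
Qed.

End FourValent.

Lemma admissible_valence (G : ograph) (v : 'I_(n_int G)) P : admissible v P -> (4 <= valence (inr v))%N.
Proof.
case/and3P=> pP /eqP P2 /forall_inP P2'; rewrite /valence (card_partition pP).
have : (\sum_(A in P) 2 <= \sum_(A in P) #|A|)%N by apply: leq_sum.
by rewrite sum_nat_const P2.
Qed.

Lemma big_seq3 (V : nmodType) (I : Type) (F : I -> V) x y z :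
  \sum_(i <- [:: x; y; z]) F i = F x + F y + F z.
Proof. by rewrite !big_cons big_nil addr0 addrA. Qed.

Lemma scalerD3 (V : lmodType rat) a (x y z : V) : a *: (x + y + z) = a *: x + a *: y + a *: z.
Proof. by rewrite !scalerDr. Qed.

Lemma scaleNN (V : lmodType rat) a (x : V) : (- a) *: (- x) = a *: x.
Proof. by rewrite scalerN scaleNr opprK. Qed.

Lemma scaler2 (V : lmodType rat) (x : V) : 2 *: x = x + x.
Proof. by rewrite scaler_nat mulr2n. Qed.

Section BoundaryStd.
Variables (m N : nat).
Hypotheses (m_even : ~~ odd m) (N_even : ~~ odd N) (N_gt0 : (0 < N)%N).

Local Notation eqv := (eqv_mod m N).

Section Branch.
Variables (G : ograph) (th : gtheta G) (x : 'I_(n_ext G)) (k : half_edge G).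
Hypotheses (gd : good th) (oG : is_order (ord G)) (tpE : tp th = [:: (x, k)]).

Let n0 : (0 < n_ext G)%N. Proof. by case: (x) => i; apply: leq_trans. Qed.

Let star_k : star (inr (tu th) : vertex G) :\ k = fstar (inr (tu th) : vertex G).
Proof.
have ath : (k, inr (tu th), inl x) \in tab th by rewrite /tab tpE inE eqxx.
have /andP[/= /eqP k1 /eqP k2] := allP (good_tab gd) _ ath.
apply/setP => h; rewrite !inE; have [->|hk] /= := eqVneq h k; first by rewrite k2 andbF.
have [hu|//] := eqVneq (inc G h) (inr (tu th)); rewrite /=; apply/esym/negPn/negP => hn.
have h1 : #|hstar (inr (tu th) : vertex G)| = 1%N by rewrite (hstar_tu gd) tpE.
move/eqP: hk; apply; apply: (eq_card1 h1); rewrite inE ?hu ?k1 ?k2 eqxx //.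
Qed.

Let star_u : k \in star (inr (tu th) : vertex G) /\ #|star (inr (tu th) : vertex G)| = 4.
Proof.
have ath : (k, inr (tu th), inl x) \in tab th by rewrite /tab tpE inE eqxx.
have /andP[/= k1 _] := allP (good_tab gd) _ ath.
split; first by rewrite inE.
have := cardsD1 k (star (inr (tu th) : vertex G)); rewrite star_k (fstar_tu gd) inE k1 => ->.
by [].
Qed.

Lemma eqv_split h r ls a b c (q : bool) : tl th = (h, r) :: ls ->
  shape th = ([:: a; b; c], 1%N, q : nat) ->
  eqv << split_vertex (tu th) [set k; h] >>
    (sgn (eword th) (eds G) *: << std a.+1 b c false q >>).
Proof.
move=> tlE; rewrite /shape tlE /= => -[ar bc _ sq].
have gs := good_split gd tpE tlE; have pw := split_theta_par tpE tlE.
have oS := split_order (tu th) [set k; h] oG.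
have := eqv_good m_even N_even N_gt0 gs (a := a.+1) (b := b) (c := c) (p := false) (q := q) _ oS n0.
rewrite shape_split ar bc sq => /(_ erefl); congr eqv; congr (_ *: _).
have fl := full_lift (good_word gd).
rewrite -(sgn_lift (good_word gd) (full_eds oG)) -(eds_split (tu th) [set k; h]).
by rewrite -(sgn_trans (good_word gs) fl (full_eds oS)) sgn_sym ?(good_word gs) // (sgn_par pw) // mul1r.
Qed.

Lemma eqv_block P A : is_Egraph (split_vertex (tu th) A) -> admissible (tu th) P -> A \in P ->
  eqv << split_vertex (tu th) (block P) >> << split_vertex (tu th) A >>.
Proof.
move=> eA aP AP; have [<-|nA] := eqVneq A (block P); first exact: eqv_refl.
have [ABS dAB] := admissible_blocks aP AP (block_in aP) nA.
have oB := split_order (tu th) (block P) oG.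
apply: eqv_sym; have := eqv_siso m_even N_even N_gt0 (split_swap ABS dAB) eA oB.
by rewrite map_id !eds_split sgn_refl scale1r.
Qed.

Lemma hair_star : k \in star (inr (tu th) : vertex G) /\
  #|star (inr (tu th) : vertex G)| = 4 /\
  star (inr (tu th) : vertex G) :\ k = fstar (inr (tu th) : vertex G).
Proof. by case: star_u. Qed.

End Branch.

(** The construction of [split_theta] treats the first line; any other line is first brought to the
    front, at the cost of the sign of [s]. *)
Lemma eqv_split_line (G : ograph) (th : gtheta G) x k s h r ls a b c (q : bool) :
  good th -> is_order (ord G) -> tp th = [:: (x, k)] -> par s (tl th) ((h, r) :: ls) ->
  [seq size l.2 | l <- (h, r) :: ls] = [:: a; b; c] -> size (tq th) = q ->
  eqv << split_vertex (tu th) (block (pair_split (tu th) k h)) >>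
    ((sgn (eword th) (eds G) * (-1) ^+ s) *: << std a.+1 b c false q >>).
Proof.
move=> gd oG tpE pl lE qE; have gl := good_set_lines gd pl.
have [ku [u4 starE]] := hair_star gd tpE.
have hS : h \in star (inr (tu th) : vertex G) :\ k.
  have [_ fE] := firsts_fstar gl; rewrite starE.
  by rewrite -[h \in _]fE /= inE eqxx.
have eS : is_Egraph (split_vertex (tu th) [set k; h]).
  apply: (good_Egraph (good_split gl tpE (erefl _))); first by case: (x) => i; apply: leq_trans.
  exact: split_order.
apply: eqv_trans (eqv_block oG eS (pair_split_admissible ku u4 hS) (set21 _ _)) _.
have sE : shape (set_lines th ((h, r) :: ls)) = ([:: a; b; c], 1%N, q : nat).
  by rewrite -lE -qE /shape /= tpE.
have pw := par_sym (eword_par (par_set_lines pl)).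
have <- : sgn (eword (set_lines th ((h, r) :: ls))) (eds G) = sgn (eword th) (eds G) * (-1) ^+ s.
  by rewrite -(sgn_trans (good_word gl) (good_word gd) (full_eds oG)) (sgn_par pw) ?(good_word gl) // mulrC.
exact: (eqv_split gl oG tpE (erefl _) sE).
Qed.

(** Each of the three splittings pushes the hair onto one line. The sign of bringing this line to
    the front is compensated by the sign of moving it back in the resulting generator. *)
Lemma eqv_split_branch (G : ograph) (th : gtheta G) a b c (q : bool) :
  good th -> is_order (ord G) -> shape th = ([:: a; b; c], 1%N, q : nat) ->
  eqv (\sum_(P | @admissible G (tu th) P) << split_vertex (tu th) (block P) >>)
    (sgn (eword th) (eds G) *:
      (<< std a.+1 b c false q >> + << std a b.+1 c false q >> + << std a b c.+1 false q >>)).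
Proof.
move=> gd oG [lE pE qE].
have [x [k tpE]] : exists x k, tp th = [:: (x, k)].
  by case: (tp th) pE => [|[x k] []] // _; exists x, k.
have [ku [u4 starE]] := hair_star gd tpE.
rewrite (sum_admissible ku u4) starE.
have [uf fE] := firsts_fstar gd.
rewrite -(eq_bigl _ _ fE) -big_uniq // big_map.
have split_line s h r ls a' b' c' := @eqv_split_line G th x k s h r ls a' b' c' q gd oG tpE.
case tlE: (tl th) lE split_line => [|[h1 r1] [|[h2 r2] [|[h3 r3] []]]] //= [ar br cr] split_line.
rewrite big_seq3 scalerD3; apply: eqvD; first apply: eqvD.
- have := split_line false h1 r1 [:: (h2, r2); (h3, r3)] a b c (par_refl _) _ qE.
  by rewrite expr0 mulr1; apply; rewrite /= ar br cr.
- have H := split_line true h2 r2 [:: (h1, r1); (h3, r3)] b a c (par_swap _ _ _) _ qE.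
  apply: eqv_trans (H _) _; first by rewrite /= ar br cr.
  rewrite expr1 mulrN1.
  have n0 : (0 < false + q + (b.+1 + a + c))%N by rewrite !addSn !addnS.
  by have := eqvZ (- sgn (eword th) (eds G)) (std_swap12 m_even N_even N_gt0 n0); rewrite scaleNN.
(* Bringing the third line to the front is a cyclic permutation, hence even; it is undone by two
   transpositions. *)
- have pl : par false [:: (h1, r1); (h2, r2); (h3, r3)] [:: (h3, r3); (h1, r1); (h2, r2)].
    exact: par_sym (par_move (h3, r3) [:: (h1, r1); (h2, r2)] [::]).
  have H := split_line false h3 r3 [:: (h1, r1); (h2, r2)] c a b pl _ qE.
  apply: eqv_trans (H _) _; first by rewrite /= ar br cr.
  rewrite expr0 mulr1; apply: eqvZ.
  have n0 : (0 < false + q + (c.+1 + a + b))%N by rewrite !addSn !addnS.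
  apply: eqv_trans (std_swap12 m_even N_even N_gt0 n0) _.
  have n1 : (0 < false + q + (a + c.+1 + b))%N by rewrite addnS addSn addnS.
  by have := eqvZ (-1) (std_swap23 m_even N_even N_gt0 n1); rewrite scaleNN scale1r scaleN1r.
Qed.

Lemma boundaryU G : boundary << G >> = boundary1 G.
Proof. exact: (free_extU (@boundary1) G). Qed.

Lemma boundary1_good (G : ograph) (th : gtheta G) : good th ->
  boundary1 G = \sum_(P | @admissible G (tu th) P) << split_vertex (tu th) (block P) >> +
    \sum_(P | @admissible G (tw th) P) << split_vertex (tw th) (block P) >>.
Proof.
move=> gd; have [_ uw _ _] := inner_uniq gd.
rewrite /boundary1 (bigD1 (tu th)) //= (bigD1 (tw th)) 1?eq_sym //=; congr (_ + _).
rewrite [X in _ + X]big1 => [|v /andP[vu vw]]; first exact: addr0.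
apply: big_pred0 => P; apply/negP => /admissible_valence; rewrite (valence_int gd).
by rewrite !(eq_sym _ v) (negbTE vu) (negbTE vw) !muln0.
Qed.

Lemma boundary_std10 a b c :
  eqv (boundary << std a b c true false >>)
    (<< std a.+1 b c false false >> + << std a b.+1 c false false >> + << std a b c.+1 false false >>).
Proof.
have [gd sE oS eS] := stdP a b c true false; have [_ _ qE] := sE.
rewrite boundaryU (boundary1_good gd) [X in _ + X]big_pred0 ?addr0; last first.
  move=> P; apply/negP => /admissible_valence; rewrite (valence_int gd) qE.
  by have [_ /negbTE -> _ _] := inner_uniq gd; rewrite muln0.
have := eqv_split_branch (q := false) gd oS sE; rewrite eS sgn_refl scale1r; exact.
Qed.

(** For an odd sum and p = q = 1 the mirror has sign +1, so both branch vertices contribute the same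
    terms, whence the factor 2. In these terms the sum is even, and the remaining hair can be moved
    to the first branch vertex without a sign. *)
Lemma boundary_std11 a b c : odd (a + b + c) ->
  eqv (boundary << std a b c true true >>)
    (2 *: (<< std a.+1 b c true false >> + << std a b.+1 c true false >> + << std a b c.+1 true false >>)).
Proof.
move=> oabc; have [gd sE oS eS] := stdP a b c true true; have [lE pE qE] := sE.
have sM : shape (mirror (std_theta a b c true true)) = ([:: a; b; c], 1%N, true : nat).
  by rewrite shape_mirror sE pE qE.
have E1 := eqv_split_branch (q := true) gd oS sE.
have E2 := eqv_split_branch (q := true) (good_mirror gd) oS sM.
have sgnM : sgn (eword (mirror (std_theta a b c true true))) (eds (std a b c true true)) = 1.
  have := par_mirror (std_theta a b c true true); rewrite sE pE qE /= addn0 addnA oabc /= => pm.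
  by rewrite eS sgn_sym ?(good_word gd) ?(good_word (good_mirror gd)) // (sgn_par pm) ?(good_word gd).
rewrite sgnM scale1r in E2; rewrite eS sgn_refl scale1r in E1.
rewrite boundaryU (boundary1_good gd); apply: eqv_trans (eqvD E1 E2) _.
have M a' b' c' : ~~ odd (a' + b' + c') -> (0 < a' + b' + c')%N ->
    eqv << std a' b' c' false true >> << std a' b' c' true false >>.
  move=> /negbTE o' n0; have n1 : (0 < false + true + (a' + b' + c'))%N by [].
  by have := std_mirror m_even N_even N_gt0 n1; rewrite o' expr0 scale1r.
have H := eqvD (eqvD (M a.+1 b c _ _) (M a b.+1 c _ _)) (M a b c.+1 _ _).
by rewrite scaler2; apply: eqvD; apply: H; rewrite ?addnS ?addSn //= oabc.
Qed.

End BoundaryStd.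

(** * Alternating polynomials modulo the first elementary symmetric one *)

Section AntisymmetricSpan.
Variables (V : lmodType rat) (S : V -> Prop) (f : nat -> nat -> nat -> V) (l : nat).
Hypotheses (sS : subspace S)
  (f12 : forall a b c, (a + b + c)%N = l.*2 -> S (f a b c + f b a c))
  (f23 : forall a b c, (a + b + c)%N = l.*2 -> S (f a b c + f a c b))
  (f_e1 : forall a b c, (a + b + c).+1%N = l.*2 -> S (f a.+1 b c + f a b.+1 c + f a b c.+1))
  (f_basis : forall i, (i < l %/ 3)%N -> S (f (l - i)%N (l - i).-1 i.*2.+1)).

Let S_half x : S (x + x) -> S x.
Proof.
move=> /(subspaceZ (1 / 2) sS); rewrite -mulr2n -scaler_nat scalerA.
by rewrite (_ : 1 / 2 * 2%:R = 1) ?scale1r //; field.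
Qed.

Let S_cancel x y : S (x + y) -> S y -> S x.
Proof. by move=> xy Sy; rewrite -[x](addrK y); apply: subspaceB. Qed.

(* The relation [f_e1] raises the smallest entry or shrinks the gap between the
   other two, until the gap is 0 or 1. *)
Lemma sorted_span n a b c : (l.*2 < c + n)%N -> (c <= b <= a)%N -> (a + b + c)%N = l.*2 ->
  S (f a b c).
Proof.
elim: n a b c => [|n IHn] a b c; first by lia.
have [d] := ubnP (a - b); elim: d a b => // d IHd a b abd cn /andP[cb ba] abc.
have [E|nbc] := eqVneq c b; first by subst c; apply/S_half/f23.
have [ab|] := leqP a b.
  by have E : a = b; [lia | subst a; apply/S_half/f12].
rewrite leq_eqVlt => /orP[/eqP ab|ab].
  (* With a = b + 1 the total 2l forces c to be odd, c = 2i + 1, so the triple is a basis element; c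
     < b gives i < floor(l/3). *)
  have -> : a = (l - c./2)%N by lia.
  have -> : b = (l - c./2).-1 by lia.
  by rewrite (_ : c = (c./2).*2.+1) ?doubleK ?uphalf_double; [rewrite /= ?uphalf_double; apply: f_basis; lia | lia].
case: a abd ba abc ab => // a abd ba abc ab.
(* The first replacement has a smaller gap between the two larger entries, the second a larger
   smallest entry. *)
apply: (@S_cancel _ (f a b.+1 c + f a b c.+1)).
  by rewrite addrA; apply: f_e1; lia.
by apply: subspaceD => //; [apply: IHd; lia | apply: IHn; lia].
Qed.

Lemma antisym_span a b c : (a + b + c)%N = l.*2 -> S (f a b c).
Proof.
have sorted x y z : (z <= y <= x)%N -> (x + y + z)%N = l.*2 -> S (f x y z).
  by apply: (@sorted_span l.*2.+1); lia.
have s12 x y z : (x + y + z)%N = l.*2 -> S (f y x z) -> S (f x y z).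
  by move=> E; apply: S_cancel; apply: f12.
have s23 x y z : (x + y + z)%N = l.*2 -> S (f x z y) -> S (f x y z).
  by move=> E; apply: S_cancel; apply: f23.
move=> E; case: (leqP a b) => ab; case: (leqP b c) => bc; case: (leqP a c) => ac; try lia.
- by apply: (s12 a b c) => //; apply: (s23); [lia|]; apply: (s12); [lia|]; apply: (sorted); lia.
- by apply: (s12 a b c) => //; apply: (s23); [lia|]; apply: (sorted); lia.
- by apply: (s12 a b c) => //; apply: (sorted); lia.
- by apply: (s23 a b c) => //; apply: (s12); [lia|]; apply: (sorted); lia.
- by apply: (s23 a b c) => //; apply: (sorted); lia.
- by apply: (sorted); lia.
Qed.

End AntisymmetricSpan.

Definition antisym (R : zmodType) (f : nat -> nat -> nat -> R) : Prop :=
  (forall a b c, f b a c = - f a b c) /\ (forall a b c, f a c b = - f a b c).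

Definition det3 (R : pzRingType) (F G H : nat -> R) (a b c : nat) : R :=
  F a * G b * H c - F b * G a * H c + F b * G c * H a - F c * G b * H a
  + F c * G a * H b - F a * G c * H b.

Lemma det3_antisym (R : comNzRingType) (F G H : nat -> R) : antisym (det3 F G H).
Proof. by split=> a b c; rewrite /det3; ring. Qed.

(* A functional that vanishes on the multiples of the first elementary symmetric
   polynomial: a coefficient of the alternant at a point whose coordinates add
   up to zero. *)
Definition alternant_coef (t a b c : nat) : rat :=
  (det3 (fun=> 1) (fun n => (- (1 + 'X)) ^+ n) (fun n => 'X^n) a b c : {poly rat})`_t.

Lemma alternant_coef_antisym t : antisym (alternant_coef t).
Proof.
by split=> a b c; rewrite /alternant_coef -coefN; congr (_`_t);
  [rewrite (det3_antisym _ _ _).1 | rewrite (det3_antisym _ _ _).2].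
Qed.

Lemma alternant_coef_e1 t a b c : alternant_coef t a.+1 b c + alternant_coef t a b.+1 c +
  alternant_coef t a b c.+1 = 0.
Proof.
rewrite /alternant_coef -!coefD -[RHS](coef0 rat t); apply: (congr1 (fun p : {poly rat} => p`_t)).
by rewrite /det3 !exprS; ring.
Qed.

(** The matrix of evaluations is triangular with non-zero diagonal, which gives independence. *)
Lemma alternant_coef_basis l i j : (i < l %/ 3)%N -> (j <= i)%N ->
  alternant_coef j.*2.+1 (l - i) (l - i).-1 i.*2.+1 = if j == i then 2 * (-1) ^+ (l - i).-1 else 0.
Proof.
move=> il ji; have [s [sE ts]] : exists s, (l - i)%N = s.+1 /\ (i.*2.+1 < s)%N.
  by exists (l - i).-1; lia.
rewrite sE [s.+1.-1]/=; set c := i.*2.+1; set y : {poly rat} := - (1 + 'X).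
(* The terms are sorted by the powers of X that they contain. Since 2j + 1 < s, the multiples of X^s
   contribute nothing, and the coefficient of X^c in the first summand is the value at 0 of y^s (1 -
   y), where y(0) = -1. *)
have -> : alternant_coef j.*2.+1 s.+1 s c =
    ('X^c * (y ^+ s * (1 - y)) + 'X^s * (y ^+ s.+1 - y ^+ c + 'X * y ^+ c - 'X * y ^+ s))`_j.*2.+1.
  by rewrite /alternant_coef; apply: (congr1 (fun p : {poly rat} => p`_ _)); rewrite /det3 -/y !exprS; ring.
rewrite coefD !coefXnM [X in _ + X]ifT ?addr0; last by lia.
rewrite ltnS ltn_double; case: (eqVneq j i) => [->|ne]; last by rewrite ifT //; lia.
rewrite ltnn subnn -horner_coef0 /y !hornerE /=.
by ring.
Qed.

Section QuotientBasis.
Variables (V : lmodType rat) (Z B : V -> Prop) (f : nat -> nat -> nat -> V) (l : nat).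
Variable ev : nat -> V -> rat.
Hypotheses (sB : subspace B)
  (f12 : forall a b c, (a + b + c)%N = l.*2 -> B (f a b c + f b a c))
  (f23 : forall a b c, (a + b + c)%N = l.*2 -> B (f a b c + f a c b))
  (f_e1 : forall a b c, (a + b + c).+1%N = l.*2 -> B (f a.+1 b c + f a b.+1 c + f a b c.+1))
  (Zf : forall a b c, (a + b + c)%N = l.*2 -> Z (f a b c))
  (Z_ind : forall U : V -> Prop, subspace U -> (forall x, B x -> U x) ->
     (forall a b c, (a + b + c)%N = l.*2 -> U (f a b c)) -> forall x, Z x -> U x)
  (ev_lin : forall t a x y, ev t (a *: x + y) = a * ev t x + ev t y)
  (evB : forall t x, B x -> ev t x = 0)
  (evf : forall t a b c, (a + b + c)%N = l.*2 -> ev t (f a b c) = alternant_coef t a b c).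

(** Common form of the two non-zero cases. [antisym_span], applied to the vectors that are
    combinations of the [z i] modulo [B], gives generation; the functionals [ev] give
    independence. *)
Lemma quotient_dim_antisym : quotient_dim Z B (l %/ 3).
Proof.
pose z (i : 'I_(l %/ 3)) := f (l - i)%N (l - i).-1 i.*2.+1.
have zl (i : 'I_(l %/ 3)) : ((l - i) + (l - i).-1 + i.*2.+1)%N = l.*2.
  by have := ltn_ord i; lia.
have B0 : B 0 by case: sB.
exists z; split=> [i|x Zx|c Bc i]; first exact: Zf.
  pose U x := exists c : 'I_(l %/ 3) -> rat, B (x - \sum_i c i *: z i).
  have sU : subspace U.
    split.
      by exists (fun=> 0); rewrite big1 ?subr0 // => i _; rewrite scale0r.
    move=> a y y' [c Bc] [c' Bc']; exists (fun i => a * c i + c' i).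
    have -> : \sum_i (a * c i + c' i) *: z i = a *: \sum_i c i *: z i + \sum_i c' i *: z i.
      by rewrite scaler_sumr -big_split; apply: eq_bigr => i _; rewrite scalerDl scalerA.
    by rewrite opprD addrACA -scalerBr; case: sB => _; apply.
  have BU y : B y -> U y.
    move=> By; exists (fun=> 0); rewrite big1 ?subr0 // => i _; exact: scale0r.
  apply: (Z_ind sU BU _ Zx); apply: antisym_span => //.
  - by move=> a b c abc; apply/BU/f12.
  - by move=> a b c abc; apply/BU/f23.
  - by move=> a b c abc; apply/BU/f_e1.
  move=> i il; exists (fun j => (j == Ordinal il)%:R).
  rewrite (bigD1 (Ordinal il)) //= eqxx scale1r big1 ?addr0 ?subrr //.
  by move=> j /negbTE ->; rewrite scale0r.
have ev0 t : ev t 0 = 0 by exact: evB.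
have ev_sum t : ev t (\sum_i c i *: z i) = \sum_i c i * alternant_coef t (l - i) (l - i).-1 i.*2.+1.
  elim/big_rec2: _ => [|j x y _ E]; first exact: ev0.
  by rewrite ev_lin E evf.
(* The functional with t = 2i + 1 vanishes on the later basis elements, and the coefficients of the
   earlier ones are zero by induction. *)
have [n] := ubnP (i : nat); elim: n i => // n IHn i ilt.
have := ev_sum i.*2.+1; rewrite evB // (bigD1 i) //= alternant_coef_basis ?eqxx //.
rewrite big1 ?addr0 => [/esym/eqP|j ji].
  by rewrite mulf_eq0 => /orP[/eqP//|]; rewrite mulf_eq0 signr_eq0.
have [lt|le] := ltnP j i; first by rewrite IHn ?mul0r //; apply: leq_trans lt _.
rewrite alternant_coef_basis // ifF ?mulr0 //.
by apply: contraNF ji => /eqP E; apply/eqP/val_inj.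
Qed.

End QuotientBasis.

Definition on_triple (f : nat -> nat -> nat -> rat) (ns : seq nat) : rat :=
  if ns is [:: a; b; c] then f a b c else 0.

(** * Homology *)

(* The value f on theta graphs of defect e with an even number of hairs on the
   lines. *)
Definition even_weight (e : nat) f (ns : seq nat) (p q : nat) : rat :=
  if ((p + q)%N == e) && ~~ odd (sumn ns) then on_triple f ns else 0.

Lemma par_on_triple f b ns ns' : antisym f -> par b ns ns' ->
  on_triple f ns' = (-1) ^+ b * on_triple f ns.
Proof.
(* [on_triple] looks at the whole list, so the heads removed in the induction are kept as a
   prefix. *)
move=> [f12 f23] pn; rewrite -[ns]cat0s -[ns']cat0s; elim: pn [::] => {b ns ns'}.
- by move=> pre; rewrite mul1r.
- by move=> b x s t _ IH pre; rewrite -!cat_rcons.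
- move=> x y s [|a [|b pre]]; rewrite expr1 mulN1r /=.
  + by case: s => [|c []]; rewrite ?oppr0.
  + by case: s => [|c s]; rewrite ?oppr0.
  by case: pre => [|c pre] /=; rewrite ?oppr0 //; case: pre => //; rewrite oppr0.
by move=> b c s t u _ IH1 _ IH2 pre; rewrite IH2 IH1 mulrA -signr_addb addbC.
Qed.

(** With an even sum the mirror sign is (-1)^(pq); the bound on [e] excludes p = q = 1, where it
    would be -1. *)
Lemma even_weight_sym e f : (e <= 1)%N -> antisym f -> sym_weight (even_weight e f).
Proof.
move=> e1 af; split=> [b ns ns' p q pn|ns p q]; rewrite /even_weight.
  rewrite -(perm_sumn (par_perm pn)); case: ifP => _; last by rewrite mulr0.
  exact: par_on_triple.
rewrite addnC; case: ifP => [/andP[/eqP pqe /negbTE ->]|]; last by rewrite mulr0.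
rewrite (_ : odd p && odd q = false) ?mul1r //.
by case: p q pqe => [|p] [|q] //=; rewrite ?andbF //; lia.
Qed.

Section Homology.
Variables (m N : nat).
Hypotheses (m_even : ~~ odd m) (N_even : ~~ odd N) (N_gt0 : (0 < N)%N).

Local Notation eqv := (eqv_mod m N).
Local Notation rel := (relations m N).

Lemma phi_invariant W : sym_weight W -> invariant_functional (phi W).
Proof. by move=> sW G H f g r s; apply: phi_siso. Qed.

Lemma phi_std W a b c (p q : bool) : sym_weight W -> (0 < p + q + (a + b + c))%N ->
  phi W (std a b c p q) = W [:: a; b; c] p q.
Proof.
move=> sW; rewrite -n_ext_std => n0; have [gd sE oS eS] := stdP a b c p q.
by rewrite (phi_good sW oS n0 gd) eS sgn_refl mul1r /weight sE.
Qed.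

Definition ev (F : ograph -> rat) (x : {malg rat[ograph]}) : rat := free_ext (F : ograph -> rat^o) x.

Lemma evU F G : ev F << G >> = F G.
Proof. exact: (free_extU (F : ograph -> rat^o)). Qed.

Lemma ev_linear F a x y : ev F (a *: x + y) = a * ev F x + ev F y.
Proof. exact: (free_ext_linear (F : ograph -> rat^o)). Qed.

Lemma ev_sum3 F x y z u v w : ev F x = u -> ev F y = v -> ev F z = w -> ev F (x + y + z) = u + v + w.
Proof. by move=> <- <- <-; rewrite /ev !(free_extD (F : ograph -> rat^o)). Qed.

Lemma evZ F a x : ev F (a *: x) = a * ev F x.
Proof. exact: (free_extZ (F : ograph -> rat^o)). Qed.

Lemma ev_lincomb F (I : finType) (P : pred I) (c : I -> rat) x :
  ev F (\sum_(i | P i) c i *: x i) = \sum_(i | P i) c i * ev F (x i).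
Proof.
elim/big_rec2: _ => [|i u v _ <-]; first exact: (free_ext0 (F : ograph -> rat^o)).
exact: ev_linear.
Qed.

Lemma ev_rel F x : invariant_functional F -> rel x -> ev F x = 0.
Proof. by move=> iF; apply: kills_relations. Qed.

Lemma ev_eqv F x y : invariant_functional F -> eqv x y -> ev F x = ev F y.
Proof.
move=> iF /(ev_rel iF); rewrite /ev free_extB => E.
by apply/eqP; rewrite -subr_eq0; apply/eqP.
Qed.

Lemma ev_boundary F x : ev F (boundary x) = ev (bdry_functional F) x.
Proof. exact: free_ext_boundary. Qed.

Lemma ev_subspace F : subspace (fun x => ev F x = 0).
Proof.
split; first exact: (free_ext0 (F : ograph -> rat^o)).
by move=> a x y Fx Fy; rewrite ev_linear Fx Fy mulr0 addr0.
Qed.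

Lemma boundary_linear a x y : boundary (a *: x + y) = a *: boundary x + boundary y.
Proof. exact: (free_ext_linear (@boundary1)). Qed.

Lemma rel_eqv x y : eqv x y -> rel y -> rel x.
Proof. by move=> xy ry; rewrite -[x](subrK y); apply: subspaceD (relations_subspace _ _) xy ry. Qed.

Lemma eqv_mem U x y : subspace U -> (forall x, rel x -> U x) -> eqv x y -> U y -> U x.
Proof. by move=> sU rU xy Uy; rewrite -[x](subrK y); apply: subspaceD => //; apply: rU. Qed.

Section Chains.
Variable k : nat.
Hypothesis k_gt0 : (0 < k)%N.

Lemma chains_subspace i : subspace (chains m N i k).
Proof. by apply: add_space_subspace; [exact: span_subspace | exact: relations_subspace]. Qed.

Lemma std_chains i a b c (p q : bool) : (p + q)%N = i -> (p + q + (a + b + c))%N = k ->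
  chains m N i k << std a b c p q >>.
Proof.
move=> pq abc; exists << std a b c p q >>, 0; split; rewrite ?addr0 //; last first.
  by case: (relations_subspace m N).
apply: span_mem; exists (std a b c p q).
rewrite std_hairy ?std_defect ?abc // /hodge_degree n_ext_std abc pq.
by split.
Qed.

(** Induction principle for chains: modulo relations, the standard generators with hairs placed
    first at [tu] suffice. The booleans [0 < i] and [1 < i] are p and q for defect [i]; a single
    hair at the other branch vertex is moved by the mirror. *)
Lemma chains_min i U : (i <= 2)%N -> subspace U -> (forall x, rel x -> U x) ->
  (forall a b c, (i + (a + b + c))%N = k -> U << std a b c (0 < i)%N (1 < i)%N >>) ->
  forall x, chains m N i k x -> U x.
Proof.
move=> i2 sU rU sU' x [y [z [ys rz ->]]]; apply: subspaceD => //; last exact: rU.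
apply: span_min ys => // _ [G [hG dG nG ->]].
have [th gd] := hairy_good hG; have /and4P[/and5P[oG _ n0 _ _] _ _ _] := hG.
have [a [b [c lE]]] : exists a b c, (shape th).1.1 = [:: a; b; c].
  have := good_lines gd; rewrite /shape /=; case: (tl th) => [|l1 [|l2 [|l3 []]]] //= _.
  by exists (size l1.2), (size l2.2), (size l3.2).
have [p pE] : exists p : bool, size (tp th) = p.
  by have := good_tp gd; case: (size _) => [|[|]] // _; [exists false | exists true].
have [q qE] : exists q : bool, size (tq th) = q.
  by have := good_tq gd; case: (size _) => [|[|]] // _; [exists false | exists true].
have sE : shape th = ([:: a; b; c], p : nat, q : nat) by rewrite -lE -pE -qE.
have pq : (p + q)%N = i.
  by have := good_defect gd n0; rewrite dG sE /= => -[].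
have abc : (p + q + (a + b + c))%N = k.
  by rewrite -nG /hodge_degree (card_ext gd) sE /= addn0 (addnA a).
have := eqv_good m_even N_even N_gt0 gd sE oG n0 => /(eqv_mem sU rU); apply; apply: subspaceZ => //.
have abc' : (i + (a + b + c))%N = k by rewrite -pq.
have : (p = (0 < i)%N /\ q = (1 < i)%N) \/ [/\ p = false, q = true & i = 1].
  by rewrite -pq; case: (p); case: (q); [left | left | right | left].
case=> [[-> ->]|[-> -> i1]]; first exact: sU'.
have := sU' a b c abc'; rewrite i1 => Us.
have n0' : (0 < false + true + (a + b + c))%N by [].
apply: (eqv_mem sU rU (std_mirror m_even N_even N_gt0 n0')).
exact: subspaceZ.
Qed.

Lemma boundaries_subspace i : subspace (boundaries m N i k).
Proof.
apply: add_space_subspace; last exact: relations_subspace.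
have [c0 cl] := chains_subspace i.+1.
split; first by exists 0; rewrite // /boundary msupp0 big_seq_fset0.
by move=> a _ _ [x cx ->] [y cy ->]; exists (a *: x + y); [exact: cl | rewrite boundary_linear].
Qed.

Lemma rel_boundaries i x : rel x -> boundaries m N i k x.
Proof.
move=> rx; exists 0, x; split; rewrite ?add0r //.
have [c0 _] := chains_subspace i.+1.
by exists 0; rewrite // /boundary msupp0 big_seq_fset0.
Qed.

Lemma boundary_boundaries i x : chains m N i.+1 k x -> boundaries m N i k (boundary x).
Proof.
move=> cx; exists (boundary x), 0; split; rewrite ?addr0 //; first by exists x.
by case: (relations_subspace m N).
Qed.

Lemma boundaries_min i U : subspace U -> (forall x, rel x -> U x) ->
  (forall x, chains m N i.+1 k x -> U (boundary x)) -> forall x, boundaries m N i k x -> U x.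
Proof.
move=> sU rU bU _ [_ [y [[x cx ->] ry ->]]]; apply: subspaceD => //; [exact: bU | exact: rU].
Qed.

(** As [F] composed with the differential is invariant too, vanishing needs to be checked on the
    boundaries of standard generators only. *)
Lemma boundaries_ev i F : (i <= 1)%N -> invariant_functional F ->
  (forall a b c, (i.+1 + (a + b + c))%N = k ->
     ev F (boundary << std a b c true (0 < i)%N >>) = 0) ->
  forall x, boundaries m N i k x -> ev F x = 0.
Proof.
move=> i1 iF Fs; apply: boundaries_min; first exact: ev_subspace.
  by move=> x; apply: ev_rel.
move=> x; rewrite ev_boundary; move: x.
apply: chains_min => //; first exact: ev_subspace.
  by move=> x; apply: ev_rel; apply: bdry_functional_invariant.
by move=> a b c abc; rewrite -ev_boundary; apply: Fs.
Qed.

End Chains.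
End Homology.

Section HomologyDimensions.
Variables (m N : nat).
Hypotheses (m_even : ~~ odd m) (N_even : ~~ odd N) (N_gt0 : (0 < N)%N).

Local Notation eqv := (eqv_mod m N).
Local Notation rel := (relations m N).

Let relS : subspace rel. Proof. exact: relations_subspace. Qed.

(** The mirror has sign -1 here, so the generator equals its own negative. *)
Lemma std00_odd a b c : odd (a + b + c) -> rel << std a b c false false >>.
Proof.
move=> oabc; have n0 : (0 < a + b + c)%N by case: (_ + c)%N oabc.
have := std_mirror m_even N_even N_gt0 (p := false) (q := false) n0.
rewrite /= oabc expr1 scaleN1r /eqv_mod opprK -mulr2n -scaler_nat => /(subspaceZ (1 / 2) relS).
by rewrite scalerA (_ : 1 / 2 * 2%:R = 1) ?scale1r //; field.
Qed.

Lemma boundary_std00 a b c : boundary << std a b c false false >> = 0.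
Proof.
have [gd sE _ _] := stdP a b c false false; have [_ pE qE] := sE.
rewrite boundaryU /boundary1 big1 // => v _; apply: big_pred0 => P; apply/negP => /admissible_valence.
by rewrite (valence_int gd) pE qE.
Qed.

Lemma quotient_dim0 (V : lmodType rat) (Z B : V -> Prop) : (forall x, Z x -> B x) -> quotient_dim Z B 0.
Proof.
move=> ZB; exists (fun=> 0); split=> [[]|x Zx|c _ []] //.
by exists (fun=> 0); rewrite big_ord0 subr0; apply: ZB.
Qed.

Section Degree.
Variables (k : nat).
Hypothesis k_gt0 : (0 < k)%N.

Lemma homology0_odd : odd k -> homology_dim m N 0 k 0.
Proof.
move=> ok; apply: quotient_dim0 => x [cx _]; apply: rel_boundaries.
by apply: (chains_min m_even N_even N_gt0) cx => // a b c abc; apply: std00_odd; move: ok; rewrite -abc.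
Qed.

Lemma homology0_even l : k = l.*2 -> homology_dim m N 0 k (l %/ 3).
Proof.
move=> kl; pose W t := even_weight 0 (alternant_coef t).
have sW t : sym_weight (W t) by apply: even_weight_sym => //; apply: alternant_coef_antisym.
have iW t := phi_invariant (sW t).
have evf t a b c : (a + b + c)%N = k -> ev (phi (W t)) << std a b c false false >> = alternant_coef t a b c.
  move=> abc; rewrite evU phi_std //= ?abc // /W /even_weight /= addn0 (addnA a) abc kl odd_double.
  by [].
have rB x : rel x -> boundaries m N 0 k x by apply: rel_boundaries.
apply: (quotient_dim_antisym (f := fun a b c => << std a b c false false >>) (ev := fun t => ev (phi (W t)))).
- exact: boundaries_subspace.
- move=> a b c abc; apply: rB; rewrite -[X in _ + X]opprK.
  by apply: std_swap12; rewrite // abc -kl.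
- move=> a b c abc; apply: rB; rewrite -[X in _ + X]opprK.
  by apply: std_swap23; rewrite // abc -kl.
- move=> a b c abc.
  apply: (eqv_mem _ rB (eqv_sym (boundary_std10 m_even N_even N_gt0 a b c))); first exact: boundaries_subspace.
  by apply: boundary_boundaries; apply: std_chains; rewrite // kl -abc.
- move=> a b c abc; split; first by apply: std_chains; rewrite // kl.
  by rewrite boundary_std00; case: relS.
- move=> U sU BU fU x [cx _]; apply: (chains_min m_even N_even N_gt0 _ sU _ _ cx) => //.
    by move=> y /rB/BU.
  by move=> a b c abc; apply: fU; rewrite -kl -abc.
- by move=> t a x y; rewrite ev_linear.
- move=> t; apply: (boundaries_ev m_even N_even N_gt0) => // a b c abc.
  rewrite (ev_eqv m_even N_even N_gt0 (iW t) (boundary_std10 m_even N_even N_gt0 a b c)).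
  have evf' a' b' c' : (a' + b' + c')%N = (a + b + c).+1 ->
    ev (phi (W t)) << std a' b' c' false false >> = alternant_coef t a' b' c'.
    by move=> E; apply: evf; rewrite E -abc.
  rewrite (ev_sum3 (evf' a.+1 b c _) (evf' a b.+1 c _) (evf' a b c.+1 _)) ?addnS ?addSn //.
  exact: alternant_coef_e1.
by move=> t a b c abc; apply: evf; rewrite kl.
Qed.

Lemma homology1_odd l : k = l.*2.+1 -> homology_dim m N 1 k (l %/ 3).
Proof.
move=> kl; pose W t := even_weight 1 (alternant_coef t).
have sW t : sym_weight (W t) by apply: even_weight_sym => //; apply: alternant_coef_antisym.
have iW t := phi_invariant (sW t).
have evf t a b c : (a + b + c)%N = l.*2 -> ev (phi (W t)) << std a b c true false >> = alternant_coef t a b c.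
  move=> abc; rewrite evU phi_std //= /W /even_weight /= addn0 (addnA a) abc odd_double.
  by [].
have rB x : rel x -> boundaries m N 1 k x by apply: rel_boundaries.
have bd a b c : (a + b + c).+1 = l.*2 ->
    eqv (boundary << std a b c true true >>)
    (2 *: (<< std a.+1 b c true false >> + << std a b.+1 c true false >> + << std a b c.+1 true false >>)).
  move=> abc; apply: boundary_std11 => //.
  by have := odd_double l; rewrite -abc /= => /negbFE.
apply: (quotient_dim_antisym (f := fun a b c => << std a b c true false >>) (ev := fun t => ev (phi (W t)))).
- exact: boundaries_subspace.
- by move=> a b c abc; apply: rB; rewrite -[X in _ + X]opprK; apply: std_swap12.
- by move=> a b c abc; apply: rB; rewrite -[X in _ + X]opprK; apply: std_swap23.
- move=> a b c abc; have sB := boundaries_subspace m N k 1.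
  have : boundaries m N 1 k (2 *: (<< std a.+1 b c true false >> + << std a b.+1 c true false >> +
      << std a b c.+1 true false >>)).
    apply: (eqv_mem sB rB (eqv_sym (bd a b c abc))).
    by apply: boundary_boundaries; apply: std_chains; rewrite // kl -abc.
  move=> /(subspaceZ (1 / 2) sB); rewrite scalerA (_ : 1 / 2 * 2 = 1) ?scale1r //; by field.
- move=> a b c abc; split; first by apply: std_chains; rewrite // abc kl.
  (* The boundary has defect 0 and an odd number of hairs, hence vanishes: every chain is a
     cycle. *)
  apply: (rel_eqv (boundary_std10 m_even N_even N_gt0 a b c)).
  have o : odd (a + b + c).+1 by rewrite abc /= odd_double.
  by do 2?apply: subspaceD => //; apply: std00_odd; rewrite ?addnS ?addSn.
- move=> U sU BU fU x [cx _]; apply: (chains_min m_even N_even N_gt0 _ sU _ _ cx) => //.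
    by move=> y /rB/BU.
  by move=> a b c abc; apply: fU; move: abc; rewrite kl add1n => -[].
- by move=> t a x y; rewrite ev_linear.
- move=> t; apply: (boundaries_ev m_even N_even N_gt0) => // a b c abc.
  have abc' : (a + b + c).+1 = l.*2 by move: abc; rewrite kl => -[].
  rewrite (ev_eqv m_even N_even N_gt0 (iW t) (bd a b c abc')).
  have evf' a' b' c' : (a' + b' + c')%N = (a + b + c).+1 ->
    ev (phi (W t)) << std a' b' c' true false >> = alternant_coef t a' b' c'.
    by move=> E; apply: evf; rewrite E.
  rewrite evZ (ev_sum3 (evf' a.+1 b c _) (evf' a b.+1 c _) (evf' a b c.+1 _)) ?addnS ?addSn //.
  by rewrite alternant_coef_e1 mulr0.
by move=> t a b c abc; apply: evf.
Qed.

End Degree.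
End HomologyDimensions.

(** * Injectivity of the differential on defect 1 in even degree *)

Section Injectivity.
Variables (m N : nat).
Hypotheses (m_even : ~~ odd m) (N_even : ~~ odd N) (N_gt0 : (0 < N)%N).
Variable k : nat.
Hypotheses (k_gt0 : (0 < k)%N) (k_even : ~~ odd k).

Local Notation eqv := (eqv_mod m N).
Local Notation rel := (relations m N).
Local Notation triple := ('I_k * 'I_k * 'I_k)%type.

Let relS : subspace rel. Proof. exact: relations_subspace. Qed.

(** Strictly decreasing exponents of sum k - 1 index a basis of the alternating polynomials of that
    degree; all entries are below k. *)
Definition strict (t : triple) : bool :=
  [&& (t.2 < t.1.2)%N, (t.1.2 < t.1.1)%N & (t.1.1 + t.1.2 + t.2).+1 == k].

Definition strict_sum (c : triple -> rat) : {malg rat[ograph]} :=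
  \sum_(t | strict t) c t *: << std t.1.1 t.1.2 t.2 true false >>.

Lemma chains1_strict x : chains m N 1 k x -> exists c, eqv x (strict_sum c).
Proof.
pose U x := exists c, eqv x (strict_sum c).
have sum0 : strict_sum (fun=> 0) = 0.
  by rewrite /strict_sum big1 // => t _; exact: scale0r.
have sU : subspace U.
  split; first by exists (fun=> 0); rewrite sum0; apply: eqv_refl.
  move=> a y z [c Ec] [d Ed]; exists (fun t => a * c t + d t).
  have -> : strict_sum (fun t => a * c t + d t) = a *: strict_sum c + strict_sum d.
    rewrite /strict_sum scaler_sumr -big_split; apply: eq_bigr => t _.
    by rewrite scalerDl scalerA.
  by apply: eqvD => //; apply: eqvZ.
have rU y : rel y -> U y.
  by move=> ry; exists (fun=> 0); rewrite sum0 /eqv_mod subr0.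
have n0 a b c : (0 < true + false + (a + b + c))%N by [].
have s12 a b c : U << std b a c true false >> -> U << std a b c true false >>.
  move=> Uy; apply: (eqv_mem sU rU (std_swap12 m_even N_even N_gt0 (n0 a b c))).
  exact: subspaceN.
have s23 a b c : U << std a c b true false >> -> U << std a b c true false >>.
  move=> Uy; apply: (eqv_mem sU rU (std_swap23 m_even N_even N_gt0 (n0 a b c))).
  exact: subspaceN.
have half y : eqv y (- y) -> U y.
  rewrite /eqv_mod opprK -mulr2n -scaler_nat => /(subspaceZ (1 / 2) relS) ry; apply: rU.
  by move: ry; rewrite scalerA (_ : 1 / 2 * 2%:R = 1) ?scale1r //; field.
have sorted a b c : (c <= b <= a)%N -> (a + b + c).+1 = k -> U << std a b c true false >>.
  move=> /andP[cb ba] abc.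
  have [E|ncb] := eqVneq c b.
    by subst c; apply: half; apply: (std_swap23 m_even N_even N_gt0 (n0 a b b)).
  have [E|nba] := eqVneq b a.
    by subst b; apply: half; apply: (std_swap12 m_even N_even N_gt0 (n0 a a c)).
  have ltc : (c < b)%N by rewrite ltn_neqAle ncb.
  have ltb : (b < a)%N by rewrite ltn_neqAle nba.
  have ak : (a < k)%N by rewrite -abc ltnS -addnA leq_addr.
  have bk : (b < k)%N by apply: ltn_trans ak.
  have ck : (c < k)%N by apply: ltn_trans bk.
  pose t0 : triple := (Ordinal ak, Ordinal bk, Ordinal ck).
  have st0 : strict t0 by rewrite /strict /= ltc ltb abc eqxx.
  exists (fun t => (t == t0)%:R).
  rewrite /strict_sum (bigD1 t0) //= eqxx scale1r big1 ?addr0; first exact: eqv_refl.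
  by move=> t /andP[_ /negbTE ->]; rewrite scale0r.
apply: (chains_min m_even N_even N_gt0 _ sU rU) => // a b c E.
have {E} E : (a + b + c).+1 = k by rewrite -E.
case/orP: (leq_total a b) => ab; case/orP: (leq_total b c) => bc; case/orP: (leq_total a c) => ac.
- apply: (s12); apply: (s23); apply: (s12); apply: (sorted); [by rewrite ab bc | by rewrite -E; clear; lia].
- apply: (s12); apply: (s23); apply: (s12); apply: (sorted); [by rewrite ab bc | by rewrite -E; clear; lia].
- apply: (s12); apply: (s23); apply: (sorted); [by rewrite ac bc | by rewrite -E; clear; lia].
- apply: (s12); apply: (sorted); [by rewrite ac ab | by rewrite -E; clear; lia].
- apply: (s23); apply: (s12); apply: (sorted); [by rewrite ac ab | by rewrite -E; clear; lia].
- apply: (s23); apply: (sorted); [by rewrite ac bc | by rewrite -E; clear; lia].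
- apply: (sorted); [by rewrite bc ab | by []].
- apply: (sorted); [by rewrite bc ab | by []].
Qed.

(** For A > B > C this is the alternating function dual to the basis element with these
    exponents. *)
Definition indicator (A B C : nat) : nat -> nat -> nat -> rat :=
  det3 (fun n => (n == A)%:R) (fun n => (n == B)%:R) (fun n => (n == C)%:R).

Lemma indicator_sorted A B C a b c : (C < B < A)%N -> (c <= b <= a)%N ->
  indicator A B C a b c = [&& a == A, b == B & c == C]%:R.
Proof.
move=> /andP[CB BA] /andP[cb ba]; have ca := leq_trans cb ba.
have perm0 x y z : (x <= y)%N || (y <= z)%N -> [&& x == A, y == B & z == C] = false.
  move=> xyz; apply/and3P => -[/eqP xA /eqP yB /eqP zC]; move: xyz.
  by rewrite xA yB zC leqNgt BA leqNgt CB.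
rewrite /indicator /det3 -!natrM !mulnb -!andbA.
by rewrite (perm0 b a c) ?ba // (perm0 b c a) ?ca ?orbT // (perm0 c b a) ?cb //
  (perm0 c a b) ?ca // (perm0 a c b) ?cb ?orbT // !mulr0n !(subr0, addr0).
Qed.

(** Multiplication by e1 sends the leading exponent (a, b, c) to (a + 1, b, c), so distinct basis
    elements have distinct leading terms and every coefficient of a cycle vanishes. *)
Lemma homology1_even : homology_dim m N 1 k 0.
Proof.
apply: quotient_dim0 => x [cx rx]; apply: rel_boundaries.
have [c Ec] := chains1_strict cx.
suff c0 t : strict t -> c t = 0.
  apply: (rel_eqv Ec); rewrite /strict_sum big1; first by case: relS.
  by move=> t /c0 ->; exact: scale0r.
(* Downward induction on the first exponent: larger first exponents are dealt with already. *)
have [n] := ubnP (k - t.1.1); elim: n t => // n IHn t0; rewrite ltnS => t0n st0.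
have /and3P[ltc ltb /eqP sum0] := st0.
pose g := indicator t0.1.1.+1 t0.1.2 t0.2.
have sW : sym_weight (even_weight 0 g) by apply: even_weight_sym => //; apply: det3_antisym.
have iF := phi_invariant sW; set F := phi _ in iF.
have ev_std a b d : (a + b + d)%N = k -> (d <= b <= a)%N ->
    ev F << std a b d false false >> = [&& a == t0.1.1.+1, b == t0.1.2 & d == t0.2 :> nat]%:R.
  move=> abd dba; rewrite evU /F phi_std // ?abd // /even_weight /= addn0 (addnA a) abd k_even.
  by rewrite /g indicator_sorted // ltc ltnS ltnW.
have := ev_boundary F x; rewrite (ev_rel m_even N_even N_gt0 iF rx).
rewrite (ev_eqv m_even N_even N_gt0 (bdry_functional_invariant iF) Ec) ev_lincomb (bigD1 t0) //=.
have bd (t : triple) : strict t -> ev (bdry_functional F) << std t.1.1 t.1.2 t.2 true false >> =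
    [&& t.1.1.+1 == t0.1.1.+1, t.1.2 == t0.1.2 :> nat & t.2 == t0.2 :> nat]%:R +
    [&& t.1.1 == t0.1.1.+1 :> nat, t.1.2.+1 == t0.1.2 & t.2 == t0.2 :> nat]%:R +
    [&& t.1.1 == t0.1.1.+1 :> nat, t.1.2 == t0.1.2 :> nat & t.2.+1 == t0.2]%:R.
  move=> /and3P[t21 t10 /eqP tk]; rewrite -ev_boundary.
  rewrite (ev_eqv m_even N_even N_gt0 iF (boundary_std10 m_even N_even N_gt0 _ _ _)).
  apply: ev_sum3; apply: ev_std; rewrite ?addnS ?addSn //.
  - by rewrite (ltnW t21) ltnW // ltnS ltnW.
  - by rewrite t10 ltnW // ltnS ltnW.
  - by rewrite t21 ltnW.
rewrite big1 ?addr0 => [|t /andP[st tt0]].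
  rewrite bd // !eqxx ltn_eqF //= !addr0 mulr1 => <-.
  by [].
(* The terms raising the second or third exponent of [t] can only match if its first exponent is one
   more than that of [t0], and then its coefficient vanishes by induction. The term raising the
   first exponent matches only for [t = t0]. *)
rewrite bd //; have [E|ne] := eqVneq (t.1.1 : nat) t0.1.1.+1.
  by rewrite IHn ?mul0r // E; have := ltn_ord t.1.1; clear -t0n E; lia.
rewrite /= !addr0; case: and3P => [[/eqP E1 /eqP E2 /eqP E3]|]; last by rewrite mulr0.
case/eqP: tt0; case: t t0 {bd st0 st ltc ltb sum0 g sW F iF ev_std IHn t0n ne} E1 E2 E3 => -[t1 t2] t3 [[s1 s2] s3] /= [] E1 E2 E3.
by congr (_, _, _); apply: val_inj.
Qed.

End Injectivity.

Local Close Scope ring_scope.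

Theorem theorem6p2 (m N : nat) (m_gt0 : 0 < m) (N_gt0 : 0 < N)
    (m_even : ~~ odd m) (N_even : ~~ odd N) (k : nat) (k_ge1 : 1 <= k) :
  homology_dim m N 0 k (if odd k then 0 else k %/ 6) /\
  homology_dim m N 1 k (if odd k then k %/ 6 else 0).
Proof.
have [ok|ek] := boolP (odd k).
  have kE : k = k./2.*2.+1 by rewrite -[LHS]odd_double_half ok.
  split; first exact: homology0_odd.
  have -> : k %/ 6 = k./2 %/ 3 by lia.
  exact: homology1_odd.
have kE : k = k./2.*2 by rewrite -[LHS]odd_double_half (negbTE ek).
split; last exact: homology1_even.
have -> : k %/ 6 = k./2 %/ 3 by lia.
exact: homology0_even.
Qed.
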